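(* Let $A$ be a twisted commutative algebra, considered as a polynomial functor, and let $I$ be a $\mathrm{GL}$-ideal of $A$. Then the ideal $\mathrm{rad}_{\mathrm{GL}}(I)$ is $\mathrm{GL}$-prime if and only if the ideal $\mathrm{rad}(I(\mathbf{Q}^{\infty|\infty}))$ of $A(\mathbf{Q}^{\infty|\infty})$ is prime.
   Context: Polynomial functors. Vector spaces are over $\mathbf{Q}$. Let $T_n$ be the functor $V \mapsto V^{\otimes n}$. An endofunctor of the category of $\mathbf{Q}$-vector spaces is polynomial if it is a subquotient of a (possibly infinite) direct sum of functors $T_n$. The category $\mathbf{Pol}$ of polynomial functors is semisimple abelian, closed under (pointwise) tensor products, with simple objects the Schur functors $\mathbf{S}_\lambda$. A polynomial functor can be evaluated on super vector spaces, by evaluating Schur functors there using the tensor product and symmetry of super vector spaces. Here $\mathbf{Q}^{r|s}$ is the super vector space with even part $\mathbf{Q}^r$ and odd part $\mathbf{Q}^s$, and $\mathbf{Q}^{\infty|\infty}=\bigcup_{r,s}\mathbf{Q}^{r|s}$. Twisted commutative algebras (tca's). A tca is a commutative (unital) algebra object $A$ of $\mathbf{Pol}$. Then $A(\mathbf{Q}^{\infty|\infty})$ is a supercommutative $\mathbf{Q}$-algebra. A subrepresentation of $A$ is a subobject of $A$ in $\mathbf{Pol}$. For subrepresentations $V,W$ of $A$, $VW$ is the image of $V\otimes W\to A$, and $V^n$ is the image of $V^{\otimes n}\to A$. A $\mathrm{GL}$-ideal of $A$ is a subobject that is an ideal. A $\mathrm{GL}$-prime is a proper $\mathrm{GL}$-ideal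 $\mathfrak p$ such that $VW\subset\mathfrak p$ implies $V\subset\mathfrak p$ or $W\subset\mathfrak p$, for all subrepresentations $V,W$ of $A$. The $\mathrm{GL}$-radical $\mathrm{rad}_{\mathrm{GL}}(I)$ of a $\mathrm{GL}$-ideal $I$ is the sum of all subrepresentations $V$ of $A$ such that $V^n\subset I$ for some $n$. For an ideal $\mathfrak a$ of a supercommutative ring, $\mathrm{rad}(\mathfrak a)$ is the ordinary radical, i.e. the set of elements having some power in $\mathfrak a$; an ideal is prime if it is proper and $xy\in\mathfrak a$ implies $x\in\mathfrak a$ or $y\in\mathfrak a$. *)

(* Defs.v *)
From HB Require Import structures.
From mathcomp Require Import all_boot all_order all_algebra perm.
From mathcomp Require Import boolp.

Set Implicit Arguments.
Unset Strict Implicit.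
Unset Printing Implicit Defensive.

Import GRing.Theory.
Local Open Scope ring_scope.
Local Open Scope quotient_scope.

(* [univ P] is the Q-vector space which is universal for the maps [f : X -> W]
   satisfying [P].  Its elements are formal linear combinations of elements of
   [X], two of them being identified when every map satisfying [P] gives them
   the same value; when [P] is a family of linear equations, this is the free
   vector space on [X] modulo the corresponding relations. *)
Section Univ.
Variables (X : Type) (P : forall W : lmodType rat, (X -> W) -> Prop).

Definition fsum := seq (rat * {classic X}).

Definition fval (W : lmodType rat) (f : X -> W) (s : fsum) : W :=
  \sum_(p <- s) p.1 *: f p.2.

Definition fequiv (s t : fsum) : bool :=
  `[< forall (W : lmodType rat) (f : X -> W), P f -> fval f s = fval f t >].

Lemma fequiv_refl : reflexive fequiv.
Proof. by move=> s; apply/asboolP. Qed.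

Lemma fequiv_sym : symmetric fequiv.
Proof.
by move=> s t; apply/asboolP/asboolP => h W f Pf; rewrite (h W f Pf).
Qed.

Lemma fequiv_trans : transitive fequiv.
Proof.
move=> t s r /asboolP h1 /asboolP h2; apply/asboolP => W f Pf.
by rewrite (h1 W f Pf) (h2 W f Pf).
Qed.

Canonical fequiv_equiv := EquivRel fequiv fequiv_refl fequiv_sym fequiv_trans.

Definition univ : Type := {eq_quot fequiv}.
HB.instance Definition _ := Choice.on univ.
HB.instance Definition _ := Quotient.on univ.

Lemma univ_eqP (s t : fsum) :
  (forall (W : lmodType rat) (f : X -> W), P f -> fval f s = fval f t) <->
  \pi_univ s = \pi_univ t.
Proof.
split=> [h|/eqmodP/asboolP //].
by apply/eqmodP/asboolP.
Qed.

Lemma fval_nil (W : lmodType rat) (f : X -> W) : fval f [::] = 0.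
Proof. by rewrite /fval big_nil. Qed.

Lemma fval_cons (W : lmodType rat) (f : X -> W) p s : fval f (p :: s) = p.1 *: f p.2 + fval f s.
Proof. by rewrite /fval big_cons. Qed.

Lemma fval_cat (W : lmodType rat) (f : X -> W) s t : fval f (s ++ t) = fval f s + fval f t.
Proof. by rewrite /fval big_cat. Qed.

Definition fscale (a : rat) (s : fsum) : fsum := [seq (a * p.1, p.2) | p <- s].

Lemma fval_scale (W : lmodType rat) (f : X -> W) a s : fval f (fscale a s) = a *: fval f s.
Proof.
rewrite /fval /fscale big_map scaler_sumr.
by apply: eq_bigr => p _; rewrite scalerA.
Qed.

Lemma fval_repr (W : lmodType rat) (f : X -> W) s : P f -> fval f (repr (\pi_univ s)) = fval f s.
Proof. by move=> Pf; apply: (proj2 (univ_eqP _ _)); rewrite ?reprK. Qed.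

Definition univ_add (x y : univ) : univ := \pi_univ (repr x ++ repr y).
Definition univ_scale (a : rat) (x : univ) : univ := \pi_univ (fscale a (repr x)).
Definition univ_zero : univ := \pi_univ [::].
Definition univ_opp (x : univ) : univ := univ_scale (-1) x.

Lemma univ_addE s t : univ_add (\pi_univ s) (\pi_univ t) = \pi_univ (s ++ t).
Proof. by apply/univ_eqP => W f Pf; rewrite !fval_cat !fval_repr. Qed.

Lemma univ_scaleE a s : univ_scale a (\pi_univ s) = \pi_univ (fscale a s).
Proof. by apply/univ_eqP => W f Pf; rewrite !fval_scale !fval_repr. Qed.

Lemma univ_ind0 (Q : univ -> Prop) : (forall s, Q (\pi_univ s)) -> forall x, Q x.
Proof. by move=> h x; rewrite -[x]reprK. Qed.

Lemma univ_addA : associative univ_add.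
Proof.
elim/univ_ind0=> x; elim/univ_ind0=> y; elim/univ_ind0=> z.
by rewrite !univ_addE catA.
Qed.

Lemma univ_addC : commutative univ_add.
Proof.
elim/univ_ind0=> x; elim/univ_ind0=> y; rewrite !univ_addE.
by apply/univ_eqP => W f _; rewrite !fval_cat addrC.
Qed.

Lemma univ_add0 : left_id univ_zero univ_add.
Proof. by elim/univ_ind0=> x; rewrite univ_addE. Qed.

Lemma univ_addN : left_inverse univ_zero univ_opp univ_add.
Proof.
elim/univ_ind0=> x; rewrite /univ_opp univ_scaleE univ_addE.
by apply/univ_eqP => W f _; rewrite fval_cat fval_scale fval_nil scaleN1r addNr.
Qed.

HB.instance Definition _ :=
  GRing.isZmodule.Build univ univ_addA univ_addC univ_add0 univ_addN.

Lemma univ_scaleA a b x : univ_scale a (univ_scale b x) = univ_scale (a * b) x.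
Proof.
elim/univ_ind0: x => s; rewrite !univ_scaleE.
by apply/univ_eqP => W f _; rewrite !fval_scale scalerA.
Qed.

Lemma univ_scale1 : left_id 1 univ_scale.
Proof.
elim/univ_ind0=> s; rewrite univ_scaleE.
by apply/univ_eqP => W f _; rewrite fval_scale scale1r.
Qed.

Lemma univ_scaleDr : right_distributive univ_scale +%R.
Proof.
move=> a; elim/univ_ind0=> s; elim/univ_ind0=> t.
rewrite /GRing.add /= univ_addE !univ_scaleE univ_addE.
by apply/univ_eqP => W f _; rewrite !(fval_scale, fval_cat) scalerDr.
Qed.

Lemma univ_scaleDl x : {morph univ_scale^~ x : a b / a + b}.
Proof.
move=> a b; elim/univ_ind0: x => s.
rewrite [RHS]/GRing.add /= !univ_scaleE univ_addE.
by apply/univ_eqP => W f _; rewrite !(fval_scale, fval_cat) scalerDl.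
Qed.

HB.instance Definition _ := GRing.Zmodule_isLmodule.Build rat univ
  univ_scaleA univ_scale1 univ_scaleDr univ_scaleDl.

Definition ugen (x : X) : univ := \pi_univ [:: (1, x : {classic X})].

Definition ulift (W : lmodType rat) (f : X -> W) (Pf : P f) (x : univ) : W :=
  fval f (repr x).

Lemma ulift_is_linear (W : lmodType rat) (f : X -> W) (Pf : P f) : linear (ulift Pf).
Proof.
move=> a; elim/univ_ind0=> s; elim/univ_ind0=> t.
rewrite /ulift {1}/GRing.scale {1}/GRing.add /= univ_scaleE univ_addE.
by rewrite !fval_repr // fval_cat fval_scale.
Qed.

HB.instance Definition _ (W : lmodType rat) (f : X -> W) (Pf : P f) :=
  GRing.isLinear.Build rat univ W *:%R (ulift Pf) (ulift_is_linear Pf).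

Lemma ulift_gen (W : lmodType rat) (f : X -> W) (Pf : P f) x : ulift Pf (ugen x) = f x.
Proof.
by rewrite /ulift fval_repr // fval_cons fval_nil scale1r addr0.
Qed.

Lemma pi_fsum (s : fsum) : \pi_univ s = fval ugen s.
Proof.
elim: s => [|[a x] s IH]; first by rewrite fval_nil.
rewrite fval_cons -IH [RHS]/GRing.add /= [in RHS]/GRing.scale /=.
rewrite univ_scaleE univ_addE /=.
by apply/univ_eqP => W f _; rewrite !fval_cons mulr1.
Qed.

Lemma univ_ind (Q : univ -> Prop) :
  (forall a x y, Q y -> Q (a *: ugen x + y)) -> Q 0 -> forall x, Q x.
Proof.
move=> hc h0; elim/univ_ind0=> s; rewrite pi_fsum.
elim: s => [|[a x] s IH]; first by rewrite fval_nil.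
by rewrite fval_cons; apply: hc.
Qed.

Lemma ulift_uniq (W : lmodType rat) (g h : {linear univ -> W}) :
  (forall x, g (ugen x) = h (ugen x)) -> g =1 h.
Proof.
move=> gh; elim/univ_ind => [a x y IH|]; last by rewrite !linear0.
by rewrite !linearP gh IH.
Qed.

Lemma univ_sep (x y : univ) :
  (forall (W : lmodType rat) (f : X -> W) (Pf : P f), ulift Pf x = ulift Pf y) -> x = y.
Proof.
by move=> h; rewrite -[x]reprK -[y]reprK; apply/univ_eqP => W f Pf; exact: (h W f Pf).
Qed.

End Univ.

Arguments ugen {X} P x.

Record functor := Functor {
  fobj :> lmodType rat -> lmodType rat;
  fmap : forall V W : lmodType rat, {linear V -> W} -> {linear fobj V -> fobj W};
  fmap_id : forall (V : lmodType rat) (x : fobj V), fmap (idfun : V -> V) x = x;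
  fmap_comp : forall (U V W : lmodType rat) (g : {linear V -> W})
    (f : {linear U -> V}) (x : fobj U), fmap (g \o f) x = fmap g (fmap f x)
}.
Arguments fmap F {V W} f : rename.

Record ntrans (F G : functor) := NTrans {
  ntcomp :> forall V : lmodType rat, {linear F V -> G V};
  ntnat : forall (V W : lmodType rat) (f : {linear V -> W}) (x : F V),
    ntcomp W (fmap F f x) = fmap G f (ntcomp V x)
}.

Lemma linear_ext (V W : lmodType rat) (f g : {linear V -> W}) : f =1 g -> f = g.
Proof.
case: f g => [f [[fa] [fb]]] [g [[ga] [gb]]] /= /funext fg.
move: fg fa fb ga gb => -> fa fb ga gb.
by rewrite (Prop_irrelevance fa ga) (Prop_irrelevance fb gb).
Qed.

Lemma fmap_ext (F : functor) (V W : lmodType rat) (f g : {linear V -> W}) x :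
  f =1 g -> fmap F f x = fmap F g x.
Proof. by move=> /linear_ext ->. Qed.

Definition upd (I : eqType) (T : Type) (v : I -> T) (i : I) (x : T) : I -> T :=
  fun j => if j == i then x else v j.

Definition multilinear (n : nat) (V W : lmodType rat)
    (f : ('I_n -> V) -> W) : Prop :=
  forall (v : 'I_n -> V) (i : 'I_n) (a : rat) (x y : V),
    f (upd v i (a *: x + y)) = a *: f (upd v i x) + f (upd v i y).

Definition tpow_obj (n : nat) (V : lmodType rat) : lmodType rat :=
  univ (@multilinear n V).

Definition ptens (n : nat) (V : lmodType rat) (v : 'I_n -> V) : tpow_obj n V :=
  ugen (@multilinear n V) v.

Lemma ptens_multilinear n V : multilinear (@ptens n V).
Proof.
move=> v i a x y; apply: univ_sep => W f Pf.
by rewrite linearP /= /ptens !ulift_gen Pf.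
Qed.

Lemma comp_upd (I : eqType) (S T : Type) (f : S -> T) (v : I -> S) i x :
  (fun j => f (upd v i x j)) = upd (fun j => f (v j)) i (f x).
Proof. by apply/funext => j; rewrite /upd; case: eqP. Qed.

Lemma tpow_mapP n (V W : lmodType rat) (f : {linear V -> W}) :
  multilinear (fun v : 'I_n -> V => ptens (fun i => f (v i))).
Proof.
by move=> v i a x y; rewrite !comp_upd linearP ptens_multilinear.
Qed.

Definition tpow_map n (V W : lmodType rat) (f : {linear V -> W}) :
  {linear tpow_obj n V -> tpow_obj n W} := ulift (@tpow_mapP n V W f).

Lemma tpow_map_id n (V : lmodType rat) (x : tpow_obj n V) : tpow_map n (idfun : V -> V) x = x.
Proof.
rewrite -[RHS]/(idfun x); apply: ulift_uniq x => v.
by rewrite /tpow_map /= ulift_gen.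
Qed.

Lemma tpow_map_comp n (U V W : lmodType rat) (g : {linear V -> W})
    (f : {linear U -> V}) (x : tpow_obj n U) :
  tpow_map n (g \o f) x = tpow_map n g (tpow_map n f x).
Proof.
rewrite -[RHS]/((tpow_map n g \o tpow_map n f) x); apply: ulift_uniq x => v.
by rewrite /tpow_map /= !ulift_gen.
Qed.

(* The functor T_n : V |-> V^{(x) n}. *)
Definition tpow (n : nat) : functor :=
  Functor (@tpow_map_id n) (@tpow_map_comp n).

Section DirectSum.
Variables (J : Type) (F : J -> functor).

Definition dsum_univ (V W : lmodType rat) (f : {j : J & F j V} -> W) : Prop :=
  forall (j : J) (a : rat) (x y : F j V),
    f (existT _ j (a *: x + y)) = a *: f (existT _ j x) + f (existT _ j y).

Definition dsum_obj (V : lmodType rat) : lmodType rat := univ (@dsum_univ V).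

Definition dinj (V : lmodType rat) (p : {j : J & F j V}) : dsum_obj V :=
  ugen (@dsum_univ V) p.

Lemma dinjP V : dsum_univ (@dinj V).
Proof.
move=> j a x y; apply: univ_sep => W f Pf.
by rewrite linearP /= /dinj !ulift_gen Pf.
Qed.

Lemma dsum_mapP (V W : lmodType rat) (f : {linear V -> W}) :
  dsum_univ (fun p : {j : J & F j V} =>
    dinj (existT _ (tag p) (fmap (F (tag p)) f (tagged p)))).
Proof. by move=> j a x y; rewrite /= linearP dinjP. Qed.

Definition dsum_map (V W : lmodType rat) (f : {linear V -> W}) :
  {linear dsum_obj V -> dsum_obj W} := ulift (dsum_mapP f).

Lemma dsum_map_id (V : lmodType rat) (x : dsum_obj V) : dsum_map (idfun : V -> V) x = x.
Proof.
rewrite -[RHS]/(idfun x); apply: ulift_uniq x => -[j x].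
by rewrite /dsum_map /= ulift_gen /= fmap_id.
Qed.

Lemma dsum_map_comp (U V W : lmodType rat) (g : {linear V -> W})
    (f : {linear U -> V}) (x : dsum_obj U) :
  dsum_map (g \o f) x = dsum_map g (dsum_map f x).
Proof.
rewrite -[RHS]/((dsum_map g \o dsum_map f) x); apply: ulift_uniq x => -[j x].
by rewrite /dsum_map /= !ulift_gen /= fmap_comp.
Qed.

Definition dsum : functor := Functor dsum_map_id dsum_map_comp.

End DirectSum.

(* A subquotient of [S] is a quotient [q : G ->> F] of a subobject
   [i : G >-> S]. *)
Definition polynomial (F : functor) : Prop :=
  exists (J : Type) (d : J -> nat) (G : functor)
         (i : ntrans G (dsum (fun j => tpow (d j)))) (q : ntrans G F),
    (forall V, injective (i V)) /\ (forall V (y : F V), exists x, q V x = y).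

(* The tensor product of functors is pointwise, so the structure maps
   A (x) A -> A and Q -> A of a commutative algebra object are natural families
   of commutative bilinear products and of units.  The zero algebra is
   allowed. *)
Record tca := Tca {
  tfun :> functor;
  tca_polynomial : polynomial tfun;
  tmul : forall V : lmodType rat, tfun V -> tfun V -> tfun V;
  tone : forall V : lmodType rat, tfun V;
  tmul_linear : forall V a (x y z : tfun V),
    tmul (a *: x + y) z = a *: tmul x z + tmul y z;
  tmulC : forall V (x y : tfun V), tmul x y = tmul y x;
  tmulA : forall V (x y z : tfun V), tmul x (tmul y z) = tmul (tmul x y) z;
  tmul1 : forall V (x : tfun V), tmul (tone V) x = x;
  tmul_nat : forall (V W : lmodType rat) (f : {linear V -> W}) (x y : tfun V),
    fmap tfun f (tmul x y) = tmul (fmap tfun f x) (fmap tfun f y);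
  tone_nat : forall (V W : lmodType rat) (f : {linear V -> W}),
    fmap tfun f (tone V) = tone W
}.
Arguments tmul {A V} x y : rename.
Arguments tone A V : rename.

Definition lspan (M : lmodType rat) (S : M -> Prop) (x : M) : Prop :=
  exists (n : nat) (a : 'I_n -> rat) (v : 'I_n -> M),
    (forall i, S (v i)) /\ x = \sum_i a i *: v i.

Definition setfam (F : functor) := forall V : lmodType rat, F V -> Prop.

(* Subobjects of [F]; when [F] is polynomial, so are they. *)
Definition subfunctor (F : functor) (S : setfam F) : Prop :=
  [/\ forall V, S V 0,
      forall V a (x y : F V), S V x -> S V y -> S V (a *: x + y)
    & forall (V W : lmodType rat) (f : {linear V -> W}) x,
        S V x -> S W (fmap F f x)].

Definition subfam (F : functor) (S T : setfam F) : Prop :=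
  forall V x, S V x -> T V x.

Section GL.
Variable A : tca.

Definition fam_mul (S T : setfam A) : setfam A := fun V =>
  lspan (fun z => exists x y, [/\ S V x, T V y & z = tmul x y]).

(* [S^0] is the image of the unit Q -> A. *)
Fixpoint fam_pow (S : setfam A) (n : nat) : setfam A :=
  if n is m.+1 then fam_mul S (fam_pow S m)
  else fun V => lspan (fun z => z = tone A V).

Definition gl_ideal (I : setfam A) : Prop :=
  subfunctor I /\ forall V (x y : A V), I V y -> I V (tmul x y).

Definition gl_prime (p : setfam A) : Prop :=
  [/\ gl_ideal p,
      exists V x, ~ p V x
    & forall S T : setfam A, subfunctor S -> subfunctor T ->
        subfam (fam_mul S T) p -> subfam S p \/ subfam T p].

Definition gl_rad (I : setfam A) : setfam A := fun V =>
  lspan (fun x => exists (S : setfam A) (n : nat),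
    [/\ subfunctor S, subfam (fam_pow S n) I & S V x]).

End GL.

Record svect := SVect { sv_even : lmodType rat; sv_odd : lmodType rat }.

Definition homog (U : svect) : Type := (sv_even U + sv_odd U)%type.

Definition parity (U : svect) (u : homog U) : bool := if u is inr _ then true else false.

(* The super vector space Q^{oo|oo}; [{poly rat}] has basis ['X^i], i >= 0, and
   is the union of the spaces Q^r of polynomials of size at most r. *)
Definition Qinf : svect := SVect {poly rat} {poly rat}.

Section LinComb.
Variables (n : nat) (V : lmodType rat) (v : 'I_n -> V).

Definition lincomb (r : 'rV[rat]_n) : V := \sum_i r 0 i *: v i.

Lemma lincomb_is_linear : linear lincomb.
Proof.
move=> a r s; rewrite /lincomb scaler_sumr -big_split /=.
by apply: eq_bigr => i _; rewrite !mxE scalerDl scalerA.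
Qed.

HB.instance Definition _ :=
  GRing.isLinear.Build rat 'rV[rat]_n V *:%R lincomb lincomb_is_linear.

Lemma lincomb_delta i : lincomb (delta_mx 0 i) = v i.
Proof.
rewrite /lincomb (bigD1 i) //= !mxE !eqxx scale1r big1 ?addr0 // => j ji.
by rewrite !mxE (negbTE ji) andbF scale0r.
Qed.

End LinComb.

(* An element [m] of F(Q^n) defines the natural operation
   (v_1, ..., v_n) |-> [opval m v] in F(V), namely the image of [m] under the
   linear map Q^n -> V with e_i |-> v_i.  By the Yoneda lemma every natural
   transformation from V |-> V^n to F arises from a unique [m], so the [m]
   satisfying [multilinear_op] are exactly the elements of Hom(T_n, F). *)
Definition opval (F : functor) (n : nat) (m : F 'rV[rat]_n) (V : lmodType rat)
    (v : 'I_n -> V) : F V :=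
  fmap F (lincomb v) m.

Definition multilinear_op (F : functor) (n : nat) (m : F 'rV[rat]_n) : Prop :=
  forall V : lmodType rat, multilinear (fun v : 'I_n -> V => opval m v).

(* The operation v |-> m(v o s). *)
Definition perm_op (F : functor) (n : nat) (m : F 'rV[rat]_n) (s : 'S_n) :
    F 'rV[rat]_n :=
  opval m (fun i => delta_mx 0 (s i)).

Section OpVal.
Variable F : functor.

Lemma fmap_opval n (m : F 'rV[rat]_n) (V W : lmodType rat) (f : {linear V -> W})
    (v : 'I_n -> V) :
  fmap F f (opval m v) = opval m (fun i => f (v i)).
Proof.
rewrite /opval -fmap_comp; apply: fmap_ext => r /=.
by rewrite /lincomb linear_sum; apply: eq_bigr => i _; rewrite linearZ.
Qed.

Lemma opval_opval n k (m : F 'rV[rat]_n) (w : 'I_n -> 'rV[rat]_k)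
    (V : lmodType rat) (v : 'I_k -> V) :
  opval (opval m w) v = opval m (fun i => lincomb v (w i)).
Proof. exact: fmap_opval. Qed.

Lemma opval_delta n (m : F 'rV[rat]_n) : opval m (fun i => delta_mx 0 i) = m.
Proof.
rewrite -[RHS]fmap_id; apply: fmap_ext => r /=.
by rewrite [RHS]row_sum_delta.
Qed.

Lemma opval_perm n (m : F 'rV[rat]_n) (s : 'S_n) (V : lmodType rat)
    (v : 'I_n -> V) :
  opval (perm_op m s) v = opval m (v \o s).
Proof.
rewrite /perm_op opval_opval; congr (opval m _); apply/funext => i /=.
exact: lincomb_delta.
Qed.

Lemma opval_linear n (V : lmodType rat) (v : 'I_n -> V) a (m1 m2 : F 'rV[rat]_n) :
  opval (a *: m1 + m2) v = a *: opval m1 v + opval m2 v.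
Proof. exact: linearP. Qed.

End OpVal.

(* F(U) is the direct sum over n of the coinvariants of S_n on
   Hom(T_n, F) (x) T_n(U), where S_n acts on T_n(U) through the symmetry of super
   vector spaces.  This is functorial and additive in F, and for F = S_lambda it
   is the usual Schur functor of U, as Hom(T_n, S_lambda) is the Specht module
   of lambda, placed in degree n = |lambda|.

   F(U) is generated by the symbols m(u_1, ..., u_n) with m in Hom(T_n, F) and
   u_i homogeneous in U.  They are linear in m and in each u_i; and transposing
   two adjacent arguments produces the sign of the symmetry.
   Adjacent transpositions generate S_n, so no further relation is needed. *)
Record sgen (F : functor) (U : svect) := SGen {
  sg_ar : nat;
  sg_op : F 'rV[rat]_sg_ar;
  sg_opP : multilinear_op sg_op;
  sg_args : 'I_sg_ar -> homog U
}.
Arguments SGen {F U sg_ar sg_op} sg_opP sg_args.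
Arguments sg_opP {F U} s : rename.
Arguments sg_args {F U} s : rename.

Record super_rel (F : functor) (U : svect) (W : lmodType rat)
    (f : sgen F U -> W) : Prop := SuperRel {
  sr_op : forall n (a : rat) (m m1 m2 : F 'rV[rat]_n) (Pm : multilinear_op m)
      (Pm1 : multilinear_op m1) (Pm2 : multilinear_op m2) (u : 'I_n -> homog U),
    m = a *: m1 + m2 ->
    f (SGen Pm u) = a *: f (SGen Pm1 u) + f (SGen Pm2 u);
  sr_even : forall n (m : F 'rV[rat]_n) (Pm : multilinear_op m)
      (u : 'I_n -> homog U) (i : 'I_n) (a : rat) (x y : sv_even U),
    f (SGen Pm (upd u i (inl (a *: x + y)))) =
    a *: f (SGen Pm (upd u i (inl x))) + f (SGen Pm (upd u i (inl y)));
  sr_odd : forall n (m : F 'rV[rat]_n) (Pm : multilinear_op m)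
      (u : 'I_n -> homog U) (i : 'I_n) (a : rat) (x y : sv_odd U),
    f (SGen Pm (upd u i (inr (a *: x + y)))) =
    a *: f (SGen Pm (upd u i (inr x))) + f (SGen Pm (upd u i (inr y)));
  sr_sym : forall n (m : F 'rV[rat]_n) (i j : 'I_n)
      (Pm : multilinear_op m) (Pm' : multilinear_op (perm_op m (tperm i j)))
      (u : 'I_n -> homog U),
    j = i.+1 :> nat ->
    f (SGen Pm' u) =
    (-1) ^+ (parity (u i) && parity (u j)) *: f (SGen Pm (u \o tperm i j))
}.

Definition super_eval (F : functor) (U : svect) : Type :=
  univ (@super_rel F U).
HB.instance Definition _ F U := GRing.Lmodule.on (super_eval F U).

Definition sgval (F : functor) (U : svect) (g : sgen F U) : super_eval F U :=
  ugen (@super_rel F U) g.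

Lemma sgvalP F U : super_rel (@sgval F U).
Proof.
split.
- move=> n a m m1 m2 Pm Pm1 Pm2 u e; apply: univ_sep => W f Pf.
  by rewrite linearP /= /sgval !ulift_gen; apply: (sr_op Pf).
- move=> n m Pm u i a x y; apply: univ_sep => W f Pf.
  by rewrite linearP /= /sgval !ulift_gen; apply: (sr_even Pf).
- move=> n m Pm u i a x y; apply: univ_sep => W f Pf.
  by rewrite linearP /= /sgval !ulift_gen; apply: (sr_odd Pf).
- move=> n m i j Pm Pm' u ij; apply: univ_sep => W f Pf.
  by rewrite linearZ /= /sgval !ulift_gen; apply: (sr_sym Pf).
Qed.

(* If [I] is a subfunctor of [F], this is the image of I(U) in F(U). *)
Definition super_sub (F : functor) (I : setfam F) (U : svect) :
    super_eval F U -> Prop :=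
  lspan (fun x => exists g : sgen F U, I _ (sg_op g) /\ x = sgval g).

Section SuperAlgebra.
Variables (A : tca) (U : svect).

Lemma tmul_linear_r V a (x y z : A V) :
  tmul x (a *: y + z) = a *: tmul x y + tmul x z.
Proof. by rewrite tmulC tmul_linear !(tmulC x). Qed.

(* (v_1, ..., v_(n+k)) |-> m(v_1, ..., v_n) * m'(v_(n+1), ..., v_(n+k)) *)
Definition op_mul (n k : nat) (m : A 'rV[rat]_n) (m' : A 'rV[rat]_k) :
    A 'rV[rat]_(n + k) :=
  tmul (opval m (fun i => delta_mx 0 (lshift k i)))
       (opval m' (fun i => delta_mx 0 (rshift n i))).

Lemma op_mulE n k (m : A 'rV[rat]_n) (m' : A 'rV[rat]_k) :
  op_mul m m' =
  tmul (opval m (fun i => delta_mx 0 (lshift k i)))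
       (opval m' (fun i => delta_mx 0 (rshift n i))).
Proof. by []. Qed.

Lemma opval_mul n k (m : A 'rV[rat]_n) (m' : A 'rV[rat]_k) (V : lmodType rat)
    (v : 'I_(n + k) -> V) :
  opval (op_mul m m') v =
  tmul (opval m (fun i => v (lshift k i))) (opval m' (fun i => v (rshift n i))).
Proof.
rewrite [LHS]tmul_nat !fmap_opval.
by congr tmul; congr opval; apply/funext => i; exact: lincomb_delta.
Qed.

Lemma upd_lshift_l n k (T : Type) (v : 'I_(n + k) -> T) i x :
  (fun j => upd v (lshift k i) x (lshift k j)) = upd (fun j => v (lshift k j)) i x.
Proof. by apply/funext => j; rewrite /upd (inj_eq (@lshift_inj _ _)). Qed.

Lemma upd_lshift_r n k (T : Type) (v : 'I_(n + k) -> T) i x :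
  (fun j => upd v (lshift k i) x (rshift n j)) = (fun j => v (rshift n j)).
Proof. by apply/funext => j; rewrite /upd eq_rlshift. Qed.

Lemma upd_rshift_l n k (T : Type) (v : 'I_(n + k) -> T) i x :
  (fun j => upd v (rshift n i) x (lshift k j)) = (fun j => v (lshift k j)).
Proof. by apply/funext => j; rewrite /upd eq_lrshift. Qed.

Lemma upd_rshift_r n k (T : Type) (v : 'I_(n + k) -> T) i x :
  (fun j => upd v (rshift n i) x (rshift n j)) = upd (fun j => v (rshift n j)) i x.
Proof. by apply/funext => j; rewrite /upd (inj_eq (@rshift_inj _ _)). Qed.

Lemma op_mulP n k (m : A 'rV[rat]_n) (m' : A 'rV[rat]_k) :
  multilinear_op m -> multilinear_op m' -> multilinear_op (op_mul m m').
Proof.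
move=> Pm Pm' V v i a x y; rewrite !opval_mul; case: (split_ordP i) => j ->.
  by rewrite !upd_lshift_l !upd_lshift_r Pm tmul_linear.
by rewrite !upd_rshift_l !upd_rshift_r Pm' tmul_linear_r.
Qed.

Definition args_cat (T : Type) n k (u : 'I_n -> T) (u' : 'I_k -> T) : 'I_(n + k) -> T :=
  fun i => match split i with inl j => u j | inr j => u' j end.

Lemma args_catl T n k (u : 'I_n -> T) (u' : 'I_k -> T) i :
  args_cat u u' (lshift k i) = u i.
Proof. by rewrite /args_cat (unsplitK (inl i)). Qed.

Lemma args_catr T n k (u : 'I_n -> T) (u' : 'I_k -> T) i :
  args_cat u u' (rshift n i) = u' i.
Proof. by rewrite /args_cat (unsplitK (inr i)). Qed.

Lemma args_cat_updl T n k (u : 'I_n -> T) (u' : 'I_k -> T) i x :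
  args_cat (upd u i x) u' = upd (args_cat u u') (lshift k i) x.
Proof.
apply/funext => j; case: (split_ordP j) => l ->; rewrite /upd !(args_catl, args_catr).
  by rewrite (inj_eq (@lshift_inj _ _)).
by rewrite eq_rlshift.
Qed.

Lemma args_cat_updr T n k (u : 'I_n -> T) (u' : 'I_k -> T) i x :
  args_cat u (upd u' i x) = upd (args_cat u u') (rshift n i) x.
Proof.
apply/funext => j; case: (split_ordP j) => l ->; rewrite /upd !(args_catl, args_catr).
  by rewrite eq_lrshift.
by rewrite (inj_eq (@rshift_inj _ _)).
Qed.

Lemma tperm_lshift_l n k (i j l : 'I_n) :
  tperm (lshift k i) (lshift k j) (lshift k l) = lshift k (tperm i j l).
Proof. by rewrite (inj_tperm _ _ _ (@lshift_inj _ _)). Qed.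

Lemma tperm_lshift_r n k (i j : 'I_n) (l : 'I_k) :
  tperm (lshift k i) (lshift k j) (rshift n l) = rshift n l.
Proof. by rewrite tpermD // eq_lrshift. Qed.

Lemma tperm_rshift_r n k (i j l : 'I_k) :
  tperm (rshift n i) (rshift n j) (rshift n l) = rshift n (tperm i j l).
Proof. by rewrite (inj_tperm _ _ _ (@rshift_inj _ _)). Qed.

Lemma tperm_rshift_l n k (i j : 'I_k) (l : 'I_n) :
  tperm (rshift n i) (rshift n j) (lshift k l) = lshift k l.
Proof. by rewrite tpermD // eq_rlshift. Qed.

Lemma op_mul_perml n k (m : A 'rV[rat]_n) (m' : A 'rV[rat]_k) i j :
  op_mul (perm_op m (tperm i j)) m' =
  perm_op (op_mul m m') (tperm (lshift k i) (lshift k j)).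
Proof.
rewrite /perm_op opval_mul /op_mul -/(perm_op _ _) opval_perm.
congr tmul; congr opval; apply/funext => l /=.
  by rewrite tperm_lshift_l.
by rewrite tperm_lshift_r.
Qed.

Lemma op_mul_permr n k (m : A 'rV[rat]_n) (m' : A 'rV[rat]_k) i j :
  op_mul m (perm_op m' (tperm i j)) =
  perm_op (op_mul m m') (tperm (rshift n i) (rshift n j)).
Proof.
rewrite /perm_op opval_mul /op_mul -/(perm_op _ _) opval_perm.
congr tmul; congr opval; apply/funext => l /=.
  by rewrite tperm_rshift_l.
by rewrite tperm_rshift_r.
Qed.

Lemma args_cat_tperml T n k (u : 'I_n -> T) (u' : 'I_k -> T) i j :
  args_cat (u \o tperm i j) u' =
  args_cat u u' \o tperm (lshift k i) (lshift k j).
Proof.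
apply/funext => l; case: (split_ordP l) => h -> /=.
  by rewrite tperm_lshift_l !args_catl.
by rewrite tperm_lshift_r !args_catr.
Qed.

Lemma args_cat_tpermr T n k (u : 'I_n -> T) (u' : 'I_k -> T) i j :
  args_cat u (u' \o tperm i j) =
  args_cat u u' \o tperm (rshift n i) (rshift n j).
Proof.
apply/funext => l; case: (split_ordP l) => h -> /=.
  by rewrite tperm_rshift_l !args_catl.
by rewrite tperm_rshift_r !args_catr.
Qed.

Lemma sgen_cast (F : functor) n n' (e : n = n') (m : F 'rV[rat]_n)
    (m' : F 'rV[rat]_n') (Pm : multilinear_op m) (Pm' : multilinear_op m')
    (u : 'I_n -> homog U) (u' : 'I_n' -> homog U) :
  m' = opval m (fun i => delta_mx 0 (cast_ord e i)) ->
  (forall i, u i = u' (cast_ord e i)) -> SGen Pm u = SGen Pm' u'.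
Proof.
case: _ / e m' Pm' u' => m' Pm' u' em eu.
have {}em : m' = m.
  by rewrite em -[RHS]opval_delta; congr opval; apply/funext => i; rewrite cast_ord_id.
have {}eu : u = u' by apply/funext => i; rewrite eu cast_ord_id.
by subst; congr SGen; apply: Prop_irrelevance.
Qed.

Lemma sgen_eq (F : functor) n (m m' : F 'rV[rat]_n)
    (Pm : multilinear_op m) (Pm' : multilinear_op m') (u u' : 'I_n -> homog U) :
  m = m' -> u = u' -> SGen Pm u = SGen Pm' u'.
Proof. by move=> em eu; subst; congr SGen; apply: Prop_irrelevance. Qed.

Definition sgen_mul (g h : sgen A U) : sgen A U :=
  SGen (op_mulP (sg_opP g) (sg_opP h)) (args_cat (sg_args g) (sg_args h)).

Lemma sgen_mul_rel_r (g : sgen A U) :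
  super_rel (fun h => sgval (sgen_mul g h)).
Proof.
split.
- move=> n a m m1 m2 Pm Pm1 Pm2 u e; apply: (sr_op (sgvalP _ _)) => /=.
  by rewrite e /op_mul opval_linear tmul_linear_r.
- move=> n m Pm u i a x y; rewrite /sgen_mul /= !args_cat_updr.
  exact: (sr_even (sgvalP _ _)).
- move=> n m Pm u i a x y; rewrite /sgen_mul /= !args_cat_updr.
  exact: (sr_odd (sgvalP _ _)).
- move=> n m i j Pm Pm' u ij; rewrite /sgen_mul /= args_cat_tpermr.
  have P' : multilinear_op (perm_op (op_mul (sg_op g) m)
      (tperm (rshift (sg_ar g) i) (rshift (sg_ar g) j))).
    by rewrite -op_mul_permr; apply: op_mulP => //; exact: sg_opP.
  rewrite (sgen_eq _ P' (op_mul_permr _ _ _ _) (erefl _)).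
  rewrite (sr_sym (sgvalP _ _) (op_mulP (sg_opP g) Pm)) ?args_catr //=.
  by rewrite ij addnS.
Qed.

Lemma sgen_mul_rel_l (h : sgen A U) :
  super_rel (fun g => sgval (sgen_mul g h)).
Proof.
split.
- move=> n a m m1 m2 Pm Pm1 Pm2 u e; apply: (sr_op (sgvalP _ _)) => /=.
  by rewrite e /op_mul opval_linear tmul_linear.
- move=> n m Pm u i a x y; rewrite /sgen_mul /= !args_cat_updl.
  exact: (sr_even (sgvalP _ _)).
- move=> n m Pm u i a x y; rewrite /sgen_mul /= !args_cat_updl.
  exact: (sr_odd (sgvalP _ _)).
- move=> n m i j Pm Pm' u ij; rewrite /sgen_mul /= args_cat_tperml.
  have P' : multilinear_op (perm_op (op_mul m (sg_op h))
      (tperm (lshift (sg_ar h) i) (lshift (sg_ar h) j))).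
    by rewrite -op_mul_perml; apply: op_mulP => //; exact: sg_opP.
  rewrite (sgen_eq _ P' (op_mul_perml _ _ _ _) (erefl _)).
  by rewrite (sr_sym (sgvalP _ _) (op_mulP Pm (sg_opP h))) ?args_catl.
Qed.

Lemma super_rel_comb (F : functor) (W : lmodType rat) (b : rat)
    (f f' : sgen F U -> W) :
  super_rel f -> super_rel f' -> super_rel (fun g => b *: f g + f' g).
Proof.
have E (a : rat) (p q r s : W) :
    b *: (a *: p + q) + (a *: r + s) = a *: (b *: p + r) + (b *: q + s).
  by rewrite !scalerDr !scalerA [b * a]mulrC addrACA.
move=> Pf Pf'; split.
- move=> n a m m1 m2 Pm Pm1 Pm2 u e.
  by rewrite (sr_op Pf _ Pm1 Pm2 _ e) (sr_op Pf' _ Pm1 Pm2 _ e) E.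
- by move=> n m Pm u i a x y; rewrite (sr_even Pf) (sr_even Pf') E.
- by move=> n m Pm u i a x y; rewrite (sr_odd Pf) (sr_odd Pf') E.
- move=> n m i j Pm Pm' u ij.
  by rewrite (sr_sym Pf Pm) // (sr_sym Pf' Pm) // scalerDr !scalerA [b * _]mulrC.
Qed.

Lemma super_rel0 (F : functor) (W : lmodType rat) :
  super_rel (fun _ : sgen F U => 0 : W).
Proof. by split=> *; rewrite ?scaler0 ?addr0. Qed.

Lemma super_mul_rel (y : super_eval A U) :
  super_rel (fun g => ulift (sgen_mul_rel_r g) y).
Proof.
elim/univ_ind: y => [a h y IH|].
  have -> : (fun g => ulift (sgen_mul_rel_r g) (a *: ugen _ h + y)) =
      (fun g => a *: sgval (sgen_mul g h) + ulift (sgen_mul_rel_r g) y).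
    by apply/funext => g; rewrite linearP /= ulift_gen.
  by apply: super_rel_comb => //; exact: sgen_mul_rel_l.
have -> : (fun g => ulift (sgen_mul_rel_r g) 0) = (fun _ => 0).
  by apply/funext => g; rewrite linear0.
exact: super_rel0.
Qed.

(* m(u) * m'(u') = (m m')(u, u') *)
Definition super_mul (x y : super_eval A U) : super_eval A U :=
  ulift (super_mul_rel y) x.

Lemma super_mul_gen g h :
  super_mul (sgval g) (sgval h) = sgval (sgen_mul g h).
Proof. by rewrite /super_mul /sgval !ulift_gen. Qed.

Lemma super_mul_linear_l a x y z :
  super_mul (a *: x + y) z = a *: super_mul x z + super_mul y z.
Proof. exact: linearP. Qed.

Lemma super_mul0l x : super_mul 0 x = 0.
Proof. exact: linear0. Qed.

Lemma super_mul_linear_r a x y z :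
  super_mul x (a *: y + z) = a *: super_mul x y + super_mul x z.
Proof.
elim/univ_ind: x => [b g x IH|]; last first.
  by rewrite !super_mul0l -[LHS](addr0 0) -[X in X + _](scaler0 _ a).
rewrite !super_mul_linear_l IH.
have -> : super_mul (ugen (@super_rel A U) g) (a *: y + z) =
    a *: super_mul (ugen (@super_rel A U) g) y + super_mul (ugen (@super_rel A U) g) z.
  by rewrite /super_mul !ulift_gen linearP.
by rewrite !scalerDr !scalerA [b * a]mulrC addrACA.
Qed.

Lemma super_eval_ind (Q : super_eval A U -> Prop) :
  (forall a g y, Q y -> Q (a *: sgval g + y)) -> Q 0 -> forall x, Q x.
Proof. exact: univ_ind. Qed.

Lemma super_mul0r x : super_mul x 0 = 0.
Proof.
have := super_mul_linear_r (-1) x 0 0.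
by rewrite scaler0 addr0 scaleN1r addNr.
Qed.

Lemma super_mulDl : left_distributive super_mul +%R.
Proof. by move=> x y z; have := super_mul_linear_l 1 x y z; rewrite !scale1r. Qed.

Lemma super_mulDr : right_distributive super_mul +%R.
Proof. by move=> x y z; have := super_mul_linear_r 1 x y z; rewrite !scale1r. Qed.

Lemma tone_multilinear : multilinear_op (tone A 'rV[rat]_0).
Proof. by move=> V v []. Qed.

Definition sgen_one : sgen A U :=
  SGen tone_multilinear (fun i : 'I_0 => False_rect _ (notF (ltn_ord i))).

Definition super_one : super_eval A U := sgval sgen_one.

Lemma sgen_mulA g h l : sgen_mul g (sgen_mul h l) = sgen_mul (sgen_mul g h) l.
Proof.
case: g h l => [n m Pm u] [k m' Pm' u'] [r m'' Pm'' u''].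
apply: (sgen_cast (e := addnA n k r)) => /=.
  rewrite !opval_mul tmulA op_mulE opval_mul.
  congr (tmul (tmul _ _) _); congr opval; apply/funext => i;
    rewrite ?lincomb_delta; congr (delta_mx _ _); apply: val_inj => //=.
  by rewrite addnA.
move=> i; case: (split_ordP i) => j -> /=.
  rewrite args_catl.
  have -> : cast_ord (addnA n k r) (lshift (k + r) j) = lshift r (lshift k j).
    exact: val_inj.
  by rewrite !args_catl.
rewrite args_catr; case: (split_ordP j) => s -> /=.
  have -> : cast_ord (addnA n k r) (rshift n (lshift r s)) = lshift r (rshift n s).
    exact: val_inj.
  by rewrite !args_catl args_catr.
have -> : cast_ord (addnA n k r) (rshift n (rshift k s)) = rshift (n + k) s.
  by apply: val_inj => /=; rewrite addnA.
by rewrite !args_catr.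
Qed.

Lemma opval_tone n (V : lmodType rat) (v : 'I_n -> V) :
  opval (tone A 'rV[rat]_n) v = tone A V.
Proof. exact: tone_nat. Qed.

Lemma sgen_mul1l g : sgen_mul sgen_one g = g.
Proof.
case: g => [n m Pm u]; apply: (sgen_cast (e := add0n n)) => /=.
  rewrite opval_mul opval_tone tmul1 -[LHS]opval_delta; congr (opval m _).
move=> i; case: (split_ordP i) => [[]//|j ->]; rewrite args_catr.
by congr (u _); apply: val_inj.
Qed.

Lemma sgen_mul1r g : sgen_mul g sgen_one = g.
Proof.
case: g => [n m Pm u]; apply: (sgen_cast (e := addn0 n)) => /=.
  rewrite opval_mul opval_tone tmulC tmul1 -[LHS]opval_delta; congr (opval m _).
move=> i; case: (split_ordP i) => [j ->|[]//]; rewrite args_catl.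
by congr (u _); apply: val_inj.
Qed.

Lemma super_mul1l : left_id super_one super_mul.
Proof.
elim/super_eval_ind => [a g y IH|]; last exact: super_mul0r.
by rewrite super_mul_linear_r IH super_mul_gen sgen_mul1l.
Qed.

Lemma super_mul1r : right_id super_one super_mul.
Proof.
elim/super_eval_ind => [a g y IH|]; last exact: super_mul0l.
by rewrite super_mul_linear_l IH super_mul_gen sgen_mul1r.
Qed.

Lemma super_mulA : associative super_mul.
Proof.
move=> x y z; elim/super_eval_ind: x => [a g x IH|]; last by rewrite !super_mul0l.
rewrite !super_mul_linear_l IH; congr (_ *: _ + _).
elim/super_eval_ind: y {IH} => [b h y IH|].
  rewrite super_mul_linear_l !super_mul_linear_r super_mul_linear_l IH.
  congr (_ *: _ + _).
  elim/super_eval_ind: z {IH} => [c l z IH|]; last by rewrite !super_mul0r.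
  rewrite !super_mul_linear_r IH; congr (_ *: _ + _).
  by rewrite !super_mul_gen sgen_mulA.
by rewrite super_mul0l super_mul0r super_mul0l.
Qed.

HB.instance Definition _ := GRing.Zmodule_isPzRing.Build (super_eval A U)
  super_mulA super_mul1l super_mul1r super_mulDl super_mulDr.

End SuperAlgebra.

Section Ideals.
Variable R : pzRingType.

Definition ideal (a : R -> Prop) : Prop :=
  [/\ a 0, forall x y, a x -> a y -> a (x + y),
      forall x y, a y -> a (x * y) & forall x y, a y -> a (y * x)].

Definition prime_ideal (a : R -> Prop) : Prop :=
  [/\ ideal a, exists x, ~ a x & forall x y, a (x * y) -> a x \/ a y].

(* The power n = 0 is harmless: it only occurs when [a] is the whole ring. *)
Definition radical (a : R -> Prop) : R -> Prop := fun x => exists n, a (x ^+ n).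

End Ideals.

(* Main.v *)
From HB Require Import structures.
From mathcomp Require Import all_boot all_order all_algebra perm fingroup.
From mathcomp Require Import boolp zify ring.
From mathcomp Require classical_sets.
Require Import Defs.

(* Write K for the ideal I(Q^{oo|oo}), R for its radical and J for rad_GL(I); in
   general J(Q^{oo|oo}) is smaller than R, which contains all the odd elements.
   Everything is reduced to multilinear operations m, i.e. elements of Hom(T_n, A),
   and to their values m(b) at distinct basis vectors b, from which m can be
   recovered.

   - J is the largest subrepresentation S with S(Q^{oo|oo}) contained in R.  Here one
     must show that m generates a subrepresentation nilpotent modulo I as soon as
     all the m(b), with b distinct of arbitrary parities, are nilpotent modulo K.
     Polarizing m(b)^N = 0 shows that the product of N copies of m vanishes after
     symmetrization (b_k even) or antisymmetrization (b_k odd) of the arguments in each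
     slot k.  The slots are then freed one at a time, because for M > (N-1)^2 the
     symmetrizers and antisymmetrizers of N-element subsets generate the unit ideal
     of Q[S_M].  If R is prime, it follows formally that J is GL-prime.

   - Conversely let J be GL-prime and f g in K, with f even.  If F is a power of f and
     F y is in K, then so is F^2 D(y) for every even derivation D from gl(oo|oo).  Using
     finitely many D one extracts from g its multilinear components M, with
     F M(b) in K; then one extracts the components L of F, with L(b') M(b) in K for
     b' disjoint from b.  So L M lies in I, and the L or the M lie in J,
     whence F or g lies in R. *)
Set Implicit Arguments.
Unset Strict Implicit.
Unset Printing Implicit Defensive.

Import GRing.Theory Num.Theory.
Local Open Scope ring_scope.

(** * Projections of finite rank *)

(** The number (N-1)^2 is the largest size of a Young diagram with fewer than N rows and fewer than
    N columns. Both kinds of symmetrizers are needed: for N > 1 the symmetrizers vanish on the sign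
    representation and the antisymmetrizers on the trivial one. This is why nilpotency must be known
    at letters of every parity. No representation theory is used: the argument works in Q[S_M] with
    sums over Young subgroups. Characteristic 0 enters through integers that get inverted: n! when a
    tensor is recovered from its polar forms, orders of symmetric groups, and differences of
    degrees. In the converse, the condition on f g couples the two factors, so they cannot be split
    into components independently. Derivations move one factor while the other is kept, and Leibniz'
    rule yields an unwanted term. When f is kept, a higher power of f absorbs this term; when M(b)
    is kept, the term vanishes, as only derivations killing the letters of b are used. Infinitely
    many letters of both parities leave room for b and then b'. *)

Definition linear_fun_of (V W : lmodType rat) (f : V -> W) (fP : linear f) := f.
HB.instance Definition _ (V W : lmodType rat) (f : V -> W) (fP : linear f) :=
  GRing.isLinear.Build rat V W *:%R (@linear_fun_of V W f fP) fP.

(** A subspace maximal among those avoiding [v], given by Zorn's lemma, is a complement of the line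
    of [v], and [l] is the coordinate along that line. [P] does not ask for 0, so that the union of
    the empty chain satisfies it; [H0] recovers 0 by maximality. *)
Lemma exists_functional (V : lmodType rat) (v : V) :
  v != 0 -> exists l : {linear V -> rat^o}, l v = 1.
Proof.
move=> v0; pose P (A : V -> Prop) :=
  (forall a x y, A x -> A y -> A (a *: x + y)) /\ ~ A v.
have [|H [[Hlin Hv] Hmax]] := @classical_sets.Zorn_bigcup V P.
  move=> F FP Ftot; split; last by move=> [X /FP[_ Xv] /Xv].
  move=> a x y [X FX Xx] [Y FY Yy].
  have [XY|YX] := Ftot X Y FX FY.
    by exists Y => //; apply: (FP _ FY).1 => //; exact: XY.
  by exists X => //; apply: (FP _ FX).1 => //; exact: YX.
have H0 : H 0.
  apply: contrapT => nH0; apply: (Hmax (fun x => x = 0 \/ H x)).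
    split; first by move=> x Hx; right.
    by move=> /(_ 0) h; apply: nH0; apply: h; left.
  split; last by move=> [/eqP|]; [exact/negP | exact: Hv].
  have He : forall x, ~ H x.
    move=> x Hx; apply: nH0.
    by have := Hlin (-1) _ _ Hx Hx; rewrite scaleN1r addNr.
  move=> a x y [->|/He//] [->|/He//]; left.
  by rewrite scaler0 addr0.
have Hsc a x : H x -> H (a *: x) by move=> Hx; rewrite -[_ *: _]addr0; exact: Hlin.
(* If [w] is not in [H], maximality gives [v - c w] in [H] for some [c], and [c] is invertible
   because [v] is not in [H]. *)
have dec w : exists c, H (w - c *: v).
  have [Hw|Hw] := pselect (H w); first by exists 0; rewrite scale0r subr0.
  pose B x := exists c, H (x - c *: w).
  have [c Hc] : B v.
    apply: contrapT => Bv; apply: (Hmax B).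
      split; first by move=> x Hx; exists 0; rewrite scale0r subr0.
      by move=> BH; apply/Hw/BH; exists 1; rewrite scale1r subrr.
    split=> // a x y [c Hx] [d Hy]; exists (a * c + d).
    have := Hlin a _ _ Hx Hy.
    by rewrite scalerBr scalerA addrACA -opprD -scalerDl.
  have c0 : c != 0 by apply/eqP => c0; move: Hc; rewrite c0 scale0r subr0.
  exists c^-1; have := Hsc (- c^-1) _ Hc.
  by rewrite scalerBr scalerA mulNr mulVf // !scaleNr scale1r opprK addrC.
pose l w : rat^o := sval (cid (dec w)).
have lP w : H (w - l w *: v) by rewrite /l; case: cid.
have lU w c : H (w - c *: v) -> l w = c.
  move=> Hw; apply/eqP; rewrite -subr_eq0; apply/negPn/negP => n0; apply: Hv.
  have := Hlin (-1) _ _ (lP w) Hw.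
  rewrite scaleN1r opprB addrA subrK -scalerBl => /(Hsc (l w - c)^-1).
  by rewrite scalerA mulVf // scale1r.
have llin : linear l.
  move=> a x y; apply: lU; have := Hlin a _ _ (lP x) (lP y).
  by rewrite scalerBr scalerA addrACA -opprD -scalerDl.
exists (linear_fun_of llin).
by apply: lU; rewrite scale1r subrr.
Qed.

(** An element of a sum of tensor powers of [V] involves finitely many vectors; this projection
    moves it to some Q^r and back. The induction carries idempotency along, so that the new vector
    can be corrected to lie in the kernel of the projection and the new functional to vanish on its
    image. *)
Lemma finite_rank_projection (V : lmodType rat) (l : seq V) :
  exists (r : nat) (u : 'I_r -> V) (s : {linear V -> 'rV[rat]_r}),
    forall v, v \in l -> lincomb u (s v) = v.
Proof.
suff [r [u [s [_ h]]]] : exists (r : nat) (u : 'I_r -> V) (s : {linear V -> 'rV[rat]_r}),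
    (forall v, lincomb u (s (lincomb u (s v))) = lincomb u (s v)) /\
    forall v, v \in l -> lincomb u (s v) = v by exists r, u, s.
elim: l => [|v0 l [r [u [s [idem fixl]]]]].
  exists 0, (fun i : 'I_0 => 0), [the {linear V -> 'rV[rat]_0} of \0]; split=> [v|//].
  by rewrite /lincomb !big_ord0.
pose p v := lincomb u (s v); pose v1 := v0 - p v0.
have {}idem v : p (p v) = p v by exact: idem.
have {}fixl v : v \in l -> p v = v by exact: fixl.
have pD a x y : p (a *: x + y) = a *: p x + p y by rewrite /p !linearP.
have pB x y : p (x - y) = p x - p y by rewrite /p !linearB.
have [v10|v1n] := eqVneq v1 0.
  exists r, u, s; split=> // v; rewrite inE => /orP[/eqP ->|/fixl //].
  by apply/eqP; rewrite eq_sym -subr_eq0; exact/eqP.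
have [l1 l1v] := exists_functional v1n.
have l1D a x y : l1 (a *: x + y) = a * l1 x + l1 y by exact: (linearP l1).
have pv1 : p v1 = 0 by rewrite pB idem subrr.
pose l' v : rat := l1 v - l1 (p v).
have l'v1 : l' v1 = 1 by rewrite /l' pv1 linear0 subr0.
have l'p v : l' (p v) = 0 by rewrite /l' idem subrr.
have l'D a x y : l' (a *: x + y) = a * l' x + l' y.
  by rewrite /l' pD !l1D mulrBr opprD addrACA.
pose s' v : 'rV[rat]_(r + 1) := row_mx (s v) (l' v)%:M.
have s'lin : linear s'.
  by move=> a x y; rewrite /s' linearP l'D scale_row_mx add_row_mx scale_scalar_mx -raddfD.
pose u' := args_cat u (fun _ : 'I_1 => v1).
have pE v : lincomb u' (s' v) = p v + l' v *: v1.
  rewrite /lincomb big_split_ord /= big_ord1 /u' args_catr row_mxEr mxE eqxx mulr1n.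
  by congr (_ + _); apply: eq_bigr => i _; rewrite args_catl row_mxEl.
have pp v : p (p v + l' v *: v1) = p v.
  by rewrite addrC pD pv1 scaler0 add0r idem.
exists (r + 1)%N, u', (linear_fun_of s'lin); split=> v.
  rewrite /linear_fun_of !pE pp addrC [p v + _]addrC l'D l'v1 l'p.
  by rewrite addr0 mulr1.
rewrite inE /linear_fun_of pE => /orP[/eqP ->|/fixl pv].
  have -> : v0 = 1 *: v1 + p v0 by rewrite scale1r subrK.
  by rewrite l'D pD pv1 scaler0 add0r l'v1 l'p mulr1 addr0 idem scale1r addrC.
by rewrite -{2}pv l'p scale0r addr0.
Qed.

(** * Linear spans and multilinear maps *)

Section Lspan.
Variable M : lmodType rat.
Implicit Types (S T : M -> Prop) (x y : M).

Lemma lspan0 S : lspan S 0.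
Proof.
by exists 0, (fun=> 0), (fun=> 0); split=> [[]//|]; rewrite big_ord0.
Qed.

Lemma lspan_cons S a x y : S x -> lspan S y -> lspan S (a *: x + y).
Proof.
move=> Sx [n [b [v [Sv ->]]]].
exists n.+1, (fun i => oapp b a (unlift ord0 i)), (fun i => oapp v x (unlift ord0 i)).
split=> [i|]; first by case: unliftP => [j|] _ /=.
rewrite big_ord_recl !unlift_none; congr (_ + _).
by apply: eq_bigr => i _; rewrite !liftK.
Qed.

Lemma lspan_mem S x : S x -> lspan S x.
Proof. by move=> Sx; rewrite -[x]addr0 -[x]scale1r; apply: lspan_cons => //; exact: lspan0. Qed.

Lemma lspan_ind S (Q : M -> Prop) :
  Q 0 -> (forall a x y, S x -> Q y -> Q (a *: x + y)) -> forall x, lspan S x -> Q x.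
Proof.
move=> Q0 QD x [n [a [v [Sv ->]]]]; elim: n a v Sv => [|n IH] a v Sv.
  by rewrite big_ord0.
by rewrite big_ord_recl; apply: QD => //; apply: IH => i.
Qed.

Lemma lspan_lin S a x y : lspan S x -> lspan S y -> lspan S (a *: x + y).
Proof.
move=> Sx Sy; elim/lspan_ind: x / Sx => [|b z w Sz IH]; first by rewrite scaler0 add0r.
by rewrite scalerDr scalerA -addrA; exact: lspan_cons.
Qed.

Lemma lspan_sub S T x : (forall z, S z -> lspan T z) -> lspan S x -> lspan T x.
Proof.
by move=> ST; elim/lspan_ind => [|a z y Sz]; [exact: lspan0|apply/lspan_lin/ST].
Qed.

End Lspan.

Definition closed_lin (M : lmodType rat) (Z : M -> Prop) :=
  Z 0 /\ forall a x y, Z x -> Z y -> Z (a *: x + y).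

Section ClosedLin.
Variables (M : lmodType rat) (Z : M -> Prop).
Hypothesis Zlin : closed_lin Z.

Lemma closed_linZ a x : Z x -> Z (a *: x).
Proof. by move=> Zx; rewrite -[_ *: _]addr0; apply: Zlin.2 => //; exact: Zlin.1. Qed.

Lemma closed_linD x y : Z x -> Z y -> Z (x + y).
Proof. by move=> Zx Zy; rewrite -[x]scale1r; exact: Zlin.2. Qed.

Lemma closed_linN x : Z x -> Z (- x).
Proof. by rewrite -scaleN1r; exact: closed_linZ. Qed.

Lemma closed_linB x y : Z x -> Z y -> Z (x - y).
Proof. by move=> Zx Zy; apply: closed_linD => //; exact: closed_linN. Qed.

Lemma closed_lin_sum (J : Type) (r : seq J) (P : pred J) (F : J -> M) :
  (forall j, P j -> Z (F j)) -> Z (\sum_(j <- r | P j) F j).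
Proof. by move=> h; elim/big_ind: _ => //; [exact: Zlin.1|exact: closed_linD]. Qed.

Lemma closed_linZI a x : a != 0 -> Z (a *: x) -> Z x.
Proof. by move=> a0 /(closed_linZ a^-1); rewrite scalerA mulVf // scale1r. Qed.

Lemma closed_lspan (S : M -> Prop) x : (forall z, S z -> Z z) -> lspan S x -> Z x.
Proof. by move=> h; elim/lspan_ind => [|a z y /h Sz Zy]; [exact: Zlin.1|exact: Zlin.2]. Qed.

End ClosedLin.

Lemma lspan_closed_lin (M : lmodType rat) (S : M -> Prop) : closed_lin (lspan S).
Proof. by split; [exact: lspan0|move=> *; exact: lspan_lin]. Qed.

Lemma subfunctor_closed_lin (F : functor) (S : setfam F) V : subfunctor S -> closed_lin (@S V).
Proof. by case=> S0 SD _; split; [exact: S0|move=> *; exact: SD]. Qed.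

Section Multilinear.
Variables (V W : lmodType rat).

Lemma multilinear_linear n (g : ('I_n -> V) -> W) v i :
  multilinear g -> linear (fun x => g (upd v i x)).
Proof. by move=> gP a x y; exact: gP. Qed.

Lemma upd_same (I : eqType) (T : Type) (v : I -> T) i : upd v i (v i) = v.
Proof. by apply/funext => j; rewrite /upd; case: eqP => [->|]. Qed.

Lemma multilinear0 n (g : ('I_n -> V) -> W) v i : multilinear g -> v i = 0 -> g v = 0.
Proof.
move=> gP vi; rewrite -(upd_same v i) vi.
by have := gP v i (-1) 0 0; rewrite scaler0 addr0 scaleN1r addNr.
Qed.

Definition fcons n (T : Type) (x : T) (v : 'I_n -> T) (i : 'I_n.+1) : T :=
  oapp v x (unlift ord0 i).

Lemma fcons0 n T (x : T) (v : 'I_n -> T) : fcons x v ord0 = x.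
Proof. by rewrite /fcons unlift_none. Qed.

Lemma fconsS n T (x : T) (v : 'I_n -> T) i : fcons x v (lift ord0 i) = v i.
Proof. by rewrite /fcons liftK. Qed.

Lemma fcons_upd n T (x y : T) (v : 'I_n -> T) i :
  fcons x (upd v i y) = upd (fcons x v) (lift ord0 i) y.
Proof.
apply/funext => j; case: (unliftP ord0 j) => [k ->|->].
  by rewrite fconsS /upd (inj_eq lift_inj) fconsS.
by rewrite fcons0 /upd fcons0; case: eqP => // /eqP.
Qed.

Lemma sum_ffunS n (R : finType) (G : ('I_n.+1 -> R) -> W) :
  \sum_(t : {ffun 'I_n.+1 -> R}) G t = \sum_a \sum_(t : {ffun 'I_n -> R}) G (fcons a t).
Proof.
rewrite pair_big /=.
rewrite (reindex (fun p : R * {ffun 'I_n -> R} => [ffun i => fcons p.1 p.2 i])) /=.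
  by apply: eq_bigr => p _; congr G; apply/funext => i; rewrite ffunE.
exists (fun t : {ffun 'I_n.+1 -> R} => (t ord0, [ffun i => t (lift ord0 i)])) => [[a t]|t] _ /=.
  by congr pair; [|apply/ffunP => i]; rewrite !ffunE ?fcons0 ?fconsS.
apply/ffunP => i; rewrite ffunE; case: (unliftP ord0 i) => [j ->|->].
  by rewrite fconsS ffunE.
by rewrite fcons0.
Qed.

Lemma multilinear_sum n (g : ('I_n -> V) -> W) (R : finType) (f : 'I_n -> R -> V) :
  multilinear g ->
  g (fun j => \sum_a f j a) = \sum_(t : {ffun 'I_n -> R}) g (fun j => f j (t j)).
Proof.
elim: n g f => [|n IH] g f gP.
  rewrite (bigD1 [ffun i : 'I_0 => False_rect _ (notF (ltn_ord i))]) //= big1.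
    by rewrite addr0; congr g; apply/funext => -[].
  by move=> t /eqP[]; apply/ffunP => -[].
rewrite (sum_ffunS (fun t => g (fun j => f j (t j)))).
set v := (fun j => _); rewrite -(upd_same v ord0) {2}/v.
have -> : g (upd v ord0 (\sum_a f ord0 a)) = \sum_a g (upd v ord0 (f ord0 a)).
  exact: (raddf_sum (linear_fun_of (multilinear_linear v ord0 gP))).
apply: eq_bigr => a _.
have -> : upd v ord0 (f ord0 a) = fcons (f ord0 a) (fun j => \sum_a f (lift ord0 j) a).
  apply/funext => j; rewrite /upd; case: (unliftP ord0 j) => [k ->|->].
    by rewrite fconsS eq_sym (negbTE (neq_lift _ _)).
  by rewrite fcons0 eqxx.
rewrite (IH (fun w => g (fcons (f ord0 a) w)) (fun j => f (lift ord0 j))).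
  apply: eq_bigr => t _; congr g; apply/funext => j; case: (unliftP ord0 j) => [k ->|->].
    by rewrite !fconsS.
  by rewrite !fcons0.
by move=> w i b x y; rewrite !fcons_upd gP.
Qed.

End Multilinear.

(** * Multilinear operations generate polynomial functors *)

(** For polynomial functors this contains every subfunctor [S], so that inclusions between
    subrepresentations can be tested on the spaces Hom(T_n, F). *)
Definition mspan (F : functor) (S : setfam F) : setfam F := fun V =>
  lspan (fun z => exists (n : nat) (m : F 'rV[rat]_n) (v : 'I_n -> V),
    [/\ S _ m, multilinear_op m & z = opval m v]).

Lemma mspan_fmap F (S : setfam F) (V W : lmodType rat) (f : {linear V -> W}) x :
  mspan S x -> mspan S (fmap F f x).
Proof.
elim/lspan_ind => [|a z y [n [m [v [Sm Pm ->]]]] IH]; first by rewrite linear0; exact: lspan0.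
rewrite linearP; apply: lspan_cons => //; exists n, m, (fun i => f (v i)); split=> //.
exact: fmap_opval.
Qed.

Lemma multilinear_op_closed_lin (F : functor) n : closed_lin (@multilinear_op F n).
Proof.
split=> [V v i a x y|a m m' Pm Pm' V v i b x y]; first by rewrite /opval !linear0 addr0.
by rewrite !opval_linear Pm Pm' !scalerDr !scalerA [a * b]mulrC addrACA.
Qed.

(** Adding or removing a point outside [X] is a sign-reversing involution on the sets containing
    [X]. *)
Lemma alternating_subsets_sum (T : finType) (X : {set T}) :
  X != [set: T] -> \sum_(S : {set T} | X \subset S) (-1) ^+ #|S| = 0 :> rat.
Proof.
rewrite -subTset => /subsetPn[x _ xX].
pose tog (S : {set T}) := if x \in S then S :\ x else x |: S.
have togK : involutive tog.
  move=> S; rewrite /tog; have [xS|xS] := boolP (x \in S).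
    by rewrite setD11 setD1K.
  by rewrite setU11 setU1K.
set s := \sum_(_ | _) _; have : s = - s.
  rewrite {1}/s (reindex_inj (inv_inj togK)) -sumrN; apply: eq_big => S.
    rewrite /tog; case: ifP => xS; first by rewrite subsetD1 xX andbT.
    apply/idP/idP => [/subsetP h|h]; last exact: (subset_trans h (subsetUr _ _)).
    apply/subsetP => y yX; have := h y yX; rewrite !inE => /orP[/eqP e|//].
    by rewrite -e yX in xX.
  move=> _; rewrite /tog; case: ifP => xS.
    by rewrite [in RHS](cardsD1 x) xS exprS mulN1r opprK.
  by rewrite cardsU1 xS exprS mulN1r.
by move/eqP; rewrite -addr_eq0 -mulr2n -mulr_natr mulf_eq0 pnatr_eq0 orbF => /eqP.
Qed.

Section TensorSum.
Variables (J : Type) (d : J -> nat).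
Let F := dsum (fun j => tpow (d j)).

Definition dten (V : lmodType rat) (j : J) (v : 'I_(d j) -> V) : F V :=
  dinj (existT (fun j => tpow (d j) V) j (ptens v)).

Lemma dten_multilinear V j : multilinear (@dten V j).
Proof. by move=> v i a x y; rewrite /dten ptens_multilinear dinjP. Qed.

Lemma fmap_dten (V W : lmodType rat) (f : {linear V -> W}) j (v : 'I_(d j) -> V) :
  fmap F f (dten v) = dten (fun i => f (v i)).
Proof. by rewrite /dten /dinj /= /dsum_map ulift_gen /= /tpow_map ulift_gen. Qed.

Lemma dten_span V (z : F V) : lspan (fun y => exists j (v : 'I_(d j) -> V), y = dten v) z.
Proof.
elim/univ_ind: z => [a [j x] y IH|]; last exact: lspan0.
apply: lspan_lin => //.
elim/univ_ind: x => [b v x IHx|].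
  have -> : ugen (@dsum_univ _ _ V) (existT (fun j => tpow (d j) V) j
      (b *: ugen (@multilinear (d j) V) v + x)) =
      b *: dten v + dinj (existT (fun j => tpow (d j) V) j x) by exact: dinjP.
  by apply: lspan_cons => //; exists j, v.
have /= := @dinjP _ (fun j => tpow (d j)) V j (-1) 0 0.
by rewrite scaler0 addr0 scaleN1r addNr; exact: (eq_ind_r (lspan _) (lspan0 _)).
Qed.

Definition dword r j (b : 'I_(d j) -> 'I_r) : F 'rV[rat]_r :=
  dten (fun i => delta_mx 0 (b i)).

Lemma opval_dword r j (b : 'I_(d j) -> 'I_r) (V : lmodType rat) (v : 'I_r -> V) :
  opval (dword b) v = dten (v \o b).
Proof.
by rewrite /opval fmap_dten; congr (dten _); apply/funext => i; exact: lincomb_delta.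
Qed.

Lemma dten_scale (V : lmodType rat) j (v : 'I_(d j) -> V) (e : 'I_(d j) -> rat) :
  dten (fun i => e i *: v i) = (\prod_i e i) *: dten v.
Proof.
suff h (s : seq 'I_(d j)) : uniq s ->
    dten (fun i => if i \in s then e i *: v i else v i) = (\prod_(i <- s) e i) *: dten v.
  rewrite -(h (index_enum _) (index_enum_uniq _)). apply: (f_equal (@dten V j)).
  by apply/funext => i; rewrite mem_index_enum.
elim: s => [|k s IH] /=; first by rewrite big_nil scale1r.
move=> /andP[ks us]; rewrite big_cons -scalerA -IH //.
set w := (fun i => if i \in s then _ else _).
rewrite -[in RHS](upd_same w k) -[_ *: dten _]addr0.
have <- : dten (upd w k 0) = 0 by apply: (multilinear0 (i := k)); [exact: dten_multilinear|rewrite /upd eqxx].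
rewrite -dten_multilinear addr0; congr (dten _); apply/funext => i; rewrite /upd /w inE.
by case: eqP => // ->; rewrite (negbTE ks).
Qed.

Lemma dword_span r (z : F 'rV[rat]_r) :
  lspan (fun y => exists j (b : 'I_(d j) -> 'I_r), y = dword b) z.
Proof.
apply: lspan_sub (dten_span z) => y [j [v ->]].
have -> : v = (fun i => \sum_a v i 0 a *: delta_mx 0 a).
  by apply/funext => i; rewrite -row_sum_delta.
rewrite (multilinear_sum _ (@dten_multilinear _ j)).
apply: (closed_lin_sum (lspan_closed_lin _)) => t _.
rewrite dten_scale; apply: (closed_linZ (lspan_closed_lin _)); apply: lspan_mem.
by exists j, t.
Qed.


Definition vsurj k n (t : 'I_k -> 'I_n) := [set a | [exists i, t i == a]] == [set: 'I_n].

Lemma vsurjP k n (t : 'I_k -> 'I_n) : reflect (forall a, exists i, t i = a) (vsurj t).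
Proof.
apply: (iffP eqP) => [/setP h a|h].
  by have := h a; rewrite !inE => /existsP[i /eqP]; exists i.
by apply/setP => a; rewrite !inE; apply/existsP; have [i <-] := h a; exists i.
Qed.

(** The colouring [c] tells which basis vector of Q^r each basis vector of Q^n refines, and [S]
    selects those in use. *)
Definition polar_args r n (c : 'I_n -> 'I_r) (S : {set 'I_n}) (b : 'I_r) : 'rV[rat]_n :=
  \sum_a ((a \in S) && (c a == b))%:R *: delta_mx 0 a.

(* By inclusion-exclusion, this keeps from the expansion of the tensors
   of [z] only the terms which involve all the basis vectors of Q^n: tensors of degree
   less than [n] disappear, and those of degree [n] become multilinear. *)
Definition polar r n (c : 'I_n -> 'I_r) (z : F 'rV[rat]_r) : F 'rV[rat]_n :=
  \sum_(S : {set 'I_n}) (-1) ^+ #|S| *: opval z (polar_args c S).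

Lemma polar_dword r n (c : 'I_n -> 'I_r) j (b : 'I_(d j) -> 'I_r) :
  polar c (dword b) = \sum_(t : {ffun 'I_(d j) -> 'I_n} | vsurj t)
    ((-1) ^+ n * [forall i, c (t i) == b i]%:R) *: dword t.
Proof.
rewrite /polar.
have E (S : {set 'I_n}) : opval (dword b) (polar_args c S) =
    \sum_(t : {ffun 'I_(d j) -> 'I_n})
      ([forall i, t i \in S] && [forall i, c (t i) == b i])%:R *: dword t.
  rewrite opval_dword (multilinear_sum (fun j a => ((a \in S) && (c a == b j))%:R *: delta_mx 0 a)
    (@dten_multilinear _ j)).
  apply: eq_bigr => t _; rewrite dten_scale; congr (_ *: _).
  case: (boolP (_ && _)) => [/andP[/forallP h1 /forallP h2]|].
    by rewrite big1 // => i _; rewrite h1 h2.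
  rewrite negb_and !negb_forall => h.
  have [i hi] : exists i, ~~ ((t i \in S) && (c (t i) == b i)).
    by case/orP: h => /existsP[i hi]; exists i; rewrite negb_and hi ?orbT.
  by rewrite (bigD1 i) //= (negbTE hi) mul0r.
under eq_bigr do rewrite E scaler_sumr.
(* The coefficient of [dword t] becomes an alternating sum over the sets [S] containing the image of
   [t], which vanishes unless [t] is onto. *)
rewrite exchange_big /= [RHS]big_mkcond; apply: eq_bigr => t _.
under eq_bigr do rewrite scalerA.
rewrite -scaler_suml.
have -> : \sum_(S : {set 'I_n}) (-1) ^+ #|S| *
    ([forall i, t i \in S] && [forall i, c (t i) == b i])%:R =
    (\sum_(S : {set 'I_n} | [set a | [exists i, t i == a]] \subset S) (-1) ^+ #|S|) *
      [forall i, c (t i) == b i]%:R :> rat.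
  rewrite [in RHS]big_mkcond mulr_suml; apply: eq_bigr => S _.
  have -> : [forall i, t i \in S] = ([set a | [exists i, t i == a]] \subset S).
    apply/forallP/subsetP => [h a|h i]; last by apply: h; rewrite inE; apply/existsP; exists i.
    by rewrite inE => /existsP[i /eqP <-].
  by case: ifP; rewrite ?mulr0 ?mul0r.
case: ifPn => ht; last by rewrite alternating_subsets_sum // mul0r scale0r.
rewrite (eqP ht) (big_pred1 setT) ?cardsT ?card_ord // => S.
by rewrite subTset.
Qed.

Lemma polar_linear r n (c : 'I_n -> 'I_r) : linear (polar c).
Proof.
move=> a x y; rewrite /polar scaler_sumr -big_split; apply: eq_bigr => S _ /=.
by rewrite opval_linear scalerDr !scalerA mulrC.
Qed.

(** Restitution in the classical sense: each polar form is specialized back along the colouring that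
    produced it. On tensors of degree [n] the sum is the scalar (-1)^n n!, and on lower degrees it
    is 0. *)
Definition restit r n (z : F 'rV[rat]_r) : F 'rV[rat]_r :=
  \sum_(c : {ffun 'I_n -> 'I_r}) opval (polar c z) (fun i => delta_mx 0 (c i)).

Lemma restit_linear r n : linear (@restit r n).
Proof.
move=> a x y; rewrite /restit scaler_sumr -big_split; apply: eq_bigr => c _ /=.
by rewrite polar_linear opval_linear.
Qed.

Definition nsurj k n := #|[set t : {ffun 'I_k -> 'I_n} | vsurj t]|.

Lemma nsurj_gt0 n : (0 < nsurj n n)%N.
Proof.
apply/card_gt0P; exists [ffun i => i]; rewrite inE; apply/vsurjP => a.
by exists a; rewrite ffunE.
Qed.

Lemma vsurj_lt k n (t : 'I_k -> 'I_n) : (k < n)%N -> vsurj t = false.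
Proof.
move=> kn; apply/vsurjP => h.
have [f hf] : exists f : {ffun 'I_n -> 'I_k}, forall a, t (f a) = a.
  have [f hf] := choice h; by exists (finfun f) => a; rewrite ffunE.
have /leq_card : injective f by apply: (can_inj hf).
by rewrite !card_ord leqNgt kn.
Qed.

Lemma vsurj_bij k n (t : 'I_k -> 'I_n) :
  k = n -> vsurj t -> exists s, cancel t s /\ cancel s t.
Proof.
move=> e; case: _ / e t => t /vsurjP /choice[s hs]; exists s; split=> //.
by have /injF_bij[s' ss' s's] : injective s by [apply: (can_inj hs)]; move=> a; rewrite -[a in LHS]s's hs.
Qed.

Lemma restit_dword r n j (b : 'I_(d j) -> 'I_r) : (d j <= n)%N ->
  restit n (dword b) = ((-1) ^+ n * (nsurj (d j) n)%:R * (d j == n)%:R) *: dword b.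
Proof.
move=> dn; rewrite /restit.
under eq_bigr => c _ do rewrite polar_dword.
have [dj|dj] := eqVneq (d j) n; last first.
  rewrite mulr0 scale0r big1 // => c _; rewrite big_pred0 => [|t].
    by rewrite /opval linear0.
  by rewrite vsurj_lt // ltn_neqAle dj.
rewrite mulr1.
have E (c : {ffun 'I_n -> 'I_r}) :
  opval (\sum_(t : {ffun 'I_(d j) -> 'I_n} | vsurj t)
    ((-1) ^+ n * [forall i, c (t i) == b i]%:R) *: dword t) (fun i => delta_mx 0 (c i)) =
  \sum_(t : {ffun 'I_(d j) -> 'I_n} | vsurj t)
    ((-1) ^+ n * [forall i, c (t i) == b i]%:R) *: dword b.
  rewrite /opval linear_sum; apply: eq_bigr => t _; rewrite linearZ -/(opval _ _) opval_dword /=.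
  case: (boolP [forall i, _]) => [/forallP h|]; last by rewrite mulr0 !scale0r.
  by congr (_ *: dten _); apply/funext => i /=; rewrite (eqP (h i)).
under eq_bigr do rewrite E.
rewrite exchange_big /=.
rewrite /nsurj -sum1_card natr_sum mulr_sumr scaler_suml; apply: eq_big => [t|t]; first by rewrite inE.
rewrite mulr1 -scaler_suml => ht; congr (_ *: _); rewrite -[RHS]mulr1 -mulr_sumr; congr (_ * _).
have [s [ts st]] := vsurj_bij dj ht.
(* For a bijective [t] with inverse [s], the only colouring [c] with [c \o t = b] is [b \o s]. *)
rewrite (bigD1 [ffun a => b (s a)]) //= big1 ?addr0.
  by case: forallP => // -[] i; rewrite ffunE ts.
move=> c; case: forallP => // h /eqP[]; apply/ffunP => a.
by rewrite ffunE -(eqP (h _)) st.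
Qed.

Lemma multilinear_dword n j (t : 'I_(d j) -> 'I_n) :
  d j = n -> vsurj t -> multilinear_op (dword t).
Proof.
move=> dj /(vsurj_bij dj)[s [ts st]] V v i a x y; rewrite !opval_dword.
have E z : upd v i z \o t = upd (v \o t) (s i) z.
  by apply/funext => l; rewrite /= /upd (can2_eq ts st).
by rewrite !E dten_multilinear.
Qed.

(** Once the element is moved to some Q^r, the proof is by induction on a strict bound for the
    degrees of its tensors. The polar forms at the top degree are multilinear and lie in [S], and
    subtracting a multiple of [restit n z] removes the top degree without leaving [S]. *)
Lemma mspan_tensor_sum (S : setfam F) : subfunctor S -> subfam S (mspan S).
Proof.
move=> PS.
have Slin := subfunctor_closed_lin _ PS.
pose Pn r n := fun y : F 'rV[rat]_r => exists j (b : 'I_(d j) -> 'I_r), (d j < n)%N /\ y = dword b.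
suff h n r (z : F 'rV[rat]_r) : S _ z -> lspan (Pn r n) z -> mspan S z.
  move=> V z Sz.
  have [l hl] : exists l : seq V, lspan (fun y => exists j (v : 'I_(d j) -> V),
      (forall i, v i \in l) /\ y = dten v) z.
    elim/lspan_ind: z / (dten_span z) {Sz} => [|a x y [j [v ->]] [l IH]].
      by exists [::]; exact: lspan0.
    exists ([seq v i | i : 'I_(d j)] ++ l); apply: lspan_cons.
      by exists j, v; split=> // i; rewrite mem_cat map_f ?mem_enum.
    apply: lspan_sub IH => _ [k [w [hw ->]]]; apply: lspan_mem.
    by exists k, w; split=> // i; rewrite mem_cat hw orbT.
  have [r [u [s fixl]]] := finite_rank_projection l.
  have -> : z = fmap F (lincomb u) (fmap F s z).
    elim/lspan_ind: z / hl {Sz} => [|a x y [j [v [hv ->]]] IH]; first by rewrite !linear0.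
    rewrite !linearP -IH !fmap_dten; congr (_ *: _ + _).
    apply: (f_equal (@dten V j)); apply/funext => i. exact/esym/fixl/hv.
  apply: mspan_fmap; set y := fmap F s z.
  have Sy : S _ y by case: PS => _ _; exact.
  have [n yn] : exists n, lspan (Pn r n) y.
    elim/lspan_ind: y / (dword_span y) {Sy} => [|a x y [j [b ->]] [n IH]].
      by exists 0%N; exact: lspan0.
    exists (maxn (d j).+1 n); apply: lspan_cons; first by exists j, b; rewrite leq_maxl.
    apply: lspan_sub IH => _ [k [w [hw ->]]]; apply: lspan_mem.
    by exists k, w; rewrite leq_max hw orbT.
  exact: h Sy yn.
elim: n z => [|n IH] z Sz zn.
  have -> : z = 0 by elim/lspan_ind: z / zn {Sz} => [//|a x y [j [b []]]].
  exact: lspan0.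
pose K : rat := (-1) ^+ n * (nsurj n n)%:R.
have K0 : K != 0 by rewrite mulf_neq0 ?signr_eq0 // pnatr_eq0 -lt0n nsurj_gt0.
have ML (c : 'I_n -> 'I_r) : multilinear_op (polar c z).
  elim/lspan_ind: z / zn {Sz} => [|a x y [j [b [dj ->]]] IHz].
    have := polar_linear c (-1) 0 0; rewrite scaler0 addr0 scaleN1r addNr => ->.
    exact: (multilinear_op_closed_lin _ _).1.
  rewrite polar_linear; apply: (multilinear_op_closed_lin _ _).2 => //.
  rewrite polar_dword; apply: (closed_lin_sum (multilinear_op_closed_lin _ _)) => t ht.
  apply: (closed_linZ (multilinear_op_closed_lin _ _)); apply: multilinear_dword => //.
  apply/eqP; rewrite eqn_leq; apply/andP; split; first exact: dj.
  by rewrite leqNgt; apply/negP => /(vsurj_lt t); rewrite ht.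
have Spol (c : 'I_n -> 'I_r) : S _ (polar c z).
  apply: (closed_lin_sum (Slin _)) => X _; apply: (closed_linZ (Slin _)).
  by case: PS => _ _; exact.
have Mrest : mspan S (restit n z).
  apply: (closed_lin_sum (lspan_closed_lin _)) => c _; apply: lspan_mem.
  by exists n, (polar c z), (fun i => delta_mx 0 (c i)).
have Srest : S _ (restit n z).
  apply: (closed_lin_sum (Slin _)) => X _; case: PS => _ _; exact.
rewrite -[z](addrNK (K^-1 *: restit n z)) addrC.
apply: (lspan_lin _ Mrest); apply: IH.
  by apply: (closed_linB (Slin _)) => //; exact: (closed_linZ (Slin _)).
elim/lspan_ind: z / zn {Sz ML Spol Mrest Srest} => [|a x y [j [b [dj ->]]] IHz].
  have := @restit_linear r n (-1) 0 0; rewrite scaler0 addr0 scaleN1r addNr => ->.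
  by rewrite scaler0 subr0; exact: lspan0.
rewrite restit_linear scalerDr opprD addrACA scalerA [_ * a]mulrC -scalerA -scalerBr.
apply: lspan_lin => //; rewrite restit_dword; last exact: dj.
have [e|ne] := eqVneq (d j) n.
  by rewrite e mulr1 scalerA -/K mulVf // scale1r subrr; exact: lspan0.
rewrite mulr0 scale0r scaler0 subr0; apply: lspan_mem; exists j, b; split=> //.
by rewrite ltn_neqAle ne; exact: dj.
Qed.

End TensorSum.

Lemma multilinear_op_ntrans (F G : functor) (q : ntrans F G) n (m : F 'rV[rat]_n) :
  multilinear_op m -> multilinear_op (q _ m).
Proof. by move=> Pm V v i a x y; rewrite /opval -!ntnat -[RHS]linearP; congr (q V _); exact: Pm. Qed.

Lemma multilinear_op_ntransI (F G : functor) (i : ntrans F G) n (m : F 'rV[rat]_n) :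
  (forall V, injective (i V)) -> multilinear_op (i _ m) -> multilinear_op m.
Proof.
by move=> inj Pm V v k a x y; apply: inj; rewrite linearP !ntnat; exact: Pm.
Qed.

(** [S'] is the image under [i] of the preimage of [S] under [q]. Multilinearity is reflected by the
    injective [i] and preserved by [q], so generators found in the sum of tensor powers give
    generators of [S]. *)
Lemma mspan_polynomial (F : functor) (S : setfam F) :
  Defs.polynomial F -> subfunctor S -> subfam S (mspan S).
Proof.
move=> [J [d [G [i [q [injI surjQ]]]]]] PS V x Sx.
have [S0 SD Sf] := PS.
pose S' : setfam (dsum (fun j => tpow (d j))) := fun V z => exists y : G V, S V (q V y) /\ z = i V y.
have PS' : subfunctor S'.
  split=> [W|W a _ _ [y [Sy ->]] [y' [Sy' ->]]|W W' f _ [y [Sy ->]]].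
  - by exists 0; rewrite !linear0.
  - by exists (a *: y + y'); rewrite !linearP; split=> //; apply: SD.
  - by exists (fmap G f y); rewrite !ntnat; split=> //; apply: Sf.
have [y qy] := surjQ V x.
suff : exists y', i V y' = i V y /\ mspan S (q V y').
  by move=> [y' [/injI ->]]; rewrite qy.
have : S' V (i V y) by exists y; rewrite qy.
move=> /(mspan_tensor_sum PS'); elim/lspan_ind => [|a z z' [n [m [v [[m' [Sm' em]] Pm ->]]]] [y' [<- IH]]].
  by exists 0; rewrite !linear0; split=> //; exact: lspan0.
exists (a *: opval m' v + y'); split; first by rewrite linearP em /opval ntnat.
rewrite linearP; apply: lspan_cons => //; exists n, (q _ m'), v; split=> //.
  by apply: multilinear_op_ntrans; apply: multilinear_op_ntransI injI _; rewrite -em.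
by rewrite /opval ntnat.
Qed.

(** * Symmetrizers and antisymmetrizers of bounded size *)

Lemma subset_of_card (T : finType) (A : {set T}) n :
  (n <= #|A|)%N -> exists X : {set T}, X \subset A /\ #|X| = n.
Proof.
move=> nA; exists [set x in take n (enum A)]; split.
  by apply/subsetP => x; rewrite inE => /mem_take; rewrite mem_enum.
rewrite cardsE; have /card_uniqP -> : uniq (take n (enum A)) by rewrite take_uniq ?enum_uniq.
by rewrite size_takel // -cardE.
Qed.

Section Symmetrizers.
Variables (T : finType) (W : lmodType rat) (Z : W -> Prop).
Hypothesis Zlin : closed_lin Z.
Implicit Types (X D : {set T}) (s t u y : {perm T}) (x a p q c : T).

(** Decomposition into cosets of the symmetric group of [X], the coset of [u] being recorded by the
    preimage [q] of [p] under [u]. *)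
Lemma sum_perm_onU1 X p (F : {perm T} -> W) : p \notin X ->
  \sum_(u | perm_on (p |: X) u) F u =
  \sum_(q in p |: X) \sum_(u | perm_on X u) F (tperm q p * u)%g.
Proof.
move=> pX; rewrite (partition_big (fun u : {perm T} => (u^-1)%g p) (mem (p |: X))) /=; last first.
  move=> u uX; case: (boolP ((u^-1)%g p \in p |: X)) => // h.
  by have := out_perm uX h; rewrite permKV => e; rewrite -{1}e setU11 in h.
apply: eq_bigr => q qX; rewrite (reindex_inj (mulgI (tperm q p))) /=; apply: eq_bigl => u.
have tq : perm_on (p |: X) (tperm q p).
  by apply: (subset_trans (tperm_on _ _)); rewrite subUset !sub1set qX setU11.
rewrite invMg tpermV permM.
apply/andP/idP => [[uX /eqP e]|uX].
  have {}e : (u^-1)%g p = p by apply: (@perm_inj _ (tperm q p)); rewrite e tpermR.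
  have up : u p = p by rewrite -{1}e permKV.
  have : perm_on (p |: X) u.
    by rewrite -[u]mul1g -(tperm2 q p) -mulgA; apply: perm_onM.
  move=> /subsetP h; apply/subsetP => x xu; have := h x xu.
  rewrite in_setU1 => /orP[/eqP xp|//]; move: xu.
  by rewrite !inE xp up eqxx.
split.
  by apply: perm_onM => //; apply: (subset_trans uX); apply: subsetUr.
have up : u p = p by exact: out_perm uX pX.
have -> : (u^-1)%g p = p by rewrite -{1}up permK.
by rewrite tpermR.
Qed.

Variables (phi : {perm T} -> W) (D : {set T}) (N : nat).
Hypothesis symZ : forall X s, X \subset D -> #|X| = N ->
  Z (\sum_(u | perm_on X u) phi (u * s)%g).
Hypothesis altZ : forall X s, X \subset D -> #|X| = N ->
  Z (\sum_(u | perm_on X u) (-1) ^+ u *: phi (u * s)%g).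

Definition stab (b : T -> T) t := perm_on D t && [forall x, b (t x) == b x].

(** The colouring [b] encodes a partition of [D] into rows, and [stab b] is its Young subgroup;
    [ysym b] is thus a row symmetrizer. For [b] the identity it is [phi] itself. *)
Definition ysym (b : T -> T) s : W := \sum_(t | stab b t) phi (t * s)%g.

Definition cls (b : T -> T) c := [set x in D | b x == c].

Definition yalt (b : T -> T) X s : W :=
  \sum_(u | perm_on X u) (-1) ^+ u *: ysym b (u * s)%g.

(** Permutations of a subset [X] of one class do not change [ysym b s], so symmetrizing over an [X]
    with [N] elements only multiplies it by a positive integer. *)
Lemma ysym_big_class b c s : (N <= #|cls b c|)%N -> Z (ysym b s).
Proof.
move=> /subset_of_card[X [Xc cX]].
have XD : X \subset D.
  by apply: (subset_trans Xc); apply/subsetP => x; rewrite inE => /andP[].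
have : Z (\sum_(u : {perm T} | perm_on X u) ysym b s).
  have -> : \sum_(u : {perm T} | perm_on X u) ysym b s =
      \sum_(t | stab b t) \sum_(u | perm_on X u) phi (u * (t * s))%g.
    rewrite [RHS]exchange_big /=; apply: eq_bigr => u uX.
    rewrite /ysym (reindex_inj (mulgI u)); apply: eq_big => t /=.
      have ub x : b (u x) = b x.
        have [xX|xX] := boolP (x \in X); last by rewrite (out_perm uX).
        have uxX : u x \in X by rewrite perm_closed.
        move: (subsetP Xc _ xX) (subsetP Xc _ uxX).
        by rewrite !inE => /andP[_ /eqP ->] /andP[_ /eqP ->].
      have uD : perm_on D u by exact: subset_trans uX XD.
      congr (_ && _).
        apply/idP/idP => h; last exact: perm_onM.
        by rewrite -[t](mulKg u); apply: perm_onM => //; apply: perm_onV.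
      apply/forallP/forallP => h x; last by rewrite permM (eqP (h _)) ub.
      have := h ((u^-1)%g x); rewrite permM permKV => /eqP ->.
      by rewrite -{2}(permKV u x) ub.
    by rewrite mulgA.
  by apply: (closed_lin_sum Zlin) => t _; apply: symZ.
rewrite sumr_const -scaler_nat; apply: (closed_linZI Zlin).
rewrite pnatr_eq0 -lt0n; apply/card_gt0P; exists 1%g; exact: perm_on1.
Qed.

(** The sum equals the one over the points [a] of the class of [p] in which [a] is moved to the
    class [k]. Indeed, after the substitution [q = y a], both are sums of [phi (y * s)] over the
    pairs of such an [a] and a permutation [y] of [D] with [upd b p k (y x) = upd b a k x] for all
    [x]. *)
Lemma ysym_exchange b p k s : p \in D -> b p != k ->
  (forall a r, a \in cls b (b p) -> Z (ysym (upd b a k) r)) ->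
  Z (\sum_(q in p |: cls b k) ysym b (tperm p q * s)%g).
Proof.
move=> pD bp h.
have onD a y : a \in D -> perm_on D (y * tperm p a)%g = perm_on D y.
  move=> aD; have tD : perm_on D (tperm p a).
    by apply: (subset_trans (tperm_on _ _)); rewrite subUset !sub1set pD.
  by apply/idP/idP => yD; [rewrite -[y](mulgK (tperm p a)) tpermV|]; apply: perm_onM.
have reD b' a : ysym b' (tperm p a * s)%g = \sum_(y | stab b' (y * tperm p a)%g) phi (y * s)%g.
  rewrite /ysym [RHS](reindex_inj (mulIg (tperm p a))); apply: eq_big => t.
    by rewrite -mulgA tperm2 mulg1.
  by rewrite -!mulgA.
have -> : \sum_(q in p |: cls b k) ysym b (tperm p q * s)%g =
    \sum_(a in cls b (b p)) ysym (upd b a k) (tperm p a * s)%g.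
  under eq_bigr do rewrite reD big_mkcond.
  under [RHS]eq_bigr do rewrite reD big_mkcond.
  rewrite exchange_big [RHS]exchange_big; apply: eq_bigr => y _.
  rewrite (reindex_inj (@perm_inj _ y)) /= big_mkcond [RHS]big_mkcond /=.
  apply: eq_bigr => a _; rewrite -!if_and; congr (if _ then _ else _).
  have inD q : q \in p |: cls b k -> q \in D.
    by rewrite !inE => /orP[/eqP ->|/andP[]].
  apply/andP/andP => -[qk /andP[yD /forallP e]]; have := qk; rewrite !inE.
    move=> /orP qk'.
    have {}yD : perm_on D y by rewrite -(onD (y a)) // inD.
    have ba : b a = b p by have := e a; rewrite permM tpermR => /eqP.
    have aD : a \in D by rewrite -(perm_closed _ yD) inD.
    split; first by rewrite aD ba eqxx.
    rewrite /stab onD // yD; apply/forallP => x; rewrite permM /upd.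
    have [->|xa] := eqVneq x a.
      case: tpermP => [_|ya|yp ya]; rewrite ?eqxx //.
        have [_|pa] := eqVneq p a; first by rewrite eqxx.
        case: qk' => [/eqP yap|/andP[_]]; last by rewrite ya ba.
        by case/eqP: pa; rewrite -yap ya.
      by rewrite (introF eqP ya); case: qk' => [/eqP //|/andP[_ //]].
    have yxa : y x != y a by rewrite (inj_eq perm_inj).
    have := e x; rewrite permM.
    case: tpermP => [yxp|/eqP|/eqP yxp _]; [|by rewrite (negbTE yxa)|].
      rewrite yxp tpermL eqxx => /eqP <-; rewrite eq_sym; case: qk' => [/eqP yap|/andP[_ //]].
      by rewrite yap yxp eqxx in yxa.
    case: (tpermP p a (y x)) => [/eqP|yxa'|_ /eqP yx]; [by rewrite (negbTE yxp)| |by rewrite (negbTE yx)].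
    by rewrite yxa' ba; have [pa|//] := eqVneq p a; move: yxp; rewrite yxa' pa eqxx.
  move=> /andP[aD /eqP ba].
  rewrite onD // in yD.
  have yaD : y a \in D by rewrite perm_closed.
  have qk' : y a = p \/ b (y a) = k.
    have := e a; rewrite permM /upd eqxx.
    case: tpermP => [->|yaa|_ /eqP yaa]; first by left.
      have [pa _|_] := eqVneq p a; first by left; rewrite yaa pa.
      by rewrite -ba -[in b a]yaa => /eqP; right.
    by rewrite (negbTE yaa) => /eqP; right.
  split; first by case: qk' => [->|->]; rewrite ?eqxx // yaD orbT.
  rewrite /stab onD // yD; apply/forallP => x; rewrite permM.
  have [->|xa] := eqVneq x a; first by rewrite tpermR ba.
  have yxa : y x != y a by rewrite (inj_eq perm_inj).
  have := e x; rewrite permM /upd (negbTE xa).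
  case: (tpermP p (y a) (y x)) => [yxp|/eqP|/eqP yxp _]; [|by rewrite (negbTE yxa)|].
    rewrite yxp tpermL eqxx => /eqP <-; case: qk' => [yap|-> //].
    by rewrite yap yxp eqxx in yxa.
  case: (tpermP p a (y x)) => [/eqP|yxa'|_ /eqP yx]; [by rewrite (negbTE yxp)| |by rewrite (negbTE yx)].
  by rewrite yxa' ba; have [pa|//] := eqVneq p a; move: yxp; rewrite yxa' pa eqxx.
by apply: (closed_lin_sum Zlin) => a ha; exact: h.
Qed.

(** Conjugation by an element [t] of the Young subgroup turns the antisymmetrizer on [X] into the
    one on the preimage of [X] under [t], again a subset of [D] with [N] elements; so [altZ] applies
    to each [t] separately. *)
Lemma yalt_zero b X s : X \subset D -> #|X| = N -> Z (yalt b X s).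
Proof.
move=> XD cX; rewrite /yalt.
under eq_bigr do rewrite scaler_sumr.
rewrite exchange_big /=; apply: (closed_lin_sum Zlin) => t /andP[tD _].
have tX : t @^-1: X \subset D.
  by apply/subsetP => x; rewrite inE => /(subsetP XD); rewrite perm_closed.
have ct : #|t @^-1: X| = N by rewrite card_preimset //; exact: perm_inj.
have := altZ (t * s)%g tX ct.
rewrite (reindex_inj (conjg_inj t^-1%g)) /=.
have E u : perm_on (t @^-1: X) (u ^ t^-1)%g = perm_on X u.
  rewrite /perm_on; apply/subsetP/subsetP => h x; rewrite !inE.
    move=> ux; have := h ((t^-1)%g x); rewrite !inE permKV; apply.
    by rewrite conjgE invgK !permM permKV (inj_eq perm_inj).
  rewrite conjgE invgK !permM => ux; apply: h; rewrite inE.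
  by apply: contraNneq ux => ->; rewrite permK.
rewrite (eq_bigl _ _ E); congr (Z _); apply: eq_bigr => u _.
rewrite odd_permJ conjgE invgK !mulgA; congr (_ *: phi _).
by rewrite -!mulgA mulKg.
Qed.

(* Summing over [p] in [cls b c], each transposition of [p] with an element of [X] acts
   as -1 by [ysym_exchange], so that one obtains the nonzero multiple
   [#|cls b c| + #|X|] of [yalt b X]. *)
Lemma yalt_step b X c : X \subset D -> cls b c != set0 -> (forall x, x \in X -> b x != c) ->
  (forall x a r, x \in X -> a \in cls b (b x) -> Z (ysym (upd b a c) r)) ->
  (forall p, p \in cls b c -> forall s, Z (yalt b (p |: X) s)) ->
  forall s, Z (yalt b X s).
Proof.
move=> XD /set0Pn[p0 p0c] Xc hX hp s.
have rel q r : q \in X -> Z (ysym b r + \sum_(p in cls b c) ysym b (tperm q p * r)%g).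
  move=> qX; have := ysym_exchange r (subsetP XD _ qX) (Xc _ qX) (fun a r => @hX q a r qX).
  rewrite big_setU1 /=; first by rewrite tperm1 mul1g.
  by rewrite inE negb_and (Xc _ qX) orbT.
have : Z (\sum_(p in cls b c) yalt b (p |: X) s + \sum_(u | perm_on X u) (-1) ^+ u *:
    \sum_(q in X) (ysym b (u * s)%g + \sum_(p in cls b c) ysym b (tperm q p * (u * s))%g)).
  apply: (closed_linD Zlin); first by apply: (closed_lin_sum Zlin) => p /hp.
  apply: (closed_lin_sum Zlin) => u _; apply: (closed_linZ Zlin).
  by apply: (closed_lin_sum Zlin) => q /rel.
suff -> : \sum_(p in cls b c) yalt b (p |: X) s + \sum_(u | perm_on X u) (-1) ^+ u *:
    \sum_(q in X) (ysym b (u * s)%g + \sum_(p in cls b c) ysym b (tperm q p * (u * s))%g) =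
    (#|cls b c| + #|X|)%:R *: yalt b X s.
  apply: (closed_linZI Zlin); rewrite pnatr_eq0 addn_eq0 negb_and -lt0n.
  by apply/orP; left; apply/card_gt0P; exists p0.
have E p : p \in cls b c -> yalt b (p |: X) s = \sum_(u | perm_on X u) (-1) ^+ u *:
    (ysym b (u * s)%g - \sum_(q in X) ysym b (tperm q p * (u * s))%g).
  move=> pc; have pX : p \notin X.
    by apply: contraL pc => /Xc h; rewrite inE negb_and h orbT.
  rewrite /yalt (sum_perm_onU1 _ pX) big_setU1 //= tperm1.
  under eq_bigr do rewrite mul1g.
  rewrite exchange_big -big_split; apply: eq_bigr => u _ /=.
  rewrite scalerBr; congr (_ + _); rewrite scaler_sumr -sumrN; apply: eq_bigr => q qX.
  rewrite odd_permM odd_tperm; have -> : (q != p) by apply: contraNneq pX => <-.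
  by rewrite -mulgA /=; case: (odd_perm u); rewrite !(expr0, expr1) ?scaleN1r ?scale1r ?opprK.
rewrite (eq_bigr _ E) exchange_big -big_split /= /yalt scaler_sumr; apply: eq_bigr => u _.
rewrite -scaler_sumr -scalerDr scalerA mulrC -scalerA; congr (_ *: _).
set y := ysym b (u * s)%g; pose f q p := ysym b (tperm q p * (u * s))%g.
rewrite -/f [X in _ + X](_ : _ = y *+ #|X| + \sum_(p in cls b c) \sum_(q in X) f q p); last first.
  by rewrite big_split sumr_const [in RHS]exchange_big.
rewrite [X in X + _](_ : _ = y *+ #|cls b c| - \sum_(p in cls b c) \sum_(q in X) f q p); last first.
  by rewrite big_split sumrN sumr_const.
by rewrite addrACA addNr addr0 -mulrnDr scaler_nat.
Qed.

(** Starting from the empty set, [X] grows into a column with one point in each class used, while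
    [cs] lists the classes still to be used. At [N] points [yalt_zero] applies; [hb] disposes of the
    terms created by the exchanges. *)
Lemma yalt_chain b cs X :
  (forall i c a r, (#|cls b i| <= #|cls b c|)%N -> i != c -> a \in cls b i ->
     Z (ysym (upd b a c) r)) ->
  X \subset D -> (#|X| + size cs)%N = N -> uniq cs ->
  (forall c, c \in cs -> cls b c != set0) ->
  (forall x c, x \in X -> c \in cs -> b x != c /\ (#|cls b (b x)| <= #|cls b c|)%N) ->
  pairwise (fun i c => #|cls b i| <= #|cls b c|)%N cs ->
  forall s, Z (yalt b X s).
Proof.
move=> hb; elim: cs X => [|c cs IH] X XD cX /= ucs ncs hX pcs s.
  by apply: yalt_zero => //; rewrite addn0 in cX.
move: ucs pcs => /andP[ccs ucs] /andP[/allP ac pcs].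
have inX x : x \in X -> b x != c by move=> xX; have [] := hX x c xX (mem_head _ _).
apply: (@yalt_step b X c) => //; first by apply: ncs; rewrite mem_head.
  move=> x a r xX; apply: hb; last exact: inX.
  by have [] := hX x c xX (mem_head _ _).
move=> p pc {}s; have := pc; rewrite inE => /andP[pD /eqP bp].
have pX : p \notin X by apply: contraL pc => /inX h; rewrite inE negb_and h orbT.
apply: IH => //.
- by rewrite subUset sub1set pD.
- by rewrite cardsU1 pX add1n addSnnS.
- by move=> e ecs; apply: ncs; rewrite inE ecs orbT.
move=> x e; rewrite in_setU1 => /orP[/eqP ->|xX] ecs.
  by rewrite bp ac //; split=> //; apply: contraNneq ccs => ->.
by apply: hX => //; rewrite inE ecs orbT.
Qed.

Lemma yalt0 b s : yalt b set0 s = ysym b s.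
Proof.
rewrite /yalt (big_pred1 1%g) ?odd_perm1 ?scale1r ?mul1g // => u.
apply/idP/eqP => [u0|->]; last exact: perm_on1.
by apply/permP => x; rewrite perm1; apply: (out_perm u0); rewrite inE.
Qed.

Lemma sum_cls b : (\sum_c #|cls b c|)%N = #|D|.
Proof.
rewrite -[RHS]sum1_card [RHS](partition_big b predT) //=; apply: eq_bigr => c _.
by rewrite -sum1_card; apply: eq_bigl => x; rewrite inE.
Qed.

Definition dispersion b := (\sum_c #|cls b c| ^ 2)%N.

(** Sizes B+1 <= A become B and A+1, so the sum of squares grows by 2(A-B) > 0. *)
Lemma dispersion_upd b i c a : (#|cls b i| <= #|cls b c|)%N -> i != c -> a \in cls b i ->
  (dispersion b < dispersion (upd b a c))%N.
Proof.
rewrite inE => ic ic' /andP[aD /eqP ba].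
rewrite /dispersion (bigD1 i) //= (bigD1 c) 1?eq_sym //=.
rewrite [X in (_ < X)%N](bigD1 i) //= [X in (_ < _ + X)%N](bigD1 c) 1?eq_sym //=.
have -> : (\sum_(k | (k != i) && (k != c)) #|cls (upd b a c) k| ^ 2 =
          \sum_(k | (k != i) && (k != c)) #|cls b k| ^ 2)%N.
  apply: eq_bigr => k /andP[ki kc]; congr (#|pred_of_set _| ^ 2)%N.
  apply/setP => x; rewrite !inE /upd; have [->|//] := eqVneq x a.
  by rewrite ba eq_sym (negbTE kc) eq_sym (negbTE ki).
have -> : #|cls (upd b a c) c| = #|cls b c|.+1.
  have -> : cls (upd b a c) c = a |: cls b c.
    apply/setP => x; rewrite !inE /upd; have [->|//] := eqVneq x a.
    by rewrite aD eqxx.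
  by rewrite cardsU1 inE ba (negbTE ic') andbF.
have := cardsD1 a (cls b i); rewrite inE aD ba eqxx /= add1n => e.
have -> : #|cls (upd b a c) i| = #|cls b i :\ a|.
  congr #|pred_of_set _|; apply/setP => x; rewrite !inE /upd; have [->|//] := eqVneq x a.
  by rewrite eq_sym (negbTE ic') andbF.
rewrite !addnA ltn_add2r; move: ic; rewrite e; set A := #|_|; set B := #|_| => AB.
nia.
Qed.

(* Descending induction on the dispersion.  If no class has [N] elements, there are at
   least [N] nonempty classes; ordering them by size, all exchanges move a point to a
   class which is at least as large, and this increases the dispersion. *)
Lemma ysym_mem b s : (N.-1 ^ 2 < #|D|)%N -> Z (ysym b s).
Proof.
move=> ND.
have dis_le b' : (dispersion b' <= #|T| ^ 3)%N.
  rewrite expnS -sum_nat_const; apply: leq_sum => c _.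
  by rewrite leq_exp2r // max_card.
have [n hn] : exists n, (#|T| ^ 3 < dispersion b + n)%N.
  by exists (#|T| ^ 3).+1; rewrite addnS ltnS leq_addl.
elim: n b s hn => [|n IH] b s hn; first by move: hn; rewrite addn0 ltnNge dis_le.
have [/existsP[c]|/existsPn hc] := boolP [exists c, (N <= #|cls b c|)%N]; first exact: ysym_big_class.
pose r (c e : T) := (#|cls b c| <= #|cls b e|)%N.
have rtr : transitive r by move=> ? ? ?; exact: leq_trans.
pose cs := sort r (enum [set c | cls b c != set0]).
(* Fewer than [N] nonempty classes, each with fewer than [N] points, would leave at most (N-1)^2
   points in [D]: this is the origin of the bound. *)
have cs_size : (N <= size cs)%N.
  rewrite leqNgt; apply/negP; rewrite size_sort -cardE => lt_cs.
  suff : (#|D| <= N.-1 ^ 2)%N by rewrite leqNgt ND.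
  rewrite -(sum_cls b) (bigID (fun c => cls b c != set0)) /= [X in (_ + X)%N]big1 ?addn0; last first.
    by move=> c /negPn/eqP ->; rewrite cards0.
  apply: (@leq_trans (\sum_(c | cls b c != set0) N.-1)).
    by apply: leq_sum => c _; have := hc c; rewrite -ltnNge; case: (N).
  rewrite sum_nat_const -mulnn leq_mul2r; apply/orP; right.
  by have := lt_cs; rewrite cardsE; case: (N).
rewrite -yalt0; apply: (@yalt_chain b (take N cs)) => //.
- by move=> i c a t ic ic' ai; apply: IH; have := dispersion_upd ic ic' ai; lia.
- by rewrite sub0set.
- by rewrite cards0 size_takel.
- by rewrite take_uniq // sort_uniq enum_uniq.
- by move=> c /mem_take; rewrite mem_sort mem_enum inE.
- by move=> x c; rewrite inE.
have : pairwise r cs by rewrite -sorted_pairwise // sort_sorted // => ? ?; exact: leq_total.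
by rewrite -{1}[cs](cat_take_drop N) pairwise_cat => /and3P[].
Qed.

Theorem symmetrizers_span s : (N.-1 ^ 2 < #|D|)%N -> Z (phi s).
Proof.
move=> /(ysym_mem id s); rewrite /ysym (big_pred1 1%g) ?mul1g // => t.
apply/andP/eqP => [[_ /forallP h]|->]; last by split; [exact: perm_on1|apply/forallP => x; rewrite perm1].
by apply/permP => x; rewrite perm1; apply/eqP.
Qed.

End Symmetrizers.

(** * Symmetrizing one slot at a time *)

HB.instance Definition _ (A : tca) (V : lmodType rat) :=
  Monoid.isComLaw.Build (A V) (tone A V) (@tmul A V) (@tmulA A V) (@tmulC A V) (@tmul1 A V).

Section TcaLinear.
Variables (A : tca) (V : lmodType rat).

Lemma tmul_sumr (x : A V) (J : Type) (r : seq J) (P : pred J) (F : J -> A V) :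
  tmul x (\sum_(j <- r | P j) F j) = \sum_(j <- r | P j) tmul x (F j).
Proof.
have tlin : linear (@tmul A V x) by move=> a y z; rewrite tmul_linear_r.
exact: (raddf_sum (linear_fun_of tlin)).
Qed.

Lemma tmulZr (x : A V) a y : tmul x (a *: y) = a *: tmul x y.
Proof.
have tlin : linear (@tmul A V x) by move=> b y' z; rewrite tmul_linear_r.
exact: (linearZZ (linear_fun_of tlin)).
Qed.

End TcaLinear.

Section SlotOperators.
Variables (T J : finType) (V W : lmodType rat).
Implicit Types (X Y : {set T}) (k l : J) (s t : {perm T}) (v : T -> J -> V).
Implicit Types (h : (T -> J -> V) -> W) (e : J -> bool) (b : bool).

(** The arguments form a matrix: [T] indexes the factors of a product, and [J] the argument slots of
    a single factor. *)
Definition slot_act k s v : T -> J -> V := fun x j => v (if j == k then s x else x) j.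

Lemma slot_actM k s t v : slot_act k s (slot_act k t v) = slot_act k (s * t)%g v.
Proof.
by apply/funext => x; apply/funext => j; rewrite /slot_act; case: eqP => // _; rewrite permM.
Qed.

Lemma slot_actC k l s t v : k != l ->
  slot_act k s (slot_act l t v) = slot_act l t (slot_act k s v).
Proof.
move=> kl; apply/funext => x; apply/funext => j; rewrite /slot_act.
by have [->|jk] := eqVneq j k; rewrite ?(negbTE kl).
Qed.

Lemma slot_act1 k v : slot_act k 1%g v = v.
Proof. by apply/funext => x; apply/funext => j; rewrite /slot_act perm1 if_same. Qed.

Definition slot_op X k b h v : W :=
  \sum_(s | perm_on X s) (-1) ^+ (b && odd_perm s) *: h (slot_act k s v).

Definition slot_ops X (ks : seq J) e h := foldr (fun k => slot_op X k (e k)) h ks.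

Lemma slot_opC X Y k l b c h : k != l ->
  slot_op X k b (slot_op Y l c h) = slot_op Y l c (slot_op X k b h).
Proof.
move=> kl; apply/funext => v; rewrite /slot_op.
under eq_bigr do rewrite scaler_sumr.
rewrite exchange_big /=; apply: eq_bigr => t _; rewrite scaler_sumr; apply: eq_bigr => s _.
by rewrite !scalerA mulrC slot_actC // eq_sym.
Qed.

Lemma slot_op_act X k b h s : perm_on X s ->
  slot_op X k b (fun v => h (slot_act k s v)) =
  fun v => (-1) ^+ (b && odd_perm s) *: slot_op X k b h v.
Proof.
move=> sX; apply/funext => v; rewrite /slot_op scaler_sumr.
rewrite [RHS](reindex_inj (mulgI s)); apply: eq_big => t /=.
  apply/idP/idP => tX; first exact: perm_onM.
  by rewrite -[t](mulKg s); apply: perm_onM => //; exact: perm_onV.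
move=> _; rewrite slot_actM scalerA odd_permM; congr (_ *: _).
by case: b; case: (odd_perm s); case: (odd_perm t); rewrite /= ?expr0 ?expr1 ?mulr1 ?mul1r ?mulrNN ?mulr1.
Qed.

Lemma slot_opZ X k b h a : slot_op X k b (fun v => a *: h v) = fun v => a *: slot_op X k b h v.
Proof.
apply/funext => v; rewrite /slot_op scaler_sumr; apply: eq_bigr => s _.
by rewrite !scalerA mulrC.
Qed.

Lemma slot_opsZ X ks e h a : slot_ops X ks e (fun v => a *: h v) = fun v => a *: slot_ops X ks e h v.
Proof. by elim: ks => //= k ks ->; rewrite slot_opZ. Qed.

Lemma slot_op_sum X k b (R : Type) (r : seq R) (h : R -> (T -> J -> V) -> W) :
  slot_op X k b (fun v => \sum_(i <- r) h i v) = fun v => \sum_(i <- r) slot_op X k b (h i) v.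
Proof.
apply/funext => v; rewrite /slot_op exchange_big /=; apply: eq_bigr => s _.
by rewrite scaler_sumr.
Qed.

Lemma slot_ops_sum X ks e (R : Type) (r : seq R) (h : R -> (T -> J -> V) -> W) :
  slot_ops X ks e (fun v => \sum_(i <- r) h i v) = fun v => \sum_(i <- r) slot_ops X ks e (h i) v.
Proof. by elim: ks => //= k ks ->; rewrite slot_op_sum. Qed.

(** The operator on [Y] absorbs each permutation of [X] with a sign that cancels the one in front of
    it, so [c] is the order of the symmetric group of [X]. *)
Lemma slot_op_absorb X Y k b h : X \subset Y -> exists2 c : rat, c != 0 &
  slot_op Y k b (slot_op X k b h) = fun v => c *: slot_op Y k b h v.
Proof.
move=> XY; exists #|[set s | perm_on X s]|%:R.
  by rewrite pnatr_eq0 -lt0n; apply/card_gt0P; exists 1%g; rewrite inE perm_on1.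
rewrite {2}/slot_op.
have -> : (fun v => \sum_(s | perm_on X s) (-1) ^+ (b && odd_perm s) *: h (slot_act k s v)) =
  fun v => \sum_(s <- enum [set s | perm_on X s]) (-1) ^+ (b && odd_perm s) *: h (slot_act k s v).
  by apply/funext => v; rewrite big_enum /=; apply: eq_bigl => s; rewrite inE.
rewrite slot_op_sum; apply/funext => v; rewrite big_enum /=.
rewrite (eq_bigr (fun=> slot_op Y k b h v)) ?sumr_const ?scaler_nat // => s.
rewrite inE => sX; rewrite slot_opZ slot_op_act; last exact: subset_trans XY.
by rewrite scalerA -expr2 sqrr_sign scale1r.
Qed.

Lemma slot_ops_opC X Y k ks b e h : k \notin ks ->
  slot_op X k b (slot_ops Y ks e h) = slot_ops Y ks e (slot_op X k b h).
Proof.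
by elim: ks => //= l ks IH; rewrite inE negb_or => /andP[kl /IH <-]; exact: slot_opC.
Qed.

Lemma slot_ops_absorb X Y ks e h : X \subset Y -> uniq ks -> exists2 c : rat, c != 0 &
  slot_ops Y ks e (slot_ops X ks e h) = fun v => c *: slot_ops Y ks e h v.
Proof.
move=> XY; elim: ks => [_|k ks IH /= /andP[kks /IH[c c0 E]]].
  by exists 1; rewrite ?oner_eq0 //; apply/funext => v; rewrite scale1r.
rewrite -(slot_ops_opC _ _ _ _ _ kks) E slot_opZ.
have [c' c'0 E'] := slot_op_absorb k (e k) (slot_ops Y ks e h) XY.
exists (c * c'); first by rewrite mulf_neq0.
by rewrite slot_opZ E'; apply/funext => v; rewrite scalerA.
Qed.

Lemma slot_ops_act X ks e h k s : uniq ks -> k \in ks -> perm_on X s ->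
  slot_ops X ks e (fun v => h (slot_act k s v)) =
  fun v => (-1) ^+ (e k && odd_perm s) *: slot_ops X ks e h v.
Proof.
elim: ks => //= l ks IH /andP[lks uks]; rewrite inE.
have [->|kl] /= := eqVneq k l => kks sX; last first.
  by rewrite IH // slot_opZ.
have -> : slot_ops X ks e (fun v => h (slot_act l s v)) = fun v => slot_ops X ks e h (slot_act l s v).
  elim: ks lks {IH uks kks} => //= k' ks IH; rewrite inE negb_or => /andP[lk' /IH ->].
  apply/funext => v; rewrite /slot_op; apply: eq_bigr => t _.
  by rewrite slot_actC // eq_sym.
exact: slot_op_act.
Qed.

Lemma slot_ops_mem (Z : W -> Prop) X ks e h : closed_lin Z ->
  (forall v, Z (h v)) -> forall v, Z (slot_ops X ks e h v).
Proof.
move=> Zlin hZ; elim: ks => //= k ks IH v.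
by apply: (closed_lin_sum Zlin) => s _; apply: (closed_linZ Zlin).
Qed.

End SlotOperators.

Section SlotMonomials.
Variables (A : tca) (d : nat) (m : A 'rV[rat]_d) (V : lmodType rat).

Definition slot_mon (T : finType) (X : {set T}) (v : T -> 'I_d -> V) : A V :=
  \big[@tmul A V/tone A V]_(x in X) opval m (v x).

Lemma slot_ops_factor (T : finType) (X : {set T}) ks e
    (g h : (T -> 'I_d -> V) -> A V) :
  (forall k s v, perm_on X s -> g (slot_act k s v) = g v) ->
  slot_ops X ks e (fun v => tmul (g v) (h v)) = fun v => tmul (g v) (slot_ops X ks e h v).
Proof.
move=> gX; elim: ks => //= k ks ->; apply/funext => v; rewrite /slot_op.
rewrite tmul_sumr; apply: eq_bigr => s sX.
by rewrite gX // tmulZr.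
Qed.

Lemma slot_mon_act (T : finType) (X Y : {set T}) k s v : [disjoint X & Y] -> perm_on X s ->
  slot_mon Y (slot_act k s v) = slot_mon Y v.
Proof.
move=> dXY sX; apply: eq_bigr => x xY; congr opval; apply/funext => j.
rewrite /slot_act (out_perm sX) ?if_same //.
by apply/negP => xX; move/pred0P: dXY => /(_ x) /=; rewrite xX xY.
Qed.

Lemma slot_monD (T : finType) (X Y : {set T}) : X \subset Y ->
  @slot_mon T Y = fun v => tmul (slot_mon (Y :\: X) v) (slot_mon X v).
Proof.
move=> XY; apply/funext => v; rewrite /slot_mon (big_setID X) /= tmulC.
by rewrite (setIidPr XY).
Qed.

End SlotMonomials.

Section Nilpotency.
Variables (A : tca) (I : setfam A) (hI : gl_ideal I) (d : nat) (m : A 'rV[rat]_d).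

(* The slots not in [ks] are free.  For [ks] the list of all slots, this is the
   polarized form of the nilpotency of [m] at distinct letters, [e k] being the
   parity of the [k]-th one. *)
Definition slots_vanish (ks : seq 'I_d) := exists N : nat,
  forall (e : 'I_d -> bool) (V : lmodType rat) M (X : {set 'I_M}) v,
    #|X| = N -> I (slot_ops X ks e (@slot_mon A d m V 'I_M X) v).

Lemma eq_slot_ops (T J : finType) (V W : lmodType rat) (X : {set T}) (ks : seq J) e e'
    (h : (T -> J -> V) -> W) : {in ks, e =1 e'} -> slot_ops X ks e h = slot_ops X ks e' h.
Proof.
elim: ks => //= k ks IH E; rewrite (E k (mem_head _ _)) IH // => l lks.
by apply: E; rewrite inE lks orbT.
Qed.

(** Let [X] be an [N]-element subset of [Y]. By absorption, the operators on [X] can be inserted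
    before those on [Y]. They then meet the product over [X], which they bring into [I], times the
    product over the rest of [Y], which they leave alone. As [N] serves all parities [e], the
    symmetrizer and the antisymmetrizer of [X] in slot [k] both land in [I], and [symmetrizers_span]
    frees the slot. *)
Lemma slots_vanish_step k ks : uniq (k :: ks) -> slots_vanish (k :: ks) -> slots_vanish ks.
Proof.
move=> /= /andP[kks uks] [N hN]; exists (N.-1 ^ 2).+1 => e V M Y v cY.
have Zlin := subfunctor_closed_lin V hI.1.
pose h := slot_ops Y ks e (@slot_mon A d m V 'I_M Y).
have hop (b : bool) (X : {set 'I_M}) : X \subset Y -> #|X| = N -> forall w, I (slot_op X k b h w).
  move=> XY cX w; rewrite /h slot_ops_opC //.
  set g := slot_op X k b _.
  have [c c0 E] := slot_ops_absorb e g XY uks.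
  apply: (closed_linZI Zlin c0).
  rewrite -[_ *: _]/((fun v => c *: slot_ops Y ks e g v) w) -E.
  apply: slot_ops_mem => // {}w; rewrite /g -slot_ops_opC //.
  have -> : slot_op X k b (slot_ops X ks e (slot_mon m Y)) =
            slot_ops X (k :: ks) (upd e k b) (@slot_mon A d m V 'I_M Y).
    rewrite /= {1}/upd eqxx; congr slot_op; apply: eq_slot_ops => l lks.
    by rewrite /upd; case: eqP => // lk; rewrite -lk lks in kks.
  rewrite (slot_monD m V XY) slot_ops_factor; first by apply: hI.2; apply: hN.
  move=> l s u sX; apply: slot_mon_act sX.
  by rewrite -setI_eq0 setDE setICA setICr setI0.
have := @symmetrizers_span _ _ (@I V) Zlin (fun s => h (slot_act k s v)) Y N.
move/(_ _ _ 1%g); rewrite slot_act1; apply; last by rewrite cY.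
  move=> X s XY cX; have := hop false X XY cX (slot_act k s v); congr (I _).
  by apply: eq_bigr => u _; rewrite /= expr0 scale1r slot_actM.
move=> X s XY cX; have := hop true X XY cX (slot_act k s v); congr (I _).
by apply: eq_bigr => u _; rewrite slot_actM.
Qed.

Lemma slots_vanish_nilpotent : slots_vanish (enum 'I_d) ->
  exists N, forall (V : lmodType rat) (v : 'I_N -> 'I_d -> V),
    I (\big[@tmul A V/tone A V]_i opval m (v i)).
Proof.
suff h ks : uniq ks -> slots_vanish ks -> slots_vanish [::].
  move=> /h; case=> [|N hN]; first exact: enum_uniq.
  exists N => V v; have := hN (fun=> false) V N [set: 'I_N] v.
  rewrite cardsT card_ord => /(_ erefl); congr (I _); rewrite /= /slot_mon.
  by apply: eq_bigl => i; rewrite inE.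
elim: ks => // k ks IH u; move/(slots_vanish_step u); apply: IH.
by case/andP: u.
Qed.

End Nilpotency.

(** * Signs and polarization *)

Section KoszulSign.
Variables (T : Type) (odd_elt : T -> bool) (rk : T -> nat).
Hypothesis rk_inj : injective rk.

Definition inv_sign x y : rat := (-1) ^+ [&& odd_elt x, odd_elt y & (rk y < rk x)%N].

Definition koszul n (t : 'I_n -> T) : rat :=
  \prod_(p : 'I_n * 'I_n | (p.1 < p.2)%N) inv_sign (t p.1) (t p.2).

Lemma koszul_neq0 n (t : 'I_n -> T) : koszul t != 0.
Proof. by apply/prodf_neq0 => p _; rewrite signr_eq0. Qed.

Lemma inv_signC x y : x <> y ->
  inv_sign y x = (-1) ^+ (odd_elt x && odd_elt y) * inv_sign x y.
Proof.
move=> xy; rewrite /inv_sign -signr_addb andbCA; congr (_ ^+ (nat_of_bool _)).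
case: (odd_elt x) => //=; case: (odd_elt y) => //=.
by case: ltngtP => // /rk_inj.
Qed.

(** No position lies between [i] and [j], so all other pairs of positions are permuted with their
    order kept; only the pair of [i] and [j] contributes a change. *)
Lemma koszul_adj n (t : 'I_n -> T) (i j : 'I_n) : injective t -> j = i.+1 :> nat ->
  koszul (t \o tperm i j) = (-1) ^+ (odd_elt (t i) && odd_elt (t j)) * koszul t.
Proof.
move=> tinj ij.
have ltij : (i < j)%N by rewrite ij.
have ji : j <> i by move=> e; rewrite e ltnn in ltij.
rewrite /koszul (bigD1 (i, j)) //= [in RHS](bigD1 (i, j)) //= tpermL tpermR.
rewrite inv_signC; last by move=> /tinj /esym.
rewrite -mulrA; congr (_ * (_ * _)).
pose s (p : 'I_n * 'I_n) := (tperm i j p.1, tperm i j p.2).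
have sK : involutive s by move=> [a b]; rewrite /s /= !tpermK.
rewrite (reindex_inj (inv_inj sK)) /=; apply: eq_big => [[a b]|[a b] _] /=; last by rewrite !tpermK.
have sE : (s (a, b) == (i, j)) = ((a == j) && (b == i)).
  rewrite /s xpair_eqE /=; congr (_ && _).
    by rewrite -(inj_eq (@perm_inj _ (tperm i j))) tpermK tpermL.
  by rewrite -(inj_eq (@perm_inj _ (tperm i j))) tpermK tpermR.
rewrite sE xpair_eqE.
case: tpermP => [->|->|/eqP ai /eqP aj]; case: tpermP => [->|->|/eqP bi /eqP bj];
 rewrite ?eqxx ?ltnn ?andbT ?andbF //=;
 try move: bi bj; try move: ai aj; move: ij ltij; rewrite -!(inj_eq val_inj) /=; lia.
Qed.

(** An adjacent transposition conjugates this one into one of smaller span. The entry passed over is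
    passed twice, by entries of equal parity, so the two extra signs cancel. *)
Lemma koszul_tperm n (t : 'I_n -> T) (i j : 'I_n) : injective t -> i != j ->
  odd_elt (t i) = odd_elt (t j) ->
  koszul (t \o tperm i j) = (-1) ^+ odd_elt (t i) * koszul t.
Proof.
wlog: i j / (i < j)%N => [h|].
  move=> tinj ij o; have [lt|le] := ltnP i j; first exact: h.
  rewrite tpermC o; apply: h => //; last by rewrite eq_sym.
  by rewrite ltn_neqAle le andbT eq_sym.
have [k] := ubnP (j - i)%N; elim: k i j t => // k IH i j t hk ij tinj _ o.
have [e|ne] := eqVneq (j : nat) i.+1; first by rewrite koszul_adj // o andbb.
have j'P : (j.-1 < n)%N by apply: leq_ltn_trans (leq_pred _) (ltn_ord j).
pose j' := Ordinal j'P.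
have jj' : j = j'.+1 :> nat by rewrite /= prednK //; apply: leq_ltn_trans ij.
have ij' : (i < j')%N by rewrite /=; lia.
have nij' : i != j' by rewrite -(inj_eq val_inj) /=; lia.
have nij : i != j by rewrite -(inj_eq val_inj) /=; lia.
have njj : j' != j by rewrite -(inj_eq val_inj) /=; lia.
have e : (tperm j' j * tperm i j' * tperm j' j)%g = tperm i j.
  by rewrite -{1}[tperm j' j]tpermV -mulgA -conjgE tpermJ tpermL tpermD // eq_sym.
have -> : t \o tperm i j = ((t \o tperm j' j) \o tperm i j') \o tperm j' j.
  by apply/funext => x /=; rewrite -e !permM.
have inj1 : injective (t \o tperm j' j) by apply: inj_comp tinj _; exact: perm_inj.
have inj2 : injective ((t \o tperm j' j) \o tperm i j') by apply: inj_comp inj1 _; exact: perm_inj.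
have ti : tperm j' j i = i by rewrite tpermD // eq_sym.
have rj : tperm i j' j = j by rewrite tpermD // eq_sym.
have oj : odd_elt ((t \o tperm j' j) i) = odd_elt ((t \o tperm j' j) j').
  by rewrite /= ti tpermL.
rewrite koszul_adj //= (tpermR i j') rj ti (tpermR j' j).
rewrite (IH i j' _ _ ij' inj1 nij' oj); last by rewrite /=; lia.
rewrite koszul_adj //= ti o.
by rewrite [odd_elt (t j') && _]andbC; case: (odd_elt (t j)); case: (odd_elt (t j'));
  rewrite /= ?expr0 ?expr1; ring.
Qed.

End KoszulSign.

Lemma perm_adj_ind n (Q : 'S_n -> Prop) :
  Q 1%g -> (forall s (i j : 'I_n), j = i.+1 :> nat -> Q s -> Q (tperm i j * s)%g) ->
  forall s, Q s.
Proof.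
move=> Q1 Qadj.
have Qt k (i j : 'I_n) s : (j - i < k)%N -> (i < j)%N -> Q s -> Q (tperm i j * s)%g.
  elim: k i j s => // k IH i j s hk ij Qs.
  have [e|ne] := eqVneq (j : nat) i.+1; first exact: Qadj.
  have j'P : (j.-1 < n)%N by apply: leq_ltn_trans (leq_pred _) (ltn_ord j).
  pose j' := Ordinal j'P.
  have jj' : j = j'.+1 :> nat by rewrite /= prednK //; apply: leq_ltn_trans ij.
  have ij' : (i < j')%N by rewrite /=; lia.
  have nij : i != j by rewrite -(inj_eq val_inj) /=; lia.
  have nij' : i != j' by rewrite -(inj_eq val_inj) /=; lia.
  have e : (tperm j' j * tperm i j' * tperm j' j)%g = tperm i j.
    by rewrite -{1}[tperm j' j]tpermV -mulgA -conjgE tpermJ tpermL tpermD // eq_sym.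
  rewrite -e -!mulgA; apply: (Qadj _) => //; apply: IH => //; last exact: Qadj.
  by rewrite /=; lia.
move=> s; have [ts -> dts] := prod_tpermP s.
elim: ts dts => [|[i j] ts IH] /=; first by rewrite big_nil.
move=> /andP[ij /IH Qs]; rewrite big_cons /=.
case: (ltngtP i j) => [lt|lt|e]; first exact: (Qt (j - i).+1).
  by rewrite tpermC; apply: (Qt (i - j).+1).
by move: ij; rewrite /dpair /= -(inj_eq val_inj) /= e eqxx.
Qed.

Lemma perm_op_multilinear (F : functor) n (m : F 'rV[rat]_n) (s : 'S_n) :
  multilinear_op m -> multilinear_op (perm_op m s).
Proof.
move=> Pm V v i a x y; rewrite !opval_perm.
have E z : upd v i z \o s = upd (v \o s) ((s^-1)%g i) z.
  by apply/funext => l; rewrite /= /upd -(inj_eq (@perm_inj _ s) l) permKV.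
by rewrite !E Pm.
Qed.

Lemma perm_op1 (F : functor) n (m : F 'rV[rat]_n) : perm_op m 1%g = m.
Proof. by rewrite -[RHS]opval_delta; congr opval; apply/funext => i; rewrite perm1. Qed.

Lemma perm_opM (F : functor) n (m : F 'rV[rat]_n) (s t : 'S_n) :
  perm_op m (t * s)%g = perm_op (perm_op m t) s.
Proof.
rewrite [in RHS]/perm_op opval_perm; congr (opval m _).
by apply/funext => i /=; rewrite permM.
Qed.

Lemma sgval_perm (F : functor) (U : svect) n (m : F 'rV[rat]_n) (Pm : multilinear_op m)
    (s : 'S_n) (Ps : multilinear_op (perm_op m s)) (u : 'I_n -> homog U) :
  sgval (SGen Ps u) =
  koszul (fun i => parity (u i)) (@nat_of_ord n) s *: sgval (SGen Pm (u \o s)).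
Proof.
elim/perm_adj_ind: s m Pm Ps => [|s i j ij IH] m Pm Ps.
  rewrite (sgen_eq Ps Pm (perm_op1 m) (erefl _)).
  have -> : koszul (fun i => parity (u i)) (@nat_of_ord n) (1%g : 'S_n) = 1.
    apply: big1 => -[a b] /= ab; rewrite /inv_sign !perm1 [(_ < a)%N]ltnNge ltnW //.
    by rewrite !andbF.
  rewrite scale1r; congr sgval; apply: sgen_eq => //.
  by apply/funext => i /=; rewrite perm1.
have Pt := perm_op_multilinear (tperm i j) Pm.
have Pts := perm_op_multilinear s Pt.
rewrite (sgen_eq Ps Pts (perm_opM _ _ _) (erefl _)) (IH _ Pt).
rewrite (sr_sym (sgvalP _ _) Pm) // scalerA.
have -> : (tperm i j * s)%g = s \o tperm i j :> ('I_n -> 'I_n).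
  by apply/funext => l; rewrite permM.
rewrite koszul_adj //; last 2 first.
- exact: val_inj.
- exact: perm_inj.
by rewrite mulrC; congr (_ *: sgval _); apply: sgen_eq => //; apply/funext => l /=; rewrite permM.
Qed.

(** * The basis of Q^{oo|oo} and polarization at its letters *)

Definition letter := (bool * nat)%type.

Definition lett (a : letter) : homog Qinf :=
  if a.1 then inr ('X^(a.2) : {poly rat}) else inl ('X^(a.2) : {poly rat}).

Definition letter_coef (a : letter) (u : homog Qinf) : rat :=
  match u with
  | inl f => if a.1 then 0 else (f : {poly rat})`_(a.2)
  | inr f => if a.1 then (f : {poly rat})`_(a.2) else 0
  end.

Lemma letter_coef_lett a b : letter_coef a (lett b) = (a == b)%:R.
Proof. by case: a b => [[] i] [[] j]; rewrite /lett /= ?coefXn // xpair_eqE eq_sym. Qed.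

Lemma letter_coef_parity a u : letter_coef a u != 0 -> parity u = a.1.
Proof. by case: u a => f [[] i]; rewrite /= ?eqxx. Qed.

Section Polarization.
Variables (F : functor) (V : lmodType rat) (T : finType) (X : {set T}).
Variables (b : T -> letter) (rk : T -> nat) (v : T -> V).
Hypothesis rk_inj : injective rk.

Definition onto_args n (t : 'I_n -> T) := injectiveb t && ([set t i | i in 'I_n] == X).

Definition args_weight n (u : 'I_n -> homog Qinf) (t : 'I_n -> T) : rat :=
  koszul (fun x => (b x).1) rk t * \prod_i letter_coef (b (t i)) (u i).

Lemma prod_coef_upd n (t : 'I_n -> T) (u : 'I_n -> homog Qinf) i z :
  \prod_j letter_coef (b (t j)) (upd u i z j) =
  letter_coef (b (t i)) z * \prod_(j | j != i) letter_coef (b (t j)) (u j).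
Proof.
rewrite (bigD1 i) //= /upd eqxx; congr (_ * _).
by apply: eq_bigr => j /negbTE ->.
Qed.

(* Every argument is expanded in the letters [b]; the terms in which each
   element of [X] occurs exactly once are kept, and its letter is replaced by the
   vector [v x], the sign being that of sorting the odd letters by rank. *)
Definition polarize (g : sgen F Qinf) : F V :=
  \sum_(t : {ffun 'I_(sg_ar g) -> T} | onto_args t)
    args_weight (sg_args g) t *: opval (sg_op g) (v \o t).

Lemma polarize_rel : super_rel polarize.
Proof.
split.
- move=> n a m m1 m2 Pm Pm1 Pm2 u e; rewrite /polarize /= scaler_sumr -big_split.
  apply: eq_bigr => t _ /=.
  by rewrite e opval_linear scalerDr !scalerA [a * _]mulrC.
- move=> n m Pm u i a x y; rewrite /polarize /= scaler_sumr -big_split.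
  apply: eq_bigr => t _ /=; rewrite scalerA -scalerDl; congr (_ *: _).
  rewrite /args_weight !prod_coef_upd /=; case: (b (t i)).1; first by ring.
  by rewrite coefD coefZ; ring.
- move=> n m Pm u i a x y; rewrite /polarize /= scaler_sumr -big_split.
  apply: eq_bigr => t _ /=; rewrite scalerA -scalerDl; congr (_ *: _).
  rewrite /args_weight !prod_coef_upd /=; case: (b (t i)).1; last by ring.
  by rewrite coefD coefZ; ring.
move=> n m i j Pm Pm' u ij; rewrite /polarize /= scaler_sumr.
pose r (t : {ffun 'I_n -> T}) := [ffun l => t (tperm i j l)].
have rK : involutive r by move=> t; apply/ffunP => l; rewrite !ffunE tpermK.
have rE t : r t = t \o tperm i j :> ('I_n -> T) by apply/funext => l; rewrite ffunE.
rewrite (reindex_inj (inv_inj rK)) /=; apply: eq_big => t.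
  rewrite /onto_args rE; congr (_ && (_ == X)).
    apply/injectiveP/injectiveP => tinj x y.
      by move=> e; apply: (@perm_inj _ (tperm i j)); apply: tinj; rewrite /= !tpermK.
    by move=> /tinj /perm_inj.
  apply/setP => x; apply/imsetP/imsetP => -[l _ ->].
    by exists (tperm i j l).
  by exists (tperm i j l) => //=; rewrite tpermK.
move=> /andP[/injectiveP rinj _].
have tinj : injective t.
  move=> x y e; apply: (@perm_inj _ (tperm i j)); apply: rinj.
  by rewrite !ffunE !tpermK.
rewrite opval_perm scalerA rE; congr (_ *: _); last first.
  by congr (opval m _); apply/funext => l /=; rewrite tpermK.
rewrite /args_weight koszul_adj // -mulrA [RHS]mulrCA [RHS]mulrCA.
have -> : \prod_l letter_coef (b ((t \o tperm i j) l)) (u l) =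
    \prod_l letter_coef (b (t l)) ((u \o tperm i j) l).
  by rewrite (reindex_inj (@perm_inj _ (tperm i j))); apply: eq_bigr => l _ /=; rewrite tpermK.
have [->|nz] := eqVneq (\prod_l letter_coef (b (t l)) ((u \o tperm i j) l)) 0.
  by rewrite !mulr0.
(* Where the product of coefficients is nonzero, each letter has the parity of the argument it comes
   from, so the sign of [koszul_adj] is the one of the symmetry. *)
have par l : (b (t l)).1 = parity (u (tperm i j l)).
  apply/esym/letter_coef_parity; apply: contraNneq nz => z.
  by rewrite (bigD1 l) //= z mul0r.
by rewrite !par tpermL tpermR andbC mulrCA.
Qed.

Definition polarization : {linear super_eval F Qinf -> F V} := ulift polarize_rel.

Lemma polarization_sgval g : polarization (sgval g) = polarize g.
Proof. exact: ulift_gen. Qed.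

Lemma polarization_sub (S : setfam F) x :
  subfunctor S -> super_sub S x -> S V (polarization x).
Proof.
move=> PS; have Slin := subfunctor_closed_lin V PS.
elim/lspan_ind => [|a _ y [g [Sg ->]] IH]; first by rewrite linear0; exact: Slin.1.
rewrite linearP; apply: Slin.2 => //; rewrite polarization_sgval.
apply: (closed_lin_sum Slin) => t _; apply: (closed_linZ Slin).
by case: PS => _ _; exact.
Qed.

End Polarization.

(** Polarizing at the letters [b], with the basis vectors of Q^n as new arguments, returns a nonzero
    multiple of [m]: as the letters are distinct, only the identity assignment contributes. *)
Lemma super_sub_distinct (F : functor) (S : setfam F) n (m : F 'rV[rat]_n)
    (Pm : multilinear_op m) (b : 'I_n -> letter) :
  subfunctor S -> injective b -> super_sub S (sgval (SGen Pm (fun i => lett (b i)))) -> S _ m.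
Proof.
move=> PS binj.
move=> /(polarization_sub [set: 'I_n] b (fun i => delta_mx 0 i : 'rV[rat]_n)
  (@val_inj _ _ _) PS).
have Slin := subfunctor_closed_lin 'rV[rat]_n PS.
rewrite polarization_sgval /polarize (bigD1 [ffun i => i]) /=; last first.
  apply/andP; split; first by apply/injectiveP => i j; rewrite !ffunE.
  by apply/eqP/setP => i; rewrite inE; apply/imsetP; exists i; rewrite ?ffunE.
rewrite big1 ?addr0 => [|t /andP[_ tid]].
  have -> : (fun i => delta_mx 0 i) \o [ffun i : 'I_n => i] = (fun i => delta_mx 0 i : 'rV[rat]_n).
    by apply/funext => i; rewrite /= ffunE.
  rewrite opval_delta; apply: (closed_linZI Slin).
  rewrite mulf_neq0 ?koszul_neq0 // prodf_seq_neq0; apply/allP => i _ /=.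
  by rewrite ffunE letter_coef_lett eqxx oner_eq0.
have [i ti] : exists i, t i != i.
  apply/existsP; apply: contraNT tid => /existsPn h; apply/eqP/ffunP => i.
  by rewrite ffunE; have := h i; rewrite negbK => /eqP.
rewrite /args_weight (bigD1 i) //= letter_coef_lett (inj_eq binj) (negbTE ti).
by rewrite mul0r mulr0 scale0r.
Qed.

(** * Powers of a generator *)

Section SuperIdeal.
Variables (A : tca) (U : svect) (I : setfam A).

Lemma super_sub_lin : closed_lin (@super_sub A I U).
Proof. exact: lspan_closed_lin. Qed.

Lemma sgval_mul (g h : sgen A U) : sgval g * sgval h = sgval (sgen_mul g h).
Proof. exact: super_mul_gen. Qed.

Lemma super_mulDZl a (x y z : super_eval A U) : (a *: x + y) * z = a *: (x * z) + y * z.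
Proof. exact: super_mul_linear_l. Qed.

Lemma super_mulDZr a (x y z : super_eval A U) : z * (a *: x + y) = a *: (z * x) + z * y.
Proof. exact: super_mul_linear_r. Qed.

Lemma super_sub_ideal : gl_ideal I -> ideal (@super_sub A I U).
Proof.
move=> [PI idI]; have lin := super_sub_lin.
have [_ _ If] := PI.
split; [exact: lin.1|by move=> x y; exact: closed_linD| |].
- move=> x y; elim/lspan_ind => [|a _ z [h [Ih ->]] IH]; first by rewrite mulr0; exact: lin.1.
  rewrite super_mulDZr; apply: lin.2 => //.
  elim/super_eval_ind: x {IH} => [b g x IH|]; last by rewrite mul0r; exact: lin.1.
  rewrite super_mulDZl; apply: lin.2 => //; rewrite sgval_mul; apply: lspan_mem.
  by exists (sgen_mul g h); split=> //; apply: idI; exact: If.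
move=> x y; elim/lspan_ind => [|a _ z [h [Ih ->]] IH]; first by rewrite mul0r; exact: lin.1.
rewrite super_mulDZl; apply: lin.2 => //.
elim/super_eval_ind: x {IH} => [b g x IH|]; last by rewrite mulr0; exact: lin.1.
rewrite super_mulDZr; apply: lin.2 => //; rewrite sgval_mul; apply: lspan_mem.
by exists (sgen_mul h g); split=> //=; rewrite /op_mul tmulC; apply: idI; exact: If.
Qed.

Fixpoint sgen_pow (g : sgen A U) n : sgen A U :=
  if n is k.+1 then sgen_mul g (sgen_pow g k) else sgen_one A U.

Lemma sgval_pow g n : sgval g ^+ n = sgval (sgen_pow g n).
Proof. by elim: n => // n IH; rewrite exprS IH sgval_mul. Qed.

Lemma sgen_pow_ar g n : sg_ar (sgen_pow g n) = (n * sg_ar g)%N.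
Proof. by elim: n => //= n ->. Qed.

Lemma sgen_pow_op g n (V : lmodType rat) (w : nat -> V) :
  opval (sg_op (sgen_pow g n)) (fun l => w l) =
  \big[@tmul A V/tone A V]_(i < n) opval (sg_op g) (fun k => w (i * sg_ar g + k)%N).
Proof.
elim: n w => [|n IH] w; first by rewrite big_ord0 /=; exact: opval_tone.
rewrite big_ord_recl /= opval_mul; congr tmul.
rewrite (IH (fun l => w (sg_ar g + l)%N)); apply: eq_bigr => i _; congr opval.
by apply/funext => k; rewrite /bump /= add1n mulSn addnA.
Qed.

Lemma sgen_pow_args g n (q : nat -> homog U) :
  (forall k, sg_args g k = q k) -> forall l, sg_args (sgen_pow g n) l = q (l %% sg_ar g)%N.
Proof.
move=> gq; elim: n => [[]//|n IH] /= l; case: (split_ordP l) => j ->.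
  by rewrite args_catl gq /= modn_small.
by rewrite args_catr IH /= modnDl.
Qed.

End SuperIdeal.

Section Slots.
Variables (A : tca) (I : setfam A) (hI : gl_ideal I) (d : nat) (m : A 'rV[rat]_d).
Hypothesis Pm : multilinear_op m.

Definition slot_gen (e : 'I_d -> bool) : sgen A Qinf :=
  SGen Pm (fun k => lett (e k, k : nat)).

Section Theta.
Variables (e : 'I_d -> bool) (V : lmodType rat) (M : nat) (X : {set 'I_M}).
Let T := ('I_M * 'I_d)%type.
Let g := sgen_pow (slot_gen e) #|X|.
Let n := sg_ar g.
Let ks := enum 'I_d.
Let XT := finset.setX X [set: 'I_d].
Let b (x : T) : letter := (e x.2, x.2 : nat).
Let rk (x : T) : nat := (x.2 * M + x.1)%N.
Let uncurry (v : 'I_M -> 'I_d -> V) (x : T) := v x.1 x.2.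
Let mon (t : 'I_n -> T) v := opval (sg_op g) (uncurry v \o t).
Let slotted (t : 'I_n -> T) := forall l, (t l).2 = (l %% d)%N :> nat.

Lemma slot_rk_inj : injective rk.
Proof.
move=> [x k] [y l] /= h.
have M0 : (0 < M)%N by apply: leq_ltn_trans (ltn_ord x).
have kl : k = l.
  apply: val_inj => /=; have := congr1 (divn^~ M) h; rewrite /rk /=.
  by rewrite !divnMDl // !divn_small // !addn0.
move: h; rewrite /rk kl /= => /eqP; rewrite eqn_add2l => /eqP h.
by congr pair; exact: val_inj.
Qed.

(** Slotted assignments differ by permutations inside the slots. A transposition inside slot [k]
    multiplies both the Koszul sign and the (anti)symmetrized monomial by (-1)^(e k), and it can be
    chosen to lower the number of disagreements with [t']. *)
Lemma slot_theta_swap t t' : onto_args XT t -> onto_args XT t' -> slotted t -> slotted t' ->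
  forall v, koszul (fun x => (b x).1) rk t *: slot_ops X ks e (mon t) v =
            koszul (fun x => (b x).1) rk t' *: slot_ops X ks e (mon t') v.
Proof.
move=> ot ot' st st' v.
have [k] := ubnP #|[set l | t l != t' l]|; elim: k t ot st => // k IH t ot st hk.
have [/eqP|/set0Pn[l]] := eqVneq [set l | t l != t' l] set0.
  move=> /eqP/setP h; have -> // : t = t'.
  by apply/funext => l; have := h l; rewrite !inE => /negbT; rewrite negbK => /eqP.
rewrite inE => tl.
move: (ot) => /andP[/injectiveP tinj /eqP timg].
move: (ot') => /andP[/injectiveP t'inj /eqP t'img].
have : t' l \in XT by rewrite -t'img; apply/imsetP; exists l.
have tlX : t l \in XT by rewrite -timg; apply/imsetP; exists l.
rewrite -{1}timg => /imsetP[l' _ el'].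
have ll' : l != l' by apply: contraNneq tl => e0; rewrite el' e0.
have slot2 : (t l).2 = (t l').2 by apply: val_inj; rewrite /= -el' st st'.
have x2X : (t l').1 \in X.
  have : t l' \in XT by rewrite -timg; apply/imsetP; exists l'.
  by rewrite !inE andbT.
have x1X : (t l).1 \in X by move: tlX; rewrite !inE andbT.
pose t1 := t \o tperm l l'.
have x12 : (t l).1 != (t l').1.
  apply: contraNneq ll' => h; apply/eqP/tinj.
  by rewrite [t l]surjective_pairing h slot2 -surjective_pairing.
have ot1 : onto_args XT t1.
  apply/andP; split.
    by apply/injectiveP => x y /tinj /perm_inj.
  rewrite -timg; apply/eqP/setP => x; apply/imsetP/imsetP => -[y _ ->].
    by exists (tperm l l' y).
  by exists (tperm l l' y) => //=; rewrite /t1 /= tpermK.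
have st1 : slotted t1.
  move=> i; rewrite /t1 /=; case: tpermP => [->|->|_ _]; last exact: st.
    by rewrite -slot2 st.
  by rewrite slot2 st.
have E : mon t1 = fun v => mon t (slot_act (t l).2 (tperm (t l).1 (t l').1) v).
  apply/funext => w; rewrite /mon; congr (opval _ _); apply/funext => i.
  rewrite /= /uncurry /slot_act /t1 /=.
  case: tpermP => [->|->|/eqP il /eqP il']; first by rewrite eqxx tpermL slot2.
    by rewrite slot2 eqxx tpermR.
  case: eqP => // ik; rewrite tpermD //.
    by apply: contraNneq il => h; apply/eqP/tinj; rewrite [t i]surjective_pairing -h ik -surjective_pairing.
  apply: contraNneq il' => h; apply/eqP/tinj.
  by rewrite [t i]surjective_pairing -h ik slot2 -surjective_pairing.
rewrite -(IH t1 ot1 st1); last first.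
  rewrite -ltnS; apply: leq_trans hk; rewrite ltnS; apply: proper_card; apply/properP; split.
    apply/subsetP => i; rewrite !inE /t1 /=; case: tpermP => [->|->|//].
      by rewrite -el' eqxx.
    by move=> _; rewrite -el' (inj_eq t'inj).
  by exists l; rewrite !inE // /t1 /= tpermL -el' eqxx.
have := koszul_tperm (odd_elt := fun x => (b x).1) slot_rk_inj tinj ll'.
rewrite -/t1 => ->; last by rewrite /= slot2.
rewrite E slot_ops_act ?enum_uniq ?mem_enum //; last first.
  by apply: (subset_trans (tperm_on _ _)); rewrite subUset !sub1set x1X.
rewrite odd_tperm x12 andbT scalerA /b /= mulrAC -expr2 sqrr_sign mul1r.
by [].
Qed.

(** The polarized power is symmetrized once more in every slot. All its terms become multiples of
    one element with coefficient 0 or 1, so nothing cancels, and [t0] shows that some coefficient is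
    1. *)
Lemma slot_ops_pow v : super_sub I (sgval (slot_gen e) ^+ #|X|) ->
  I (slot_ops X ks e (@slot_mon A d m V 'I_M X) v).
Proof.
rewrite sgval_pow -/g => gI.
have Zlin := subfunctor_closed_lin V hI.1.
have nE : n = (#|X| * d)%N by exact: sgen_pow_ar.
have lt_mul_gt0 p a c : (p < a * c)%N -> (0 < c)%N by case: c => //; rewrite muln0.
have d0 (l : 'I_n) : (0 < d)%N by apply: (@lt_mul_gt0 l #|X|); rewrite -nE.
have hdiv (l : 'I_n) : (l %/ d < #|X|)%N by rewrite ltn_divLR ?d0 // -nE.
have hmod (l : 'I_n) : (l %% d < d)%N by rewrite ltn_pmod ?d0.
(* Position [l] of the power is slot [l mod d] of factor number [l / d], the factors being numbered
   by the elements of [X]. *)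
pose t0 (l : 'I_n) : T := (enum_val (Ordinal (hdiv l)), Ordinal (hmod l)).
have st0 : slotted t0 by [].
have ot0 : onto_args XT t0.
  apply/andP; split.
    apply/injectiveP => l l' [/enum_val_inj [e1] e2]; apply: val_inj.
    by rewrite /= (divn_eq l d) (divn_eq l' d) e1 e2.
  apply/eqP/setP => -[x k]; rewrite !inE andbT; apply/imsetP/idP => [[l _ [-> _]]|xX].
    exact: enum_valP.
  have lP : (enum_rank_in xX x * d + k < n)%N.
    rewrite nE; apply: leq_trans (leq_mul (ltn_ord (enum_rank_in xX x)) (leqnn d)).
    by rewrite mulSn addnC ltn_add2r.
  exists (Ordinal lP) => //.
  have dP : (0 < d)%N by apply: leq_ltn_trans (ltn_ord k).
  congr pair.
    rewrite -[LHS](enum_rankK_in xX xX); congr enum_val; apply: val_inj => /=.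
    by rewrite divnMDl // divn_small // addn0.
  by apply: val_inj => /=; rewrite modnMDl modn_small.
have mon0 : mon t0 = @slot_mon A d m V 'I_M X.
  apply/funext => w.
  pose q (p : nat) : V := if insub (p %/ d)%N is Some i then
    if insub (p %% d)%N is Some k then w (enum_val (i : 'I_#|X|)) (k : 'I_d) else 0 else 0.
  have -> : mon t0 w = opval (sg_op g) (fun l => q l).
    congr opval; apply/funext => l; rewrite /= /q /uncurry /=.
    by rewrite (insubT (fun p => p < #|X|)%N (hdiv l)) (insubT (fun p => p < d)%N (hmod l)).
  rewrite sgen_pow_op /slot_mon [RHS]big_enum_val; apply: eq_bigr => i _; congr opval.
  apply/funext => k; rewrite /q.
  have dP : (0 < d)%N by apply: leq_ltn_trans (ltn_ord k).
  rewrite divnMDl // divn_small // addn0 modnMDl modn_small //.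
  by rewrite !valK.
pose q (p : nat) : homog Qinf := lett (oapp e false (insub p), p).
have argsE l : sg_args g l = q (l %% d)%N.
  by apply: sgen_pow_args => k; rewrite /q valK.
pose cf (t : {ffun 'I_n -> T}) := \prod_l letter_coef (b (t l)) (sg_args g l).
have cf01 t : cf t = [forall l, b (t l) == (oapp e false (insub (l %% d)%N), (l %% d)%N)]%:R.
  rewrite /cf; case: (boolP [forall l, _]) => [/forallP h|].
    by apply: big1 => l _; rewrite argsE letter_coef_lett h.
  rewrite negb_forall => /existsP[l h].
  by rewrite (bigD1 l) //= argsE letter_coef_lett (negbTE h) mul0r.
pose Psi w : A V := polarize XT b rk (uncurry w) g.
have PsiI w : I (Psi w).
  have := polarization_sub XT b (uncurry w) slot_rk_inj hI.1 gI.
  by rewrite polarization_sgval.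
have := slot_ops_mem X ks e Zlin PsiI v.
have PsiE : Psi = fun w => \sum_(t <- enum [pred t : {ffun 'I_n -> T} | onto_args XT t])
    args_weight b rk (sg_args g) t *: mon t w.
  by apply/funext => w; rewrite big_enum.
rewrite PsiE slot_ops_sum big_enum /=.
rewrite (eq_bigr (fun t : {ffun 'I_n -> T} => cf t *:
    (koszul (fun x => (b x).1) rk t0 *: slot_ops X ks e (mon t0) v))); last first.
  move=> t ot; rewrite slot_opsZ /args_weight -/(cf t) mulrC -scalerA cf01.
  case: (boolP [forall l, _]) => [/forallP h|]; last by rewrite !scale0r.
  rewrite (slot_theta_swap ot ot0) //; move=> l.
  by have := h l; rewrite /b xpair_eqE => /andP[_ /eqP].
rewrite -scaler_suml scalerA mon0; apply: (closed_linZI Zlin).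
rewrite mulf_neq0 ?koszul_neq0 //; apply: lt0r_neq0.
pose f0 : {ffun 'I_n -> T} := finfun t0.
have f0E : f0 = t0 :> ('I_n -> T) by apply/funext => l; rewrite ffunE.
have of0 : onto_args XT f0 by rewrite f0E.
rewrite (bigD1 f0 of0) /=.
rewrite ltr_wpDr ?sumr_ge0 // => [t _|]; first by rewrite cf01 ler0n.
rewrite cf01; case: forallP => [_|[]] // l; rewrite f0E /b /=.
by rewrite (insubT (fun p => p < d)%N (hmod l)) /=.
Qed.

End Theta.

Lemma slots_vanish_enum :
  (forall e, radical (@super_sub A I Qinf) (sgval (slot_gen e))) ->
  slots_vanish I m (enum 'I_d).
Proof.
move=> h.
have /choice[N hN] : forall e : {ffun 'I_d -> bool},
    exists k, super_sub I (sgval (slot_gen e) ^+ k) by move=> e; exact: h.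
(* A single exponent has to serve all 2^d parities; the sum bounds each [N e]. *)
exists (\sum_e N e)%N => e V M X v cX; apply: slot_ops_pow.
have [_ _ idl _] := @super_sub_ideal A Qinf I hI.
pose e' : {ffun 'I_d -> bool} := finfun e.
have e'E : e' = e :> ('I_d -> bool) by apply/funext => k; rewrite ffunE.
by rewrite cX (bigD1 e') //= addnC exprD; apply: idl; have := hN e'; rewrite e'E.
Qed.

End Slots.

(** * The radical of a supercommutative algebra *)

Lemma sgval_bij (F : functor) (U : svect) n n' (e : n' = n) (s : 'I_n' -> 'I_n)
    (m : F 'rV[rat]_n) (m' : F 'rV[rat]_n') (Pm : multilinear_op m)
    (Pm' : multilinear_op m') (u : 'I_n -> homog U) :
  injective s -> m = opval m' (fun i => delta_mx 0 (s i)) ->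
  sgval (SGen Pm u) =
  koszul (fun i => parity (u i)) (@nat_of_ord n) s *: sgval (SGen Pm' (u \o s)).
Proof.
case: _ / e s m Pm u => s m Pm u sinj em.
have sE : s = perm sinj :> (_ -> _) by apply/funext => i; rewrite permE.
have {}em : m = perm_op m' (perm sinj).
  by rewrite em; congr opval; apply/funext => i; rewrite permE.
move: Pm; rewrite em => Pm; rewrite (sgval_perm Pm'); congr (_ *: sgval _); first by rewrite -sE.
by apply: sgen_eq => //; rewrite -sE.
Qed.

Definition sgen_odd (F : functor) (U : svect) (g : sgen F U) : bool :=
  odd (\sum_i parity (sg_args g i)).

Section SuperCommutative.
Variables (A : tca) (U : svect).
Implicit Types (g h : sgen A U) (x y : super_eval A U).

Lemma sgen_odd_mul g h : sgen_odd (sgen_mul g h) = sgen_odd g (+) sgen_odd h.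
Proof.
rewrite /sgen_odd /= big_split_ord /= -oddD; congr (odd (_ + _)).
  by apply: eq_bigr => i _; rewrite args_catl.
by apply: eq_bigr => i _; rewrite args_catr.
Qed.

(** Exchanging the two blocks inverts exactly the pairs formed of an argument of [g] and one of [h],
    so the exponent of the sign is the product of the numbers of odd arguments. *)
Lemma sgval_mulC g h :
  sgval g * sgval h = (-1) ^+ (sgen_odd g && sgen_odd h) *: (sgval h * sgval g).
Proof.
rewrite !sgval_mul; case: g h => [n m Pm u] [k m' Pm' u'].
pose s (i : 'I_(k + n)) : 'I_(n + k) :=
  match split i with inl a => rshift n a | inr b => lshift k b end.
have sl a : s (lshift n a) = rshift n a by rewrite /s (unsplitK (inl a)).
have sr b : s (rshift k b) = lshift k b by rewrite /s (unsplitK (inr b)).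
have sinj : injective s.
  move=> i j; case: (split_ordP i) => a ->; case: (split_ordP j) => b ->; rewrite ?sl ?sr.
  - by move=> /rshift_inj ->.
  - by move/eqP; rewrite eq_rlshift.
  - by move/eqP; rewrite eq_lrshift.
  - by move=> /lshift_inj ->.
rewrite /sgen_mul /= (sgval_bij (addnC k n) _ (op_mulP Pm' Pm) _ sinj); last first.
  rewrite opval_mul op_mulE tmulC; congr tmul; congr opval; apply/funext => i.
    by rewrite sl.
  by rewrite sr.
congr (_ *: sgval _); last first.
  apply: sgen_eq => //; apply/funext => i /=.
  by case: (split_ordP i) => a ->; rewrite ?sl ?sr ?args_catl ?args_catr.
rewrite /koszul.
transitivity (\prod_(i < k + n) \prod_(j < k + n)
  (if (i < j)%N then inv_sign (fun i0 => parity (args_cat u u' i0)) (@nat_of_ord _) (s i) (s j) else 1)).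
  by rewrite [RHS]pair_big /= [LHS]big_mkcond /=; apply: eq_bigr => -[i j] _.
rewrite big_split_ord /= [X in _ * X]big1 ?mulr1; last first.
  move=> j _; rewrite big_split_ord /= !big1 ?mulr1 // => a _.
    case: ifP => // /= lt; rewrite /inv_sign !sr /= [(a < j)%N]ltnNge ltnW ?andbF //; lia.
  by case: ifP => //= lt; have := ltn_ord a; lia.
transitivity (\prod_(a < k) \prod_(b < n) (-1) ^+ (parity (u' a) * parity (u b)) : rat).
  apply: eq_bigr => a _; rewrite big_split_ord /= big1 ?mul1r => [|b _].
    apply: eq_bigr => b _; rewrite ltn_addr ?ltn_ord // /inv_sign sl sr args_catl args_catr /=.
    rewrite [(b < n + a)%N](leq_trans (ltn_ord b) (leq_addr _ _)) andbT.
    by case: (parity _); case: (parity _).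
  case: ifP => // /= lt; rewrite /inv_sign !sl /= ltn_add2l [(b < a)%N]ltnNge ltnW ?andbF //.
under eq_bigr => a _ do rewrite -expr_sum -big_distrr /=.
rewrite -expr_sum -big_distrl /= -signr_odd oddM /sgen_odd /= andbC.
by [].
Qed.

Definition even_rel (g : sgen A U) : super_eval A U := if sgen_odd g then 0 else sgval g.

Lemma even_relP : super_rel even_rel.
Proof.
have par n (m : A 'rV[rat]_n) (Pm : multilinear_op m) (u : 'I_n -> homog U) i z z' :
    parity z = parity z' -> sgen_odd (SGen Pm (upd u i z)) = sgen_odd (SGen Pm (upd u i z')).
  move=> e; rewrite /sgen_odd; congr odd; apply: eq_bigr => j _ /=.
  by rewrite /upd; case: eqP => // _; rewrite e.
split.
- move=> n a m m1 m2 Pm Pm1 Pm2 u e; rewrite /even_rel.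
  have -> : sgen_odd (SGen Pm u) = sgen_odd (SGen Pm1 u) by [].
  have -> : sgen_odd (SGen Pm2 u) = sgen_odd (SGen Pm1 u) by [].
  by case: ifP => _; [rewrite scaler0 addr0|exact: (sr_op (sgvalP _ _))].
- move=> n m Pm u i a x y; rewrite /even_rel.
  rewrite (par _ _ _ _ _ (inl (a *: x + y)) (inl x)) // (par _ _ _ _ _ (inl y) (inl x)) //.
  by case: ifP => _; [rewrite scaler0 addr0|exact: (sr_even (sgvalP _ _))].
- move=> n m Pm u i a x y; rewrite /even_rel.
  rewrite (par _ _ _ _ _ (inr (a *: x + y)) (inr x)) // (par _ _ _ _ _ (inr y) (inr x)) //.
  by case: ifP => _; [rewrite scaler0 addr0|exact: (sr_odd (sgvalP _ _))].
move=> n m i j Pm Pm' u ij; rewrite /even_rel.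
have -> : sgen_odd (SGen Pm (u \o tperm i j)) = sgen_odd (SGen Pm' u).
  by rewrite /sgen_odd /=; congr odd; rewrite [RHS](reindex_inj (@perm_inj _ (tperm i j))).
by case: ifP => _; [rewrite scaler0|exact: (sr_sym (sgvalP _ _))].
Qed.

Definition even_part : {linear super_eval A U -> super_eval A U} := ulift even_relP.
Definition odd_part x := x - even_part x.

Lemma even_part_sgval g : even_part (sgval g) = if sgen_odd g then 0 else sgval g.
Proof. exact: ulift_gen. Qed.

Lemma odd_part_linear : linear odd_part.
Proof. by move=> a x y; rewrite /odd_part linearP scalerBr opprD addrACA. Qed.

Lemma odd_part_sgval g : odd_part (sgval g) = if sgen_odd g then sgval g else 0.
Proof. by rewrite /odd_part even_part_sgval; case: ifP => _; rewrite ?subr0 ?subrr. Qed.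

Lemma even_odd_part x : x = even_part x + odd_part x.
Proof. by rewrite addrC subrK. Qed.

Lemma super_bilinear_ext (P Q : super_eval A U -> super_eval A U -> super_eval A U) :
  (forall y, linear (P^~ y)) -> (forall x, linear (P x)) ->
  (forall y, linear (Q^~ y)) -> (forall x, linear (Q x)) ->
  (forall g h, P (sgval g) (sgval h) = Q (sgval g) (sgval h)) -> forall x y, P x y = Q x y.
Proof.
move=> Pl Pr Ql Qr PQ.
have z0 (f : super_eval A U -> super_eval A U) : linear f -> f 0 = 0.
  by move=> fl; have := fl (-1) 0 0; rewrite scaler0 addr0 scaleN1r addNr.
move=> x y; elim/super_eval_ind: x => [a g x IH|]; last first.
  by rewrite (z0 _ (Pl y)) (z0 _ (Ql y)).
rewrite Pl Ql IH; congr (_ *: _ + _).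
elim/super_eval_ind: y {IH} => [a' h y IH|]; last by rewrite (z0 _ (Pr _)) (z0 _ (Qr _)).
by rewrite Pr Qr PQ IH.
Qed.

Lemma even_part_mul x y :
  even_part (x * y) = even_part x * even_part y + odd_part x * odd_part y.
Proof.
pose P x y := even_part (x * y).
pose Q x y := even_part x * even_part y + odd_part x * odd_part y.
apply: (@super_bilinear_ext P Q); rewrite /P /Q.
- by move=> z a u v; rewrite super_mulDZl linearP.
- by move=> z a u v; rewrite super_mulDZr linearP.
- by move=> z a u v; rewrite linearP odd_part_linear !super_mulDZl scalerDr addrACA.
- by move=> z a u v; rewrite linearP odd_part_linear !super_mulDZr scalerDr addrACA.
move=> g h; rewrite sgval_mul !even_part_sgval !odd_part_sgval sgen_odd_mul.
by case: (sgen_odd g); case: (sgen_odd h); rewrite /= ?mul0r ?mulr0 ?addr0 ?add0r ?sgval_mul.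
Qed.

Lemma even_partK x : even_part (even_part x) = even_part x.
Proof.
elim/super_eval_ind: x => [a g x IH|]; last by rewrite !linear0.
by rewrite !linearP IH even_part_sgval; case: ifP => o; rewrite ?linear0 ?even_part_sgval ?o.
Qed.

Lemma even_part_odd x : even_part (odd_part x) = 0.
Proof. by rewrite linearB even_partK subrr. Qed.

Lemma odd_part_even x : odd_part (even_part x) = 0.
Proof. by rewrite /odd_part even_partK subrr. Qed.

Lemma even_part_central x y : GRing.comm (even_part x) y.
Proof.
pose P x y := even_part x * y; pose Q x y := y * even_part x.
apply: (@super_bilinear_ext P Q); rewrite /P /Q.
- by move=> z a u v; rewrite linearP super_mulDZl.
- by move=> z a u v; rewrite super_mulDZr.
- by move=> z a u v; rewrite linearP super_mulDZr.
- by move=> z a u v; rewrite super_mulDZl.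
move=> g h; rewrite even_part_sgval; case: ifP => o; first by rewrite mul0r mulr0.
by rewrite sgval_mulC o scale1r.
Qed.

Lemma odd_part_anticomm x y : odd_part x * odd_part y = - (odd_part y * odd_part x).
Proof.
pose P x y := odd_part x * odd_part y; pose Q x y := - (odd_part y * odd_part x).
apply: (@super_bilinear_ext P Q); rewrite /P /Q.
- by move=> z a u v; rewrite odd_part_linear super_mulDZl.
- by move=> z a u v; rewrite odd_part_linear super_mulDZr.
- by move=> z a u v; rewrite odd_part_linear super_mulDZr opprD scalerN.
- by move=> z a u v; rewrite odd_part_linear super_mulDZl opprD scalerN.
move=> g h; rewrite !odd_part_sgval; case: ifP => o; last by rewrite mul0r mulr0 oppr0.
case: ifP => o'; last by rewrite mul0r mulr0 oppr0.
by rewrite sgval_mulC o o' /= expr1 scaleN1r.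
Qed.

Lemma odd_part_sqr x : odd_part x * odd_part x = 0.
Proof.
have /eqP := odd_part_anticomm x x; rewrite -addr_eq0 -mulr2n -scaler_nat.
by rewrite scaler_eq0 pnatr_eq0 => /eqP.
Qed.

End SuperCommutative.

Section SquareZero.
Variables (R : pzRingType) (K : R -> Prop).
Hypothesis idK : ideal K.

Lemma exprD_square_zero (a b : R) n : GRing.comm a b -> b * b = 0 ->
  (a + b) ^+ n.+1 = a ^+ n.+1 + (a ^+ n * b) *+ n.+1.
Proof.
move=> ab bb; elim: n => [|n IH]; first by rewrite !expr1 expr0 mul1r mulr1n.
rewrite exprSr IH mulrDl !mulrDr -exprSr !mulrnAl -!mulrA bb mulr0 mul0rn addr0 -ab.
by rewrite [a ^+ n * (a * b)]mulrA -exprSr -addrA -mulrS.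
Qed.

Lemma ideal_pow_square_zero (a b : R) n : GRing.comm a b -> b * b = 0 ->
  K (a ^+ n) -> K ((a + b) ^+ n.+1).
Proof.
move=> ab bb Ka; have [K0 KD Kl Kr] := idK.
rewrite exprD_square_zero //; apply: KD; first by rewrite exprS; exact: Kl.
by rewrite -mulr_natl; apply/Kl/Kr.
Qed.

Lemma ideal_pow_leq (a : R) n k : (n <= k)%N -> K (a ^+ n) -> K (a ^+ k).
Proof. by move=> nk Ka; rewrite -(subnK nk) exprD; case: idK => _ _ + _; apply. Qed.

Lemma ideal_sum (J : Type) (r : seq J) (F : J -> R) :
  (forall j, K (F j)) -> K (\sum_(j <- r) F j).
Proof. by case: idK => K0 KD _ _ h; elim/big_ind: _. Qed.

Lemma radicalD_comm (a b : R) : GRing.comm a b -> radical K a -> radical K b -> radical K (a + b).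
Proof.
move=> ab [n Ka] [k Kb]; exists (n + k)%N; have [K0 KD Kl Kr] := idK.
rewrite exprDn_comm //; apply: ideal_sum => i.
rewrite -mulr_natl; apply: (Kl _).
have [ni|ni] := leqP k i; first by apply: Kl; exact: ideal_pow_leq Kb.
by apply: Kr; apply: ideal_pow_leq Ka; lia.
Qed.

End SquareZero.

Section SuperRadical.
Variables (A : tca) (I : setfam A) (hI : gl_ideal I) (U : svect).
Let K := @super_sub A I U.
Let R := radical K.
Implicit Types x y : super_eval A U.

Lemma even_part_sub x : K x -> K (even_part _ _ x).
Proof.
have lin := super_sub_lin U I.
elim/lspan_ind => [|a _ y [g [Ig ->]] IH]; first by rewrite linear0; exact: lin.1.
rewrite linearP; apply: lin.2 => //; rewrite even_part_sgval; case: ifP => _; first exact: lin.1.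
by apply: lspan_mem; exists g.
Qed.

Lemma even_part_pow x n : even_part _ _ (even_part _ _ x ^+ n) = even_part _ _ x ^+ n.
Proof.
elim: n => [|n IH].
  have : sgen_odd (sgen_one A U) = false by rewrite /sgen_odd big_ord0.
  rewrite expr0 -[1]/(sgval (sgen_one A U)) => o.
  by rewrite even_part_sgval o.
by rewrite exprS even_part_mul IH odd_part_even mul0r addr0 even_partK.
Qed.

(** Write x = x0 + x1 with x0 even and x1 odd. Since x1^2 = 0, x^(n+1) = x0^(n+1) + (n+1) x0^n x1:
    its even part is x0^(n+1), and conversely each term is a multiple of x0^n. *)
Lemma radical_even_part x : R x <-> R (even_part _ _ x).
Proof.
have idK := super_sub_ideal U hI.
split=> -[n Kn].
  case: n Kn => [|n] Kn; first by exists 0%N.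
  exists n.+1; have := even_part_sub Kn.
  rewrite {1}(even_odd_part x) exprD_square_zero; last 2 first.
  - exact: even_part_central.
  - exact: odd_part_sqr.
  have o : odd_part (even_part _ _ x ^+ n) = 0 by rewrite -even_part_pow odd_part_even.
  by rewrite linearD linearMn /= even_part_pow even_part_mul even_part_odd mulr0 add0r o mul0r mul0rn addr0.
exists n.+1; rewrite (even_odd_part x); apply: ideal_pow_square_zero => //.
  exact: even_part_central.
exact: odd_part_sqr.
Qed.

(** The even part of the product is x0 y0 + x1 y1, where x1 y1 has square zero and commutes with x0
    y0. This reduces questions on the radical to central elements. *)
Lemma even_part_mul_radical x y :
  R (x * y) <-> R (even_part _ _ x * even_part _ _ y).
Proof.
have idK := super_sub_ideal U hI.
set w := odd_part x * odd_part y.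
have ww : w * w = 0.
  rewrite /w -mulrA [odd_part y * _]mulrA [odd_part y * odd_part x]odd_part_anticomm.
  by rewrite mulNr -mulrA odd_part_sqr mulr0 oppr0 mulr0.
have cen : GRing.comm (even_part _ _ x * even_part _ _ y) w.
  rewrite /GRing.comm -mulrA even_part_central mulrA -[LHS]mulrA even_part_central.
  by rewrite -!mulrA; congr (_ * _); rewrite even_part_central.
split; last first.
  move=> [n Kn]; apply/radical_even_part; rewrite even_part_mul; exists n.+1.
  exact: ideal_pow_square_zero.
move/radical_even_part => [n Kn]; exists n.+1.
rewrite -[_ * _](addrK w); apply: ideal_pow_square_zero => //.
- by rewrite -even_part_mul; exact: even_part_central.
- by rewrite mulrNN.
by rewrite -even_part_mul.
Qed.

Lemma radical_ideal : ideal R.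
Proof.
have idK := super_sub_ideal U hI; have [K0 KD Kl Kr] := idK.
split.
- by exists 1%N; rewrite expr1.
- move=> x y /radical_even_part Rx /radical_even_part Ry.
  apply/radical_even_part; rewrite linearD; apply: radicalD_comm => //.
  exact: even_part_central.
- move=> x y /radical_even_part[n Kn]; apply/even_part_mul_radical; exists n.
  by rewrite exprMn_comm; [apply: Kl|exact: even_part_central].
move=> x y /radical_even_part[n Kn]; apply/even_part_mul_radical; exists n.
by rewrite exprMn_comm; [apply: Kr|exact: even_part_central].
Qed.

End SuperRadical.

(** * Derivations and words *)

Lemma updC (I : eqType) (T : Type) (v : I -> T) i j x y : i != j ->
  upd (upd v i x) j y = upd (upd v j y) i x.
Proof.
move=> ij; apply/funext => k; rewrite /upd; case: eqP => // ->.
by rewrite eq_sym (negbTE ij).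
Qed.

Lemma upd_upd (I : eqType) (T : Type) (v : I -> T) i x y : upd (upd v i x) i y = upd v i y.
Proof. by apply/funext => k; rewrite /upd; case: eqP. Qed.

Lemma upd_eq (I : eqType) (T : Type) (v : I -> T) i x : upd v i x i = x.
Proof. by rewrite /upd eqxx. Qed.

Lemma upd_neq (I : eqType) (T : Type) (v : I -> T) i j x : j != i -> upd v i x j = v j.
Proof. by rewrite /upd => /negbTE ->. Qed.

Section Derivations.
Variables (A : tca) (U : svect).
Variables (f0 : {linear sv_even U -> sv_even U}) (f1 : {linear sv_odd U -> sv_odd U}).
Implicit Types (g h : sgen A U) (x y : super_eval A U).

Definition homog_map (u : homog U) : homog U :=
  match u with inl x => inl (f0 x) | inr x => inr (f1 x) end.

Lemma parity_homog_map u : parity (homog_map u) = parity u.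
Proof. by case: u. Qed.

(** The action on A(U) of (f0, f1), seen as an even element of the Lie superalgebra gl(U). *)
Definition sgen_deriv g : super_eval A U :=
  \sum_i sgval (SGen (sg_opP g) (upd (sg_args g) i (homog_map (sg_args g i)))).

Lemma sgen_deriv_rel : super_rel sgen_deriv.
Proof.
split.
- move=> n a m m1 m2 Pm Pm1 Pm2 u e; rewrite /sgen_deriv scaler_sumr -big_split.
  by apply: eq_bigr => i _; apply: (sr_op (sgvalP _ _)).
- move=> n m Pm u i a x y; rewrite /sgen_deriv scaler_sumr -big_split.
  apply: eq_bigr => j _ /=; have [->|ji] := eqVneq j i.
    by rewrite !upd_upd !upd_eq /= linearP; apply: (sr_even (sgvalP _ _)).
  by rewrite !upd_neq // !(updC _ _ _ (_ : i != j)) 1?eq_sym //; apply: (sr_even (sgvalP _ _)).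
- move=> n m Pm u i a x y; rewrite /sgen_deriv scaler_sumr -big_split.
  apply: eq_bigr => j _ /=; have [->|ji] := eqVneq j i.
    by rewrite !upd_upd !upd_eq /= linearP; apply: (sr_odd (sgvalP _ _)).
  by rewrite !upd_neq // !(updC _ _ _ (_ : i != j)) 1?eq_sym //; apply: (sr_odd (sgvalP _ _)).
move=> n m i j Pm Pm' u ij; rewrite /sgen_deriv scaler_sumr.
rewrite [RHS](reindex_inj (@perm_inj _ (tperm i j))) /=; apply: eq_bigr => l _ /=.
have par k : parity (upd u l (homog_map (u l)) k) = parity (u k).
  by rewrite /upd; case: eqP => // ->; exact: parity_homog_map.
rewrite (sr_sym (sgvalP _ _) Pm) //= !par tpermK; congr (_ *: sgval _).
apply: sgen_eq => //; apply/funext => k; rewrite /= /upd.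
by rewrite (can2_eq (tpermK i j) (tpermK i j)).
Qed.

Definition deriv : {linear super_eval A U -> super_eval A U} := ulift sgen_deriv_rel.

Lemma deriv_sgval g : deriv (sgval g) = sgen_deriv g.
Proof. exact: ulift_gen. Qed.

Lemma deriv_mul x y : deriv (x * y) = deriv x * y + x * deriv y.
Proof.
pose P x y := deriv (x * y); pose Q x y := deriv x * y + x * deriv y.
apply: (@super_bilinear_ext _ _ P Q); rewrite /P /Q.
- by move=> z a u v; rewrite super_mulDZl linearP.
- by move=> z a u v; rewrite super_mulDZr linearP.
- by move=> z a u v; rewrite linearP !super_mulDZl scalerDr addrACA.
- by move=> z a u v; rewrite linearP !super_mulDZr scalerDr addrACA.
move=> g h; rewrite sgval_mul !deriv_sgval /sgen_deriv /= big_split_ord /=.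
rewrite mulr_suml mulr_sumr; congr (_ + _); apply: eq_bigr => i _; rewrite sgval_mul.
  by congr sgval; apply: sgen_eq => //=; rewrite args_catl args_cat_updl.
by congr sgval; apply: sgen_eq => //=; rewrite args_catr args_cat_updr.
Qed.

Lemma deriv_sub (I : setfam A) x : super_sub I x -> super_sub I (deriv x).
Proof.
have lin := super_sub_lin U I.
elim/lspan_ind => [|a _ y [g [Ig ->]] IH]; first by rewrite linear0; exact: lin.1.
rewrite linearP; apply: lin.2 => //; rewrite deriv_sgval.
apply: (closed_lin_sum lin) => i _; apply: lspan_mem.
by exists (SGen (sg_opP g) (upd (sg_args g) i (homog_map (sg_args g i)))).
Qed.

End Derivations.

Section Words.
Variable A : tca.
Local Notation S := (super_eval A Qinf).

Definition word n (m : A 'rV[rat]_n) (Pm : multilinear_op m) (c : 'I_n -> letter) : S :=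
  sgval (SGen Pm (fun i => lett (c i))).

Lemma word_upd n (m : A 'rV[rat]_n) (Pm : multilinear_op m) (c : 'I_n -> letter) i x :
  word Pm (upd c i x) = sgval (SGen Pm (upd (fun i => lett (c i)) i (lett x))).
Proof. by congr sgval; apply: sgen_eq => //; rewrite comp_upd. Qed.

Definition bounded_words e : S -> Prop :=
  lspan (fun z => exists n (m : A 'rV[rat]_n) (Pm : multilinear_op m) c,
    (forall i, (c i).2 < e)%N /\ z = word Pm c).

Lemma bounded_words_le e e' x : (e <= e')%N -> bounded_words e x -> bounded_words e' x.
Proof.
move=> ee; apply: lspan_sub => z [n [m [Pm [c [hc ->]]]]]; apply: lspan_mem.
by exists n, m, Pm, c; split=> // i; apply: leq_trans ee.
Qed.

Lemma sgval_args0 n (m : A 'rV[rat]_n) (Pm : multilinear_op m) (u : 'I_n -> homog Qinf) i p :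
  sgval (SGen Pm (upd u i (if p : bool then inr 0 else inl 0))) = 0.
Proof.
case: p.
  have := sr_odd (sgvalP A Qinf) Pm u i (-1) 0 0.
  by rewrite scaler0 addr0 scaleN1r addNr.
have := sr_even (sgvalP A Qinf) Pm u i (-1) 0 0.
by rewrite scaler0 addr0 scaleN1r addNr.
Qed.

Lemma bounded_wordsP x : exists e, bounded_words e x.
Proof.
elim/super_eval_ind: x => [a [n m Pm u] x [e1 IH]|]; last by exists 0%N; exact: lspan0.
suff [e2 h] : exists e, bounded_words e (sgval (SGen Pm u)).
  exists (maxn e1 e2); apply: lspan_lin.
    by apply: bounded_words_le h; rewrite leq_maxr.
  by apply: bounded_words_le IH; rewrite leq_maxl.
pose sz (v : homog Qinf) := 
  match v with inl f => size (f : {poly rat}) | inr f => size (f : {poly rat}) end.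
pose e := (\max_i sz (u i))%N; exists e.
have ue i : (sz (u i) <= e)%N by exact: leq_bigmax.
clearbody e.
suff h (s : seq 'I_n) (w : 'I_n -> homog Qinf) :
    (forall i, (sz (w i) <= e)%N) ->
    (forall i, i \notin s -> exists2 a, w i = lett a & (a.2 < e)%N) ->
    bounded_words e (sgval (SGen Pm w)).
  by apply: (h (enum 'I_n)) => // i; rewrite mem_enum.
elim: s w => [|i s IHs] w we hw.
  have /choice[c hc] : forall i, exists a, w i = lett a /\ (a.2 < e)%N.
    by move=> i; have [//|a' ? ?] := hw i; exists a'.
  apply: lspan_mem; exists n, m, Pm, c; split=> [i|]; first by case: (hc i).
  by congr sgval; apply: sgen_eq => //; apply/funext => i; case: (hc i).
have step a' : (a'.2 < e)%N -> bounded_words e (sgval (SGen Pm (upd w i (lett a')))).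
  move=> ae; apply: IHs => j.
    rewrite /upd; case: eqP => // _.
    by rewrite /lett /sz; case: (a'.1); rewrite size_polyXn.
  rewrite /upd; case: eqP => [->|/eqP ji] js; first by exists a'.
  by apply: hw; rewrite inE negb_or ji.
rewrite -(upd_same w i); case wi: (w i) => [f|f]; have fe := we i; rewrite wi /= in fe.
  have -> : f = \sum_(k < e) f`_k *: 'X^k.
    rewrite -poly_def; apply/polyP => k; rewrite coef_poly; case: ltnP => // ek.
    by rewrite nth_default // (leq_trans fe).
  elim/big_rec: _ => [|k y _ IHy].
    by have := sgval_args0 Pm w i false => /= ->; exact: lspan0.
  rewrite (sr_even (sgvalP _ _)); apply: lspan_lin => //.
  by apply: (step (false, k : nat)); case: k.
have -> : f = \sum_(k < e) f`_k *: 'X^k.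
  rewrite -poly_def; apply/polyP => k; rewrite coef_poly; case: ltnP => // ek.
  by rewrite nth_default // (leq_trans fe).
elim/big_rec: _ => [|k y _ IHy].
  by have := sgval_args0 Pm w i true => /= ->; exact: lspan0.
rewrite (sr_odd (sgvalP _ _)); apply: lspan_lin => //.
by apply: (step (true, k : nat)); case: k.
Qed.

Lemma bounded_words_mul e x y : bounded_words e x -> bounded_words e y -> bounded_words e (x * y).
Proof.
move=> hx hy; elim/lspan_ind: x / hx => [|a _ x [n [m [Pm [c [hc ->]]]]] IHx].
  by rewrite mul0r; exact: lspan0.
rewrite super_mulDZl; apply: lspan_lin => //.
elim/lspan_ind: y / hy {IHx} => [|b _ y [k [m' [Pm' [c' [hc' ->]]]]] IHy].
  by rewrite mulr0; exact: lspan0.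
rewrite super_mulDZr; apply: lspan_cons => //.
exists (n + k)%N, (op_mul m m'), (op_mulP Pm Pm'), (args_cat c c'); split.
  by move=> i; case: (split_ordP i) => j ->; rewrite ?args_catl ?args_catr.
rewrite /word sgval_mul; congr sgval; apply: sgen_eq => //=; apply/funext => i.
by case: (split_ordP i) => j ->; rewrite ?args_catl ?args_catr.
Qed.

Lemma bounded_words_pow e x k : bounded_words e x -> bounded_words e (x ^+ k).
Proof.
move=> hx; elim: k => [|k IH]; last by rewrite exprS; exact: bounded_words_mul.
rewrite expr0; apply: lspan_mem; exists 0%N, (tone A _), (tone_multilinear A), (fun=> (false, 0%N)).
split=> [[]//|]; by congr sgval; apply: sgen_eq => //; apply/funext => -[].
Qed.

(** For letters of equal parity, this is the elementary matrix sending [x] to [y], restricted to the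
    summand of parity [p]. *)
Definition subst_poly (p : bool) (x y : letter) (f : {poly rat}) : {poly rat} :=
  (if p == x.1 then f`_(x.2) else 0) *: 'X^(y.2).

Lemma subst_poly_linear p x y : linear (subst_poly p x y).
Proof.
move=> a f g; rewrite /subst_poly scalerA -scalerDl; congr (_ *: _).
by case: ifP => _; rewrite ?coefD ?coefZ ?mulr0 ?addr0.
Qed.

Definition subst_letter x y : {linear S -> S} :=
  @deriv A Qinf (linear_fun_of (subst_poly_linear false x y))
                (linear_fun_of (subst_poly_linear true x y)).

Lemma subst_letter_word x y n (m : A 'rV[rat]_n) (Pm : multilinear_op m) c : x.1 = y.1 ->
  subst_letter x y (word Pm c) = \sum_(i | c i == x) word Pm (upd c i y).
Proof.
move=> xy; rewrite /subst_letter deriv_sgval /sgen_deriv [RHS]big_mkcond; apply: eq_bigr => i _ /=.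
rewrite -(sgval_args0 Pm (fun i => lett (c i)) i (c i).1) word_upd.
rewrite -(fun_if (fun z => sgval (SGen Pm (upd (fun i => lett (c i)) i z)))).
congr sgval; apply: sgen_eq => //; congr upd; rewrite /linear_fun_of.
move: x y (c i) xy => [p x] [q y] [r k] /= ->; rewrite /lett xpair_eqE /= /subst_poly /=.
case: r; case: q => /=; rewrite /linear_fun_of /subst_poly /= ?scale0r // coefXn [x == k]eq_sym.
  by case: (k == x); rewrite ?scale1r ?scale0r.
by case: (k == x); rewrite ?scale1r ?scale0r.
Qed.

Lemma take_poly_linear e : linear (@take_poly rat e).
Proof. by move=> a f g; rewrite take_polyD take_polyZ. Qed.

(** The Euler derivation, whose eigenvalue on a word in letters of exponent less than [e] is the
    arity. The truncation makes it kill the letters of larger exponent. *)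
Definition euler e : {linear S -> S} :=
  @deriv A Qinf (linear_fun_of (take_poly_linear e)) (linear_fun_of (take_poly_linear e)).

Lemma euler_word e n (m : A 'rV[rat]_n) (Pm : multilinear_op m) c :
  (forall i, (c i).2 < e)%N -> euler e (word Pm c) = n%:R *: word Pm c.
Proof.
move=> hc; rewrite /euler deriv_sgval /sgen_deriv /=.
rewrite (eq_bigr (fun=> word Pm c)) ?sumr_const ?card_ord ?scaler_nat // => i _.
congr sgval; apply: sgen_eq => //; rewrite -[RHS](upd_same _ i); congr upd.
have := hc i; rewrite /lett; case: (c i) => [[] k] /= ke;
  by rewrite /linear_fun_of take_poly_id // size_polyXn.
Qed.

End Words.

(** * Extraction of multilinear components *)

Section Arity.
Variable A : tca.
Local Notation S := (super_eval A Qinf).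

Definition arity_fun n (g : sgen A Qinf) : S := if sg_ar g == n then sgval g else 0.

Lemma arity_fun_rel n : super_rel (arity_fun n).
Proof.
split=> k.
- move=> a m m1 m2 Pm Pm1 Pm2 u e; rewrite /arity_fun /=.
  by case: ifP => _; [exact: (sr_op (sgvalP _ _))|rewrite scaler0 addr0].
- move=> m Pm u i a x y; rewrite /arity_fun /=.
  by case: ifP => _; [exact: (sr_even (sgvalP _ _))|rewrite scaler0 addr0].
- move=> m Pm u i a x y; rewrite /arity_fun /=.
  by case: ifP => _; [exact: (sr_odd (sgvalP _ _))|rewrite scaler0 addr0].
move=> m i j Pm Pm' u ij; rewrite /arity_fun /=.
by case: ifP => _; [exact: (sr_sym (sgvalP _ _))|rewrite scaler0].
Qed.

Definition arity_part n : {linear S -> S} := ulift (arity_fun_rel n).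

Lemma arity_part_word n k (m : A 'rV[rat]_k) (Pm : multilinear_op m) c :
  arity_part n (word Pm c) = if k == n then word Pm c else 0.
Proof. exact: ulift_gen. Qed.

(** Applying [f - k] removes the component of eigenvalue [k] and multiplies the others by nonzero
    numbers. *)
Lemma eigenvector_components (f : {linear S -> S}) (N : S -> Prop) (s : seq nat) (zf : nat -> S) :
  closed_lin N -> (forall z, N z -> N (f z)) -> (forall n, f (zf n) = n%:R *: zf n) ->
  uniq s -> N (\sum_(n <- s) zf n) -> forall n, n \in s -> N (zf n).
Proof.
move=> Nlin Nf; elim: s zf => // k s IH zf zfE /= /andP[ks us]; rewrite big_cons => Nz.
have Ns n : n \in s -> N (zf n).
  move=> ns; have nk : (n%:R - k%:R : rat) != 0.
    by rewrite subr_eq0 eqr_nat; apply: contraNneq ks => <-.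
  apply: (closed_linZI Nlin nk).
  apply: (IH (fun n => (n%:R - k%:R) *: zf n)) => //.
    by move=> l; rewrite linearZ /= zfE !scalerA mulrC.
  have -> : \sum_(l <- s) (l%:R - k%:R) *: zf l =
      f (zf k + \sum_(l <- s) zf l) - k%:R *: (zf k + \sum_(l <- s) zf l).
    rewrite linearD zfE linear_sum scalerDr opprD addrACA subrr add0r scaler_sumr -sumrB.
    by apply: eq_bigr => l _; rewrite zfE scalerBl.
  by apply: (closed_linB Nlin); [exact: Nf|exact: closed_linZ].
move=> n; rewrite inE => /orP[/eqP ->|/Ns //].
rewrite -[zf k](addrK (\sum_(l <- s) zf l)); apply: (closed_linB Nlin) => //.
by rewrite big_seq; apply: (closed_lin_sum Nlin) => l /Ns.
Qed.

End Arity.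

Section Components.
Variables (A : tca) (e e2 : nat) (N : super_eval A Qinf -> Prop).
Local Notation S := (super_eval A Qinf).
Hypothesis ee2 : (e <= e2)%N.
Hypothesis Nlin : closed_lin N.
Hypothesis Nderiv : forall f0 f1 : {linear {poly rat} -> {poly rat}},
  (forall k, (e <= k)%N -> f0 'X^k = 0 /\ f1 'X^k = 0) ->
  forall z, N z -> N (@deriv A Qinf f0 f1 z).

(** The word [z] may repeat letters; [N] is required of the same operation at distinct fresh
    letters, from which the operation can be recovered. *)
Definition freshened n (z : S) := exists (m : A 'rV[rat]_n) (Pm : multilinear_op m)
  (c b : 'I_n -> letter),
  [/\ injective b, forall i, (e2 <= (b i).2)%N, forall i, (b i).1 = (c i).1,
      N (word Pm b) & z = word Pm c].

(* The letters of exponent at least [e] are fresh: they are pairwise distinct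
   and of the form X^(e2 + a), with parity given by [pi]. *)
Definition marked (pi : seq bool) n (c : 'I_n -> letter) :=
  [/\ forall i, (e <= (c i).2)%N ->
        exists2 a, (a < size pi)%N & c i = (nth false pi a, e2 + a)%N,
      forall i j, (e <= (c i).2)%N -> (c i).2 = (c j).2 -> i = j
    & (#|[set i | (c i).2 < e]| + size pi = n)%N].

Definition marked_word pi n (z : S) := exists (m : A 'rV[rat]_n) (Pm : multilinear_op m)
  (c : 'I_n -> letter), marked pi c /\ z = word Pm c.

Lemma subst_letter_mem x y z : (x.2 < e)%N -> N z -> N (subst_letter A x y z).
Proof.
move=> xe; apply: Nderiv => k ek.
have kx : (x.2 == k) = false by apply/negbTE; rewrite neq_ltn (leq_trans xe).
have E : ('X^k : {poly rat})`_(x.2) = 0 by rewrite coefXn kx.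
have F p : subst_poly p x y 'X^k = 0 by rewrite /subst_poly E if_same scale0r.
by split; exact: F.
Qed.

Lemma euler_mem z : N z -> N (euler A e z).
Proof.
apply: Nderiv => k ek.
have F : take_poly e 'X^k = 0 :> {poly rat}.
  apply/polyP => i; rewrite coef_take_poly coefXn coef0; case: ltnP => // ie.
  by case: eqP => // ik; move: ie; rewrite ik ltnNge ek.
by split; exact: F.
Qed.

(** Substitution only affects the letters [c]; [m] and [b] stay, parities being preserved. *)
Lemma freshened_subst n x y z : x.1 = y.1 ->
  lspan (@freshened n) z -> lspan (@freshened n) (subst_letter A x y z).
Proof.
move=> xy; elim/lspan_ind => [|a _ w [m [Pm [c [b [bi be bc Nb ->]]]]] IH].
  by rewrite linear0; exact: lspan0.
rewrite linearP; apply: lspan_lin => //; rewrite subst_letter_word //.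
apply: (closed_lin_sum (lspan_closed_lin _)) => i /eqP ci; apply: lspan_mem.
exists m, Pm, (upd c i y), b; split=> // j.
by rewrite /upd; case: eqP => [->|//]; rewrite bc ci.
Qed.

(** With every letter fresh, the words of [z] have the same letters up to order. Permuting arguments
    merges them into one operation at [b], so that [N z] is the condition required of it. *)
Lemma marked_word_all pi n z : size pi = n -> N z ->
  lspan (@marked_word pi n) z -> lspan (@freshened n) z.
Proof.
move=> sn Nz hz.
pose b (i : 'I_n) : letter := (nth false pi i, e2 + i)%N.
have binj : injective b by move=> i j [_ /addnI ij]; exact: val_inj.
suff [m [Pm zE]] : exists (m : A 'rV[rat]_n) (Pm : multilinear_op m), z = word Pm b.
  apply: lspan_mem; exists m, Pm, b, b; split=> //; last by rewrite -zE.
  by move=> i; rewrite leq_addr.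
elim/lspan_ind: z / hz {Nz} => [|a _ z [m [Pm [c [[hc1 hc2 hc3] ->]]]] [m' [Pm' ->]]].
  have P0 := (multilinear_op_closed_lin A n).1; exists 0, P0.
  have := sr_op (sgvalP A Qinf) (a := -1) P0 P0 P0 (fun i => lett (b i)).
  rewrite scaler0 addr0 scaleN1r addNr => /(_ erefl).
  by move=> <-.
have old0 i : (e <= (c i).2)%N.
  have /eqP : #|[set i | (c i).2 < e]%N| = 0%N by apply/eqP; rewrite -(eqn_add2r (size pi)) hc3 sn.
  by rewrite cards_eq0 => /eqP/setP/(_ i); rewrite !inE ltnNge => /negbFE.
have /choice[t ht] : forall i, exists j : 'I_n, c i = b j.
  move=> i; have [a' a'n ca] := hc1 i (old0 i); rewrite sn in a'n.
  by exists (Ordinal a'n).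
have tinj : injective t by move=> i j tij; apply: hc2 => //; rewrite !ht tij.
pose s := perm tinj.
have Ps := perm_op_multilinear s Pm.
have := sgval_perm Pm Ps (fun i => lett (b i)).
set kz := koszul _ _ _ => E.
have kz0 : kz != 0 by exact: koszul_neq0.
have {}E : word Pm c = kz^-1 *: word Ps b.
  rewrite /word E scalerA mulVf // scale1r; congr sgval; apply: sgen_eq => //.
  by apply/funext => i /=; rewrite permE ht.
rewrite E scalerA.
have Pn := (multilinear_op_closed_lin A n).2 (a * kz^-1) _ _ Ps Pm'.
exists ((a * kz^-1) *: perm_op m s + m'), Pn.
by apply/esym/(sr_op (sgvalP A Qinf)).
Qed.

(* [z] is [k.+1^-1] times the sum over the old letters [x] of the elements obtained by
   substituting in [z] a fresh letter for one occurrence of [x], and then [x] for it. *)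
Lemma marked_word_freshened k pi n z : (k + size pi)%N = n -> N z ->
  lspan (@marked_word pi n) z -> lspan (@freshened n) z.
Proof.
elim: k pi z => [|k IH] pi z kn Nz hz; first exact: marked_word_all hz.
pose y (p : bool) : letter := (p, e2 + size pi)%N.
have zE : z = k.+1%:R^-1 *: \sum_(p : bool) \sum_(x < e)
    subst_letter A (y p) (p, x : nat) (subst_letter A (p, x : nat) (y p) z).
  apply: (canRL (scalerK _)); first by rewrite pnatr_eq0.
  elim/lspan_ind: z / hz {Nz} => [|a _ z [m [Pm [c [[hc1 hc2 hc3] ->]]]] IHz].
    by rewrite scaler0 big1 // => p _; rewrite big1 // => x _; rewrite !linear0.
  rewrite scalerDr IHz !scalerA [_ * a]mulrC -scalerA.
  have -> : k.+1%:R *: word Pm c = \sum_(p : bool) \sum_(x < e)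
      subst_letter A (y p) (p, x : nat) (subst_letter A (p, x : nat) (y p) (word Pm c)).
    (* The fresh letter does not occur in [c]; after the first substitution it occurs exactly once,
       and substituting back restores the word. *)
    have E p (x : 'I_e) : subst_letter A (y p) (p, x : nat)
        (subst_letter A (p, x : nat) (y p) (word Pm c)) =
        \sum_(i | c i == (p, x : nat)) word Pm c.
      rewrite subst_letter_word // linear_sum; apply: eq_bigr => i /eqP ci.
      rewrite /= subst_letter_word // (big_pred1 i) => [|j].
        by rewrite upd_upd -ci upd_same.
      rewrite /=; have [->|ji] := eqVneq j i; first by rewrite upd_eq eqxx.
      rewrite upd_neq //; apply/negbTE/eqP => cj.
      have ej : (e <= (c j).2)%N by rewrite cj /= (leq_trans ee2) ?leq_addr.
      have [a' a'n] := hc1 j ej; rewrite cj => -[_ /addnI h].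
      by rewrite -h ltnn in a'n.
    under eq_bigr do under eq_bigr do rewrite E.
    have -> : k.+1 = #|[set i | (c i).2 < e]%N|.
      by apply/eqP; rewrite -(eqn_add2r (size pi)) hc3 kn.
    rewrite pair_big /= (exchange_big_dep predT) //= scaler_nat -sumr_const.
    rewrite [RHS](bigID (fun i => (c i).2 < e)%N) /= [X in _ + X]big1 ?addr0.
      apply: eq_big => i; first by rewrite inE.
      rewrite inE => ci; rewrite (big_pred1 ((c i).1, Ordinal ci)) //.
    move=> i ci; apply: big_pred0 => -[p x] /=; apply/negbTE; apply: contra ci => /eqP ->.
    by rewrite /= ltn_ord.
  rewrite scaler_sumr -big_split; apply: eq_bigr => p _.
  rewrite scaler_sumr -big_split; apply: eq_bigr => x _ /=.
  by rewrite !linearP.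
rewrite zE; apply: (closed_linZ (lspan_closed_lin _)).
apply: (closed_lin_sum (lspan_closed_lin _)) => p _.
apply: (closed_lin_sum (lspan_closed_lin _)) => x _.
apply: freshened_subst => //; apply: (IH (rcons pi p)).
- by rewrite size_rcons addnS -addSn.
- by apply: subst_letter_mem => //; exact: (ltn_ord x).
elim/lspan_ind: z / hz {Nz zE} => [|a _ z [m [Pm [c [[hc1 hc2 hc3] ->]]]] IHz].
  by rewrite linear0; exact: lspan0.
rewrite linearP; apply: lspan_lin => //; rewrite subst_letter_word //.
apply: (closed_lin_sum (lspan_closed_lin _)) => i /eqP ci; apply: lspan_mem.
exists m, Pm, (upd c i (y p)); split=> //; split.
- move=> j; rewrite /upd; case: eqP => [_ _|_ /hc1[a' a'n ->]].
    by exists (size pi); rewrite ?size_rcons // nth_rcons ltnn eqxx.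
  by exists a'; rewrite ?size_rcons ?ltnS 1?ltnW // nth_rcons a'n.
- have fresh l : (c l).2 != (e2 + size pi)%N.
    apply/eqP => cl; have [|a' a'n ca] := hc1 l; first by rewrite cl (leq_trans ee2) ?leq_addr.
    by move: cl; rewrite ca => /addnI h; rewrite h ltnn in a'n.
  move=> j l; rewrite /upd; case: eqP => [->|_]; case: eqP => [-> //|_] //=.
  + by move=> _ h; have := fresh l; rewrite -h eqxx.
  + by move=> _ h; have := fresh j; rewrite h eqxx.
  exact: hc2.
rewrite size_rcons addnS -addSn -[RHS]hc3; congr (_ + _)%N.
rewrite [RHS](cardsD1 i) inE ci /= ltn_ord add1n; congr (_.+1).
apply: eq_card => j; rewrite !inE /upd; case: eqP => [_|//] /=.
by rewrite ltnNge (leq_trans ee2) ?leq_addr.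
Qed.

(** The Euler derivation separates the arities without leaving [N]; each arity component then starts
    with no fresh letter, that is, with [pi] empty. *)
Lemma component_extraction z : bounded_words e z -> N z ->
  lspan (fun y => exists n, @freshened n y) z.
Proof.
move=> hz Nz.
have [B zE] : exists B, forall B', (B <= B')%N -> z = \sum_(n <- iota 0 B') arity_part A n z.
  elim/lspan_ind: z / hz {Nz} => [|a _ z [k [m [Pm [c [hc ->]]]]] [B IH]].
    by exists 0%N => B' _; rewrite big1 // => n _; rewrite linear0.
  exists (maxn k.+1 B) => B'; rewrite geq_max => /andP[kB' BB'].
  under eq_bigr do rewrite linearP arity_part_word.
  rewrite big_split /= -IH // -scaler_sumr; congr (_ *: _ + _).
  rewrite (bigD1_seq k) ?iota_uniq ?mem_iota //= eqxx big1 ?addr0 // => n.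
  by rewrite eq_sym => /negbTE ->.
have hA n : lspan (@marked_word [::] n) (arity_part A n z).
  elim/lspan_ind: z / hz {Nz zE} => [|a _ z [k [m [Pm [c [hc ->]]]]] IH].
    by rewrite linear0; exact: lspan0.
  rewrite linearP; apply: lspan_lin => //; rewrite arity_part_word.
  case: eqP => [kn|_]; last exact: lspan0.
  case: _ / kn; apply: lspan_mem; exists m, Pm, c; split=> //; split.
  - by move=> i; rewrite leqNgt hc.
  - by move=> i j; rewrite leqNgt hc.
  by rewrite addn0 -[RHS]card_ord -cardsT; apply: eq_card => i; rewrite !inE hc.
have eulerE n : euler A e (arity_part A n z) = n%:R *: arity_part A n z.
  elim/lspan_ind: z / hz {Nz zE hA} => [|a _ z [k [m [Pm [c [hc ->]]]]] IH].
    by rewrite !linear0.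
  rewrite !linearP IH arity_part_word; congr (_ *: _ + _).
  case: eqP => [<-|_]; last by rewrite !linear0.
  by rewrite euler_word.
have NA n : n \in iota 0 B -> N (arity_part A n z).
  apply: (eigenvector_components Nlin euler_mem eulerE (iota_uniq _ _)).
  by rewrite -zE.
rewrite (zE B) // big_seq; apply: (closed_lin_sum (lspan_closed_lin _)) => n nB.
apply: (@lspan_sub _ (@freshened n)) => [y hy|]; first by apply: lspan_mem; exists n.
by apply: (@marked_word_freshened n [::]) => //; rewrite ?addn0 //; exact: NA.
Qed.

End Components.

(** * The theorem *)

Section NilpotentFamilies.
Variables (A : tca) (I : setfam A) (hI : gl_ideal I).
Implicit Types (S T : setfam A) (V : lmodType rat).

Definition tprod V (s : seq (A V)) : A V := \big[@tmul A V/tone A V]_(x <- s) x.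

Lemma tprod_cons V (x : A V) s : tprod (x :: s) = tmul x (tprod s).
Proof. exact: big_cons. Qed.

Lemma tprod_cat V (s t : seq (A V)) : tprod (s ++ t) = tmul (tprod s) (tprod t).
Proof. exact: big_cat. Qed.

(** Arbitrary families are allowed, so that nilpotency can be checked on generators, by
    [nilfam_span]. *)
Definition nilfam S n := forall V (s : seq (A V)), size s = n ->
  (forall x, x \in s -> S V x) -> I (tprod s).

Let Ilin V : closed_lin (@I V).
Proof. exact: subfunctor_closed_lin hI.1. Qed.

Lemma tmul0 V (x : A V) : tmul 0 x = 0.
Proof. by rewrite tmulC; have := tmulZr x 0 0; rewrite !scale0r. Qed.

Lemma gl_ideal_mull V (x y : A V) : I y -> I (tmul x y).
Proof. exact: hI.2. Qed.

Lemma gl_ideal_mulr V (x y : A V) : I x -> I (tmul x y).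
Proof. by rewrite tmulC; exact: hI.2. Qed.

Lemma nilfam_pow S n : subfam (fam_pow S n) I <-> nilfam S n.
Proof.
split=> h V.
  move=> s sn hs; apply: h; elim: n s sn hs => [[]// _ _|n IH [//|x s] /= [sn] hs].
    by rewrite /tprod big_nil; apply: lspan_mem.
  rewrite tprod_cons; apply: lspan_mem; exists x, (tprod s); split=> //.
    by apply: hs; rewrite mem_head.
  by apply: IH => // y ys; apply: hs; rewrite inE ys orbT.
suff g k (s : seq (A V)) y : (size s + k)%N = n -> (forall x, x \in s -> S V x) ->
    fam_pow S k y -> I (tmul (tprod s) y).
  move=> y /(g n [::] y (add0n _)); rewrite /tprod big_nil tmul1; exact.
elim: k s y => [|k IH] s y sk hs.
  elim/lspan_ind => [|a _ z -> IHz]; first by rewrite tmulC tmul0; exact: (Ilin _).1.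
  rewrite tmul_linear_r; apply: (Ilin _).2 => //.
  by rewrite tmulC tmul1; apply: h => //; rewrite -sk addn0.
elim/lspan_ind => [|a _ z [u [w [Su Sw ->]]] IHz]; first by rewrite tmulC tmul0; exact: (Ilin _).1.
rewrite tmul_linear_r; apply: (Ilin _).2 => //.
rewrite tmulA [tmul (tprod s) u]tmulC -tprod_cons; apply: IH => //.
  by rewrite /= addSn -addnS.
by move=> x; rewrite inE => /orP[/eqP ->|/hs].
Qed.

(** In the expansion of a product of [a + b] sums, each term has at least [a] factors from [S] or at
    least [b] from [T]; [s1] and [s2] collect the factors already chosen. *)
Lemma nilfam_sum S T a b : nilfam S a -> nilfam T b ->
  nilfam (fun V x => exists y z, [/\ S V y, T V z & x = y + z]) (a + b).
Proof.
move=> hS hT V s sn hs.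
suff g (s1 s2 : seq (A V)) : (size s + size s1 + size s2)%N = (a + b)%N ->
    (forall x, x \in s1 -> S V x) -> (forall x, x \in s2 -> T V x) ->
    I (tmul (tprod s) (tmul (tprod s1) (tprod s2))).
  have := g [::] [::]; rewrite /= !addn0 => /(_ sn).
  by rewrite /tprod !big_nil tmul1 tmulC tmul1; apply.
elim: s hs {sn} s1 s2 => [|x s IH] hs s1 s2 /= sn h1 h2.
  apply: gl_ideal_mull; have [as1|as1] := leqP a (size s1).
    apply: gl_ideal_mulr; rewrite -(cat_take_drop a s1) tprod_cat; apply: gl_ideal_mulr.
    by apply: hS => [|y /mem_take/h1 //]; rewrite size_takel.
  apply: gl_ideal_mull; rewrite -(cat_take_drop b s2) tprod_cat; apply: gl_ideal_mulr.
  by apply: hT => [|y /mem_take/h2 //]; rewrite size_takel //; lia.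
have [y [z [Sy Tz ->]]] := hs x (mem_head _ _).
have {}IH := IH (fun w ws => hs w (mem_behead (s := _ :: _) ws)).
rewrite tprod_cons -tmulA -[y]scale1r tmul_linear; apply: (Ilin _).2.
  rewrite tmulA [tmul y _]tmulC -tmulA [tmul y _]tmulA -(tprod_cons y).
  apply: IH => //=; first by lia.
  by move=> w; rewrite inE => /orP[/eqP ->|/h1].
rewrite tmulA [tmul z _]tmulC -tmulA [tmul z _]tmulA [tmul z _]tmulC -tmulA -(tprod_cons z).
apply: IH => //=; first by lia.
by move=> w; rewrite inE => /orP[/eqP ->|/h2].
Qed.

Lemma nilfam_span (G : setfam A) n : nilfam G n -> nilfam (fun V => lspan (@G V)) n.
Proof.
move=> hG V s sn hs.
suff g (s2 : seq (A V)) : (size s + size s2)%N = n -> (forall x, x \in s2 -> G V x) ->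
    I (tmul (tprod s) (tprod s2)).
  by have := g [::]; rewrite /= addn0 => /(_ sn); rewrite /tprod !big_nil tmulC tmul1; apply.
elim: s hs {sn} s2 => [|x s IH] hs s2 /= sn h2.
  by apply: gl_ideal_mull; exact: hG.
have {}IH := IH (fun w ws => hs w (mem_behead (s := _ :: _) ws)).
rewrite tprod_cons -tmulA.
have Gx : lspan (@G V) x by apply: hs; rewrite mem_head.
elim/lspan_ind: x / Gx {hs} => [|a y z Gy Iz].
  by rewrite tmul0; exact: (Ilin _).1.
rewrite tmul_linear; apply: (Ilin _).2 => //.
rewrite tmulA [tmul y _]tmulC -tmulA -(tprod_cons y); apply: IH => //=; first by lia.
by move=> w; rewrite inE => /orP[/eqP ->|/h2].
Qed.

(** A sum of two nilpotent subrepresentations is nilpotent, so one of them suffices for a whole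
    linear combination. *)
Lemma gl_radP V (x : A V) :
  gl_rad I x <-> exists S n, [/\ subfunctor S, nilfam S n & S V x].
Proof.
split; last by move=> [S [n [PS /nilfam_pow nS Sx]]]; apply: lspan_mem; exists S, n.
elim/lspan_ind => [|a y z [S [n [PS /nilfam_pow nS Sy]]] [T [k [PT nT Tz]]]].
  by exists I, 1%N; split; [exact: hI.1| |exact: (Ilin _).1] => W [|u []] //= _ h;
    rewrite tprod_cons; apply: gl_ideal_mulr; apply: h; rewrite mem_head.
exists (fun V x => exists y z, [/\ S V y, T V z & x = y + z]), (n + k)%N; split.
- have [S0 SD Sf] := PS; have [T0 TD Tf] := PT; split.
  + by move=> W; exists 0, 0; rewrite addr0.
  + move=> W b _ _ [y1 [z1 [Sy1 Tz1 ->]]] [y2 [z2 [Sy2 Tz2 ->]]].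
    exists (b *: y1 + y2), (b *: z1 + z2); split; [exact: SD|exact: TD|].
    by rewrite scalerDr addrACA.
  move=> W W' f _ [y1 [z1 [Sy1 Tz1 ->]]]; exists (fmap A f y1), (fmap A f z1).
  by split; [exact: Sf|exact: Tf|rewrite linearD].
- exact: nilfam_sum.
by exists (a *: y), z; split=> //; exact: (closed_linZ (subfunctor_closed_lin V PS)).
Qed.

Lemma gl_rad_sub : subfam I (gl_rad I).
Proof.
move=> V x Ix; apply/gl_radP; exists I, 1%N; split=> //; first exact: hI.1.
move=> W [|u []] //= _ h; rewrite tprod_cons; apply: gl_ideal_mulr.
by apply: h; rewrite mem_head.
Qed.

Lemma nilfam_gl_rad S n : subfunctor S -> nilfam S n -> subfam S (gl_rad I).
Proof. by move=> PS nS V x Sx; apply/gl_radP; exists S, n. Qed.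

Lemma gl_rad_ideal : gl_ideal (gl_rad I).
Proof.
split; first split.
- by move=> V; exact: lspan0.
- by move=> V a x y; exact: lspan_lin.
- move=> V W f x /gl_radP[S [n [PS nS Sx]]]; apply/gl_radP; exists S, n; split=> //.
  by case: PS => _ _; exact.
move=> V x y /gl_radP[S [n [PS nS Sy]]].
pose G : setfam A := fun V z => exists x y, S V y /\ z = tmul x y.
apply/gl_radP; exists (fun V => lspan (@G V)), n; split.
- split; [by move=> W; exact: lspan0|by move=> W a u w; exact: lspan_lin|].
  move=> W W' f u; elim/lspan_ind => [|a _ w [x' [y' [Sy' ->]]] IH].
    by rewrite linear0; exact: lspan0.
  rewrite linearP tmul_nat; apply: lspan_cons => //; exists (fmap A f x'), (fmap A f y').
  by split=> //; case: PS => _ _; exact.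
- apply: nilfam_span => W s sn hs.
  suff [s' [s'n hs' [u ->]]] : exists s' : seq (A W), [/\ size s' = n, forall x, x \in s' -> S W x &
      exists u, tprod s = tmul u (tprod s')] by apply: gl_ideal_mull; exact: nS.
  elim: s n sn hs {nS} => [|z s IH] n /= <- hs.
    by exists [::]; split=> //; exists (tone A W); rewrite tmul1.
  have [x' [y' [Sy' zE]]] := hs z (mem_head _ _).
  have [s' [s'n hs' [u sE]]] := IH _ erefl (fun w ws => hs w (mem_behead (s := _ :: _) ws)).
  exists (y' :: s'); split=> /=; first by rewrite s'n.
    by move=> w; rewrite inE => /orP[/eqP ->|/hs'].
  exists (tmul x' u); rewrite !tprod_cons sE zE -!tmulA; congr tmul.
  by rewrite !tmulA [tmul y' u]tmulC.
by apply: lspan_mem; exists x, y.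
Qed.

End NilpotentFamilies.

(** * The two implications *)

Section Main.
Variables (A : tca) (I : setfam A) (hI : gl_ideal I).
Local Notation U := Qinf.
Let K := @super_sub A I U.
Let R := radical K.

Definition generated (G : forall n, A 'rV[rat]_n -> Prop) : setfam A := fun V =>
  lspan (fun z => exists n (m : A 'rV[rat]_n) (v : 'I_n -> V), G n m /\ z = opval m v).

Lemma generated_subfunctor G : subfunctor (generated G).
Proof.
split; [by move=> W; exact: lspan0|by move=> W a u w; exact: lspan_lin|].
move=> W W' f u; elim/lspan_ind => [|a _ w [n [m [v [Gm ->]]]] IH].
  by rewrite linear0; exact: lspan0.
rewrite linearP fmap_opval; apply: lspan_cons => //.
by exists n, m, (fun i => f (v i)).
Qed.

Lemma generated_mem (G : forall n, A 'rV[rat]_n -> Prop) n (m : A 'rV[rat]_n) :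
  G n m -> generated G m.
Proof.
by move=> Gm; apply: lspan_mem; exists n, m, (fun i => delta_mx 0 i); rewrite opval_delta.
Qed.

Lemma super_gl_rad_radical (g : sgen A U) : gl_rad I (sg_op g) -> R (sgval g).
Proof.
move=> /(gl_radP hI)[S [n [PS nS Sg]]]; exists n; rewrite sgval_pow.
apply: lspan_mem; exists (sgen_pow g n); split=> //.
have nS' := (nilfam_pow hI S n).2 nS; apply: nS'.
have [_ _ Sf] := PS.
have Pf k (V W : lmodType rat) (f : {linear V -> W}) x : fam_pow S k x -> fam_pow S k (fmap A f x).
  elim: k V W f x => [|k IH] V W f x; elim/lspan_ind.
  - by rewrite linear0; exact: lspan0.
  - move=> a _ y -> IHy; rewrite linearP tone_nat; exact: lspan_cons.
  - by rewrite linear0; exact: lspan0.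
  move=> a _ y [u [w [Su Sw ->]]] IHy; rewrite linearP tmul_nat; apply: lspan_cons => //.
  by exists (fmap A f u), (fmap A f w); split=> //; [exact: Sf|exact: IH].
elim: n {nS} => [|n IH]; first exact: lspan_mem.
apply: lspan_mem; eexists; eexists; split; [| |reflexivity]; first exact: Sf.
exact: Pf.
Qed.

(** By [mspan_polynomial] it suffices to treat the multilinear operations [m] in [S]. The values of
    [m] at letters of all parities come from [S], so the hypothesis provides the nilpotency required
    for every [e]. *)
Lemma radical_sub_gl_rad (S : setfam A) : subfunctor S ->
  (forall g : sgen A U, S _ (sg_op g) -> R (sgval g)) -> subfam S (gl_rad I).
Proof.
move=> PS hS V x Sx.
have Jlin := subfunctor_closed_lin V (gl_rad_ideal hI).1.
have [_ _ Jf] := (gl_rad_ideal hI).1.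
have := mspan_polynomial (tca_polynomial A) PS Sx.
apply: (closed_lspan Jlin) => _ [d [m [v [Sm Pm ->]]]]; apply: Jf.
have [|N hN] := slots_vanish_nilpotent hI (m := m).
  by apply: (slots_vanish_enum hI (Pm := Pm)) => e; apply: hS.
have castm : opval m (fun j => delta_mx 0 (cast_ord (erefl d) j)) = m.
  by rewrite -[RHS]opval_delta; congr opval; apply/funext => j; rewrite cast_ord_id.
(* [G] consists of [m] alone, transported along the equality of arities. *)
pose G n (m' : A 'rV[rat]_n) := exists e : d = n, m' = opval m (fun j => delta_mx 0 (cast_ord e j)).
apply: (@nilfam_gl_rad _ _ hI (generated G) N); first exact: generated_subfunctor.
  apply: (nilfam_span hI) => W s sN hs.
  have /choice[w hw] : forall i : 'I_N, exists w : 'I_d -> W, nth 0 s i = opval m w.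
    move=> i; have [|n [m' [u [[e me] ->]]]] := hs (nth 0 s i); first by rewrite mem_nth ?sN.
    by case: _ / e m' u me => _ u ->; exists u; rewrite castm.
  have := hN W w; congr (I _); rewrite /tprod (big_nth 0) sN big_mkord.
  by apply: eq_bigr => i _; rewrite hw.
by apply: generated_mem; exists erefl; rewrite castm.
Qed.

(** If 1 lies in [K], the unit at Q^0 lies in [I], and naturality along the map from Q^0 to [V] puts
    the unit at [V] in [I]. *)
Lemma radical_proper : (exists V x, ~ gl_rad I (V := V) x) -> ~ R 1.
Proof.
move=> [V [x nx]] [n]; rewrite expr1n => K1; apply: nx; apply: gl_rad_sub => //.
rewrite -[x]tmul1 tmulC; apply: hI.2.
have h : I (tone A 'rV[rat]_0).
  have b0inj : injective (fun _ : 'I_0 => (false, 0%N) : letter) by move=> [].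
  apply: (super_sub_distinct (Pm := tone_multilinear A) hI.1 b0inj).
  by move: K1; congr (super_sub I _); congr sgval; apply: sgen_eq => //; apply/funext => -[].
have [_ _ If] := hI.1.
by rewrite -(tone_nat A (\0 : {linear 'rV[rat]_0 -> V})); exact: If.
Qed.

Lemma prime_of_gl_prime : gl_prime (gl_rad I) -> prime_ideal R.
Proof.
move=> [_ ex prJ]; have idK := super_sub_ideal U hI; have [K0 KD Kl Kr] := idK.
have Klin : closed_lin K := super_sub_lin U I.
have idR := radical_ideal hI U; have [R0 RD Rl Rr] := idR.
split=> //; first by exists 1; exact: radical_proper.
(* Passing to even parts makes the first factor central, so that its powers can be moved past
   derivatives. *)
suff main f g : even_part _ _ f = f -> K (f * g) -> R f \/ R g.
  move=> x y /(even_part_mul_radical hI)[n].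
  rewrite exprMn_comm; last exact: even_part_central.
  case/main => [|[k h]|[k h]]; first exact: even_part_pow.
    by left; apply/(radical_even_part hI); exists (n * k)%N; rewrite exprM.
  by right; apply/(radical_even_part hI); exists (n * k)%N; rewrite exprM.
move=> fe fg.
have fcen k y : GRing.comm (f ^+ k) y by rewrite -fe -even_part_pow; exact: even_part_central.
have [e1 fe1] := bounded_wordsP f; have [e2' ge2] := bounded_wordsP g.
pose e := maxn e1 e2'.
have {}fe1 : bounded_words e f by apply: bounded_words_le fe1; rewrite leq_maxl.
have {}ge2 : bounded_words e g by apply: bounded_words_le ge2; rewrite leq_maxr.
pose Nf (y : super_eval A U) := exists k, K (f ^+ k * y).
have Nf_le y k k' : (k <= k')%N -> K (f ^+ k * y) -> K (f ^+ k' * y).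
  by move=> kk h; rewrite -(subnK kk) exprD -mulrA; exact: Kl.
have Nflin : closed_lin Nf.
  split; first by exists 0%N; rewrite mulr0.
  move=> a y z [k hk] [l hl]; exists (maxn k l); rewrite super_mulDZr; apply: Klin.2.
    by apply: Nf_le hk; rewrite leq_maxl.
  by apply: Nf_le hl; rewrite leq_maxr.
(* By Leibniz, f^(2k) D(y) = f^k D(f^k y) - D(f^k) f^k y; this is why [Nf] leaves the exponent
   free. *)
have Nfderiv (f0 f1 : {linear {poly rat} -> {poly rat}}) y : Nf y -> Nf (@deriv A U f0 f1 y).
  move=> [k hk]; exists (k + k)%N; rewrite exprD -mulrA.
  have := Kl (f ^+ k) _ (@deriv_sub A U f0 f1 I _ hk).
  rewrite deriv_mul mulrDr; set D := @deriv A U f0 f1 => h.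
  have FD : f ^+ k * (D (f ^+ k) * y) = D (f ^+ k) * (f ^+ k * y) by rewrite mulrA fcen -mulrA.
  rewrite -[_ * _](addKr (D (f ^+ k) * (f ^+ k * y))); apply: KD.
    by rewrite -mulNr; exact: Kl.
  by rewrite -FD.
have Nfg : Nf g by exists 1%N; rewrite expr1.
have hg := @component_extraction A e e Nf (leqnn _) Nflin (fun f0 f1 _ => @Nfderiv f0 f1) g ge2 Nfg.
pose comp (P : super_eval A U -> Prop) lo hi n (m : A 'rV[rat]_n) :=
  exists (Pm : multilinear_op m) (b : 'I_n -> letter),
  [/\ injective b, forall i, (lo <= (b i).2 < hi)%N & P (word Pm b)].
(* Only finitely many components occur in [g], so they share an exponent [k] and a bound [e2] on
   their letters; the components of f^k will use letters from [e2] on. *)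
have [k [e2 [ee2 {}hg]]] : exists k e2, (e <= e2)%N /\
    super_sub (fun V => generated (@comp (fun y => K (f ^+ k * y)) e e2) (V := V)) g.
  elim/lspan_ind: g / hg {fg ge2 Nfg} =>
    [|a _ z [n [m [Pm [c [b [bi be bc [k hk] ->]]]]]] [k' [e2 [ee2 IH]]]].
    by exists 0%N, e; split=> //; exact: lspan0.
  pose e3 := maxn e2 (\max_i (b i).2).+1.
  exists (maxn k k'), e3; split; first by rewrite leq_max ee2.
  apply: lspan_lin.
    apply: lspan_mem; exists (SGen Pm (fun i => lett (c i))); split=> //=.
    apply: generated_mem; exists Pm, b; split=> // [i|].
      by rewrite be leq_max ltnS (leq_bigmax i) orbT.
    by apply: Nf_le hk; rewrite leq_maxl.
  apply: lspan_sub IH => y [h [Gh ->]]; apply: lspan_mem; exists h; split=> //.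
  apply: lspan_sub Gh => w [l [m' [v [[Pm' [b' [b'i b'e Kb']]] ->]]]]; apply: lspan_mem.
  exists l, m', v; split=> //; exists Pm', b'; split=> // [i|].
    by have /andP[-> h2] := b'e i; rewrite leq_max h2.
  by apply: Nf_le Kb'; rewrite leq_maxr.
pose GM := @comp (fun y => K (f ^+ k * y)) e e2.
(* The common annihilator, modulo [K], of the words M(b). Derivations killing the letters of
   exponent at least [e] kill these words, so in Leibniz' rule only the derivative of [x]
   remains. *)
pose N2 (x : super_eval A U) := forall n (m : A 'rV[rat]_n)
    (Pm : multilinear_op m) (b : 'I_n -> letter),
  injective b -> (forall i, (e <= (b i).2 < e2)%N) -> K (f ^+ k * word Pm b) -> K (x * word Pm b).
have N2lin : closed_lin N2.
  split; first by move=> *; rewrite mul0r.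
  move=> a x y Nx Ny n m Pm b bi be Kb; rewrite super_mulDZl; apply: Klin.2; [exact: Nx|exact: Ny].
have N2deriv (f0 f1 : {linear {poly rat} -> {poly rat}}) :
    (forall k, (e <= k)%N -> f0 'X^k = 0 /\ f1 'X^k = 0) ->
    forall z, N2 z -> N2 (@deriv A U f0 f1 z).
  move=> f01 z Nz n m Pm b bi be Kb.
  have := @deriv_sub A U f0 f1 I _ (Nz _ _ _ _ bi be Kb); rewrite deriv_mul.
  suff -> : @deriv A U f0 f1 (word Pm b) = 0 by rewrite mulr0 addr0.
  rewrite deriv_sgval /sgen_deriv big1 // => i _.
  rewrite -(sgval_args0 Pm (fun i => lett (b i)) i (b i).1); congr sgval; apply: sgen_eq => //.
  congr upd; rewrite /lett /=; have /andP[eb _] := be i; have [h0 h1] := f01 _ eb.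
  by case: ((b i).1) => /=; rewrite ?h0 ?h1.
have N2f : N2 (f ^+ k) by [].
have hf := @component_extraction A e e2 N2 ee2 N2lin N2deriv _ (bounded_words_pow k fe1) N2f.
pose GL n (m : A 'rV[rat]_n) := exists (Pm : multilinear_op m) (b : 'I_n -> letter),
  [/\ injective b, forall i, (e2 <= (b i).2)%N & N2 (word Pm b)].
have fGL : super_sub (generated GL) (f ^+ k).
  apply: lspan_sub hf => _ [n [m [Pm [c [b [bi be bc N2b ->]]]]]]; apply: lspan_mem.
  exists (SGen Pm (fun i => lett (c i))); split=> //=; apply: generated_mem.
  by exists Pm, b.
have superJ (S : setfam A) x : subfam S (gl_rad I) -> super_sub S x -> R x.
  move=> SJ; elim/lspan_ind => [//|a _ y [h [Sh ->]] IH].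
  (* The ideal [R] is closed under multiplication by ring elements, so the scalar [a] is turned into
     a multiple of the unit. *)
  pose c : super_eval A U := a *: super_one A U + 0.
  have -> : a *: sgval h + y = c * sgval h + y.
    by rewrite /c super_mulDZl -[super_one A U]/(1 : super_eval A U) mul1r mul0r addr0.
  by apply: RD => //; apply: Rl; apply: super_gl_rad_radical; apply: SJ.
have := prJ _ _ (generated_subfunctor GL) (generated_subfunctor GM).
case.
- move=> V z; elim/lspan_ind => [|a _ w [x [y [Sx Ty ->]]] IH]; first exact: lspan0.
  apply: lspan_lin => //; apply: gl_rad_sub => //.
  have Il W := subfunctor_closed_lin W hI.1.
  elim/lspan_ind: x / Sx => [|c _ x [n [m [v [[Pm [b [bi be N2b]]] ->]]]] IHx].
    by rewrite tmul0; exact: (Il _).1.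
  rewrite tmul_linear; apply: (Il _).2 => //.
  elim/lspan_ind: y / Ty {IHx} => [|c' _ y [l [m' [v' [[Pm' [b' [b'i b'e Kb']]] ->]]]] IHy].
    by rewrite tmulC tmul0; exact: (Il _).1.
  rewrite tmul_linear_r; apply: (Il _).2 => //.
  have -> : tmul (opval m v) (opval m' v') = opval (op_mul m m') (args_cat v v').
    rewrite opval_mul; congr tmul; congr opval; apply/funext => i.
      by rewrite args_catl.
    by rewrite args_catr.
  have [_ _ If] := hI.1; apply: If.
  (* The letters [b] have exponents at least [e2], and the letters [b'] have exponents below it. *)
  have cinj : injective (args_cat b b').
    move=> i j; case: (split_ordP i) => i' ->; case: (split_ordP j) => j' ->;
      rewrite ?args_catl ?args_catr => ij.
    - by rewrite (bi _ _ ij).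
    - by have := be i'; rewrite ij; have /andP[_] := b'e j'; rewrite ltnNge => /negbTE ->.
    - by have := be j'; rewrite -ij; have /andP[_] := b'e i'; rewrite ltnNge => /negbTE ->.
    by rewrite (b'i _ _ ij).
  apply: (super_sub_distinct (Pm := op_mulP Pm Pm') hI.1 cinj).
  have := N2b _ _ _ _ b'i b'e Kb'; rewrite /word sgval_mul; congr (super_sub I _).
  congr sgval; apply: sgen_eq => //=; apply/funext => i.
  by case: (split_ordP i) => i' ->; rewrite ?args_catl ?args_catr.
- by move=> /superJ/(_ fGL)[l h]; left; exists (k * l)%N; rewrite exprM.
by move=> /superJ h; right; exact: h.
Qed.

(** If some value of an operation in [S] is outside [R], primality puts every value coming from [T]
    in [R], and [radical_sub_gl_rad] converts this into an inclusion of subrepresentations. *)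
Lemma gl_prime_of_prime : prime_ideal R -> gl_prime (gl_rad I).
Proof.
move=> [[R0 RD Rl Rr] [x0 nx0] prR].
split; first exact: gl_rad_ideal.
  exists 'rV[rat]_0, (tone A _) => h; apply: nx0; rewrite -[x0]mulr1; apply: Rl.
  exact: (@super_gl_rad_radical (sgen_one A U)).
move=> S T PS PT ST.
have [hS|nS] := pselect (forall g : sgen A U, S _ (sg_op g) -> R (sgval g)).
  by left; exact: radical_sub_gl_rad.
right; apply: radical_sub_gl_rad => // h Th.
have /existsNP[g /not_implyP[Sg nRg]] := nS.
have [_ _ Sf] := PS; have [_ _ Tf] := PT.
case: (prR (sgval g) (sgval h)) => //; rewrite sgval_mul; apply: super_gl_rad_radical.
apply: ST; apply: lspan_mem; rewrite /= op_mulE; eexists; eexists; split; last reflexivity.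
  exact: Sf.
exact: Tf.
Qed.

End Main.

Theorem theorem2 (A : tca) (I : setfam A) (hI : gl_ideal I) :
  gl_prime (gl_rad I) <-> prime_ideal (radical (@super_sub A I Qinf)).
Proof. by split; [exact: prime_of_gl_prime|exact: gl_prime_of_prime]. Qed.
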